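(* Let $(M,T,\mu)$ be a conservative ergodic infinite ($\sigma$-finite) measure preserving dynamical system, $\tau:M\to(0,+\infty)$ a measurable function with $0<\inf_M\tau\le\sup_M\tau<\infty$, and $(\mathcal M,(\varphi_t)_t,\nu)$ the suspension flow over $(M,T,\mu)$ with roof function $\tau$. Let $f:\mathbb R^d\times\mathcal M\to\mathbb R^d$ and $\overline f:\mathbb R^d\to\mathbb R^d$ be measurable, uniformly bounded and uniformly Lipschitz in their first coordinate $x\in\mathbb R^d$. Let $\overline\tau>0$, and let $F$, $W_t$, $w_t$, $X_t^\epsilon$ be as defined in the context. Let $\overline\mu$ be a probability measure on $M$ absolutely continuous with respect to $\mu$. Let $(\mathfrak a_\epsilon)_{\epsilon>0}$ be positive real numbers such that $\lim_{\epsilon\to0}\mathfrak a_\epsilon=0$ and $\lim_{\epsilon\to0}\epsilon/\mathfrak a_\epsilon=0$. Assume that, for every $x\in\mathbb R^d$: (a) the functions $F(\cdot,\omega)$ and $\overline f$ are twice differentiable, uniformly bounded, and with uniformly bounded derivatives of first and second orders; (b) the family of continuous processes $\big(v_t^\epsilon(x,\cdot):=\mathfrak a_\epsilon\int_0^{t/\epsilon}F(w_{\epsilon s}(x),T^{\lfloor s\rfloor}(\cdot))\,ds\big)_t$ converges in distribution, as $\epsilon\to0$, to a process $(v_t(x,\cdot))_{t\ge0}$ (with respect to $\overline\mu$, in $\mathcal C([0,S'])$ for all $S'>0$), and the family $\big(\dot v_t^\epsilon(x,\cdot):=\mathfrak a_\epsilon\int_0^{t/\epsilon}D_1F(w_{\epsilon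 s}(x),T^{\lfloor s\rfloor}(\cdot))\,ds\big)_{t}$ is tight (with respect to $\overline\mu$, in $\mathcal C([0,S'])$ for all $S'>0$); (c) for all $S'>0$, $((\epsilon n_{t/\epsilon})_{t\in[0,S']})_\epsilon$ converges in probability, with respect to $\overline\mu$, to $(t/\overline\tau)_{t\in[0,S']}$ for the uniform metric; (d) the families of continuous processes $$z_t^\epsilon:=\sqrt{\epsilon\,\mathfrak a_\epsilon}\int_0^{t/\epsilon}(\tau\circ T^{\lfloor s\rfloor}-\overline\tau)\,\overline f(w_{\epsilon s}(x))\,ds\quad\text{and}\quad \dot z_t^\epsilon:=\epsilon\int_0^{t/\epsilon}(\tau\circ T^{\lfloor s\rfloor}-\overline\tau)\,D\overline f(w_{\epsilon s}(x))\,ds$$ converge in distribution to $0$ with respect to $\overline\mu$ as $\epsilon\to0$, respectively with respect to the uniform topology on $\mathcal C([0,S'])$ for all $S'>0$, and in the sense of finite-dimensional distributions. Then, for any $x\in\mathbb R^d$, the normalized error $\big(\frac{\mathfrak a_\epsilon}{\epsilon}E_t^\epsilon(x,\cdot):=\frac{\mathfrak a_\epsilon}{\epsilon}(X_t^\epsilon(x,\cdot)-W_t(x))\big)_{t\ge0}$ converges, as $\epsilon\to0$, strongly in distribution with respect to $\nu$, for the local topology of $\mathcal C([0,+\infty))$, to the process $(Y_t(x))_{t}$ with $$Y_t(x)=v_{t/\overline\tau}(x)+\int_0^tD\overline f(W_s(x))\exp\left(\int_s^tD\overline f(W_u(x))\,du\right)v_{s/\overline\tau}(x)\,ds .$$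
   Context: Suspension flow: $\mathcal M=\{(y,s)\in M\times[0,+\infty): 0\le s<\tau(y)\}$, $\nu=\mu\otimes\mathrm{Leb}$ restricted to $\mathcal M$, and $\varphi_t(y,s)=\big(T^{n_{t+s}(y)}(y),\,t+s-t_{n_{t+s}(y)}(y)\big)$ where $t_m(y)=\sum_{k=0}^{m-1}\tau(T^ky)$ and $n_t(y)=\sup\{n\in\mathbb N: t_n(y)\le t\}$. $F:\mathbb R^d\times M\to\mathbb R^d$ is $F(x,\omega)=\int_0^{\tau(\omega)}f(x,(\omega,s))\,ds$; $D_1F$ is its derivative in the first coordinate. The number $\overline\tau>0$ corresponds to the averaged value of $\tau$. $W_t(x)$ solves $\frac{dW_t}{dt}(x)=\overline f(W_t(x))$, $W_0(x)=x$, and $w_t(x):=W_{\overline\tau t}(x)$ (so $\frac{dw_t}{dt}(x)=\overline\tau\,\overline f(w_t(x))$, $w_0(x)=x$). $X_t^\epsilon(x,\omega)$ solves $\frac{dX_t^\epsilon}{dt}(x,\omega)=f(X_t^\epsilon(x,\omega),\varphi_{t/\epsilon}(\omega))+\overline f(X_t^\epsilon(x,\omega))$, $X_0^\epsilon(x,\omega)=x$, for $\omega\in\mathcal M$. $D\overline f$ is the derivative of $\overline f$. $v_t(x)$ stands for $v_t(x,\cdot)$. Strong convergence in distribution with respect to $\nu$ means convergence in distribution with respect to every probability measure absolutely continuous with respect to $\nu$. Convergence for the local topology of $\mathcal C([0,+\infty))$ means that the restrictions to $[0,T]$ converge in $(\mathcal C([0,T]),\|\cdot\|_\infty)$ for every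 $T>0$.
   Formalization: exp(∫_s^t Df̄(W_u(x))du) is taken as the ordered exponential (propagator of y'=Df̄(W_t(x))y), applied after Df̄(W_s(x)) acts on v; it equals the displayed formula if the Df̄(W_u(x)) commute (e.g. d=1); without commutation the displayed formula can fail. *)

(* Defs.v *)
From HB Require Import structures.
From mathcomp Require Import all_boot all_order all_algebra.
From mathcomp Require Import all_classical all_reals all_analysis.

Set Implicit Arguments.
Unset Strict Implicit.
Unset Printing Implicit Defensive.

Import Order.TTheory GRing.Theory Num.Theory.
Import numFieldNormedType.Exports.

Local Open Scope classical_set_scope.
Local Open Scope ring_scope.

Notation borel V := (g_sigma_algebraType (@open V)).

Section integrals.
Context {R : realType}.

Definition mxint m n (a b : R) (g : R -> 'M[R]_(m, n)) : 'M[R]_(m, n) :=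
  \matrix_(i, j) (\int[lebesgue_measure]_(s in `[a, b]) g s i j).

(* [iterated_mxint A k s t] is the integral of A u_1 *m ... *m A u_k over
   s <= u_1 <= ... <= u_k <= t. *)
Fixpoint iterated_mxint d (A : R -> 'M[R]_d) (k : nat) (s t : R) : 'M[R]_d :=
  if k is k'.+1 then mxint s t (fun u => iterated_mxint A k' s u *m A u)
  else 1%:M.

(* exp(\int_s^t A(u) du) for a family of matrices, as it occurs in the solution
   of the linear equation y' = y A(t): the ordered exponential (Peano-Baker
   series), i.e. the Psi with Psi(s, s) = 1 and d/dt Psi(s, t) = Psi(s, t) A(t).
   It is the exponential of the matrix \int_s^t A(u) du when the A(u) commute
   pairwise, hence in dimension 1 (see [mxexp_int_comm]). For noncommuting A(u)
   the exponential of the integral does not solve that equation. *)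
Definition mxexp_int d (A : R -> 'M[R]_d) (s t : R) : 'M[R]_d :=
  limn (series (fun k => iterated_mxint A k s t)).

Definition mxexp d (B : 'M[R]_d) : 'M[R]_d :=
  limn (series (fun k => (k`!%:R)^-1 *: B ^+ k)).

End integrals.

Section commuting_family.
Context {R : realType} (d : nat) (A : R -> 'M[R]_d) (s t : R).
Hypothesis st : s < t.
Hypothesis Ac : forall i j, {within `[s, t], continuous (fun u => A u i j)}.
Hypothesis AC : forall u v, u \in `[s, t] -> v \in `[s, t] ->
  A u *m A v = A v *m A u.

Let mu := @lebesgue_measure R.
Let B u := mxint s u A.

Let sub_seg u : u <= t -> `[s, u] `<=` `[s, t].
Proof. by move=> ut; apply: subset_itvl; rewrite bnd_simp. Qed.

Let int_cont (g : R -> R) u : u <= t -> {within `[s, t], continuous g} ->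
  mu.-integrable `[s, u] (EFin \o g).
Proof.
move=> ut gc; apply: continuous_compact_integrable; first exact: segment_compact.
exact: (continuous_subspaceW (sub_seg ut)).
Qed.

Let BE u i j : B u i j = \int[mu]_(r in `[s, u]) A r i j.
Proof. by rewrite mxE. Qed.

Let dB r i j : r \in `]s, t[ -> is_derive r 1 (fun x => B x i j) (A r i j).
Proof.
move=> /[dup] rst; rewrite in_itv/= => /andP[sr rt].
rewrite (_ : (fun x => B x i j) =
  fun x => \int[mu]_(r in `[s, x]) A r i j); last by apply/funext => x; rewrite BE.
have Ar : {for r, continuous (fun u => A u i j)}.
  apply: (within_continuous_continuous st) rst; exact: Ac.
have [h1 h2] := continuous_FTC1_closed rt (int_cont (lexx t) (@Ac i j)) sr Ar.
by apply: DeriveDef => //; rewrite -derive1E.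
Qed.

Let cB i j : {within `[s, t], continuous (fun x => B x i j)}.
Proof.
rewrite (_ : (fun x => B x i j) =
  fun x => \int[mu]_(r in `[s, x]) A r i j); last by apply/funext => x; rewrite BE.
exact: (parameterized_integral_continuous (ltW st) (int_cont (lexx t) (@Ac i j))).
Qed.

Let ceq (g h : R -> R) : g =1 h ->
  {within `[s, t], continuous h} -> {within `[s, t], continuous g}.
Proof. by move=> /funext ->. Qed.

Let cc (c : R) : {within `[s, t], continuous (fun _ : R => c)}.
Proof. by move=> x; exact: cvg_cst. Qed.

Let cM (g h : R -> R) : {within `[s, t], continuous g} ->
  {within `[s, t], continuous h} ->
  {within `[s, t], continuous (fun x => g x * h x)}.
Proof. by move=> gc hc x; apply: cvgM; [exact: gc|exact: hc]. Qed.

Let sum_cont (I : Type) (l : seq I) (h : I -> R -> R) :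
  (forall i, {within `[s, t], continuous (h i)}) ->
  {within `[s, t], continuous (fun r => \sum_(i <- l) h i r)}.
Proof.
move=> hc; elim: l => [|i l IH].
  by apply: (ceq (fun x => big_nil _ _ _ _)); exact: cc.
apply: (ceq (fun x => big_cons _ _ _ _ _ _)) => /=.
by move=> x; apply: cvgD; [exact: hc|exact: IH].
Qed.

Let int_sum (I : Type) (l : seq I) (h : I -> R -> R) u : u <= t ->
  (forall i, {within `[s, t], continuous (h i)}) ->
  \int[mu]_(r in `[s, u]) (\sum_(i <- l) h i r) =
  \sum_(i <- l) \int[mu]_(r in `[s, u]) h i r.
Proof.
move=> ut hc.
have sc (k : seq I) := @sum_cont I k h hc.
elim: l => [|i l IH].
  rewrite big_nil; under eq_Rintegral do rewrite big_nil.
  by rewrite Rintegral_cst// mul0r.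
rewrite big_cons -IH -RintegralD//; [|exact: int_cont|exact: int_cont].
by apply: eq_Rintegral => x _; rewrite big_cons.
Qed.

Let AB r : r \in `[s, t] -> A r *m B r = B r *m A r.
Proof.
move=> rst; have rt : r <= t by move: rst; rewrite in_itv/= => /andP[].
have cZ (c : R) i j : {within `[s, t], continuous (fun x => c * A x i j)}.
  by apply: cM; [exact: cc|exact: Ac].
have cZr (c : R) i j : {within `[s, t], continuous (fun x => A x i j * c)}.
  by apply: cM; [exact: Ac|exact: cc].
apply/matrixP => i j; rewrite !mxE.
transitivity (\int[mu]_(u in `[s, r]) (\sum_k (A r i k * A u k j))).
  rewrite int_sum//; apply: eq_bigr => k _.
  by rewrite BE -RintegralZl//; exact: int_cont.
transitivity (\int[mu]_(u in `[s, r]) (\sum_k (A u i k * A r k j))); last first.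
  rewrite int_sum//; apply: eq_bigr => k _.
  by rewrite BE -RintegralZr//; exact: int_cont.
apply: eq_Rintegral => u; rewrite inE => /(sub_seg rt) ust.
by have := AC rst ust => /matrixP/(_ i j); rewrite !mxE.
Qed.

Let ABk k r : r \in `[s, t] -> A r *m B r ^+ k = B r ^+ k *m A r.
Proof.
move=> rst; have /(commrX k) : GRing.comm (A r) (B r) by exact: AB.
exact.
Qed.

Let dBk k r i j : r \in `]s, t[ ->
  is_derive r 1 (fun x => (B x ^+ k.+1) i j)
    ((k.+1%:R *: (B r ^+ k *m A r)) i j).
Proof.
move=> rst; have rst' : r \in `[s, t] by exact: subset_itv_oo_cc.
elim: k i j => [|k IH] i j.
  rewrite expr0 mul1mx scale1r; under eq_fun do rewrite expr1; exact: dB.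
have -> : (fun x => (B x ^+ k.+2) i j) =
    \sum_(l < d) (fun x => B x i l * (B x ^+ k.+1) l j).
  by apply/funext => x; rewrite exprS mxE fct_sumE.
have dM l : is_derive r 1 (fun x => B x i l * (B x ^+ k.+1) l j)
    (B r i l *: (k.+1%:R *: (B r ^+ k *m A r)) l j +
     (B r ^+ k.+1) l j *: A r i l).
  have := dB i l rst => Bil; have := IH l j => Blj.
  exact: is_deriveM.
apply: is_derive_eq.
rewrite big_split/= addrC.
have -> : \sum_i0 ((B r ^+ k.+1) i0 j *: A r i i0) = (A r *m B r ^+ k.+1) i j.
  by rewrite mxE; apply: eq_bigr => l _; rewrite /GRing.scale/= mulrC.
have -> : \sum_i0 (B r i i0 *: (k.+1%:R *: (B r ^+ k *m A r)) i0 j) =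
   (B r *m (k.+1%:R *: (B r ^+ k *m A r))) i j.
  by rewrite mxE.
rewrite -scalemxAr mulmxA -[B r *m _]/(B r * _) -exprS ABk//.
set Q := B r ^+ k.+1 *m A r.
have mxZ (c : R) : (c *: Q) i j = c * Q i j by rewrite mxE.
by rewrite !mxZ [k.+2%:R]mulrS mulrDl mul1r.
Qed.

Let cBk k i j : {within `[s, t], continuous (fun x => (B x ^+ k) i j)}.
Proof.
elim: k i j => [|k IH] i j.
  exact: cc.
apply: (@ceq _ (fun x => \sum_l B x i l * (B x ^+ k) l j)).
  by move=> x; rewrite exprS mxE.
by apply: sum_cont => l; apply: cM; [exact: cB|exact: IH].
Qed.

Let BA k i j : {within `[s, t], continuous (fun x => (B x ^+ k *m A x) i j)}.
Proof.
apply: (@ceq _ (fun x => \sum_l (B x ^+ k) i l * A x l j)).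
  by move=> x; rewrite mxE.
by apply: sum_cont => l; apply: cM; [exact: cBk|exact: Ac].
Qed.

Let cZBA (c : R) k i j :
  {within `[s, t], continuous (fun x => (c *: (B x ^+ k *m A x)) i j)}.
Proof.
apply: (@ceq _ (fun x => c * (B x ^+ k *m A x) i j)).
  by move=> x; rewrite mxE.
by apply: cM; [exact: cc|exact: BA].
Qed.

Let B0 : B s = 0.
Proof. by apply/matrixP => i j; rewrite BE set_itv1 Rintegral_set1 mxE. Qed.

Let int_BkA k u i j : s < u <= t ->
  \int[mu]_(r in `[s, u]) (k.+1%:R *: (B r ^+ k *m A r)) i j = (B u ^+ k.+1) i j.
Proof.
move=> /andP[su ut].
have sub_oo r : r \in `]s, u[ -> r \in `]s, t[.
  by rewrite !in_itv/= => /andP[-> /lt_le_trans ->].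
rewrite /Rintegral (@continuous_FTC2 _ _ (fun x => (B x ^+ k.+1) i j))//.
- by rewrite B0 expr0n/= mxE subr0.
- apply: (continuous_subspaceW (sub_seg ut)).
  exact: cZBA.
- have := continuous_subspaceW (sub_seg ut) (@cBk k.+1 i j).
  move=> /(continuous_within_itvP _ su)[_ h1 h2]; split => // r /sub_oo rst.
  by have [] := dBk k i j rst.
- by move=> r /sub_oo rst; rewrite derive1E; have [_ ->] := dBk k i j rst.
Qed.

Lemma iterated_mxint_comm k u : s <= u <= t ->
  iterated_mxint A k s u = (k`!%:R)^-1 *: mxint s u A ^+ k.
Proof.
elim: k u => [|k IH] u sut; first by rewrite fact0 invr1 scale1r expr0.
rewrite /= -/(B u); move: sut => /andP[]; rewrite le_eqVlt => /predU1P[<- _|su ut].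
  rewrite B0 expr0n scaler0.
  by apply/matrixP => i j; rewrite !mxE set_itv1 Rintegral_set1.
apply/matrixP => i j; rewrite !mxE -(@int_BkA k) ?su//.
rewrite -RintegralZl//; last first.
  apply: int_cont => //; exact: cZBA.
apply: eq_Rintegral => r; rewrite inE/= in_itv/= => /andP[sr ru].
rewrite IH ?sr ?(le_trans ru)// -scalemxAl -/(B r) !mxE mulrA factS natrM.
by rewrite invfM [_^-1 / _ * _]mulrAC mulVf ?mul1r// pnatr_eq0.
Qed.

End commuting_family.

Lemma mxexp_int_comm {R : realType} d (A : R -> 'M[R]_d) (s t : R) : s <= t ->
  (forall i j, {within `[s, t], continuous (fun u => A u i j)}) ->
  (forall u v, u \in `[s, t] -> v \in `[s, t] -> A u *m A v = A v *m A u) ->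
  mxexp_int A s t = mxexp (mxint s t A).
Proof.
rewrite le_eqVlt => /predU1P[<-|st] Ac AC; last first.
  congr (limn (series _)); apply/funext => k.
  by rewrite (iterated_mxint_comm st Ac AC)// lexx ltW.
have m0 (h : R -> 'M[R]_d) : mxint s s h = 0.
  by apply/matrixP => i j; rewrite !mxE set_itv1 Rintegral_set1.
congr (limn (series _)); apply/funext => -[|k] /=.
  by rewrite fact0 invr1 scale1r expr0.
by rewrite !m0 expr0n scaler0.
Qed.

Section dynamics.
Context d (M : measurableType d) (R : realType).

Definition measure_preserving (mu : set M -> \bar R) (T : M -> M) :=
  measurable_fun setT T /\
  forall A, measurable A -> mu (T @^-1` A) = mu A.

(* mu is not assumed finite: an invariant set is null or conull. *)
Definition ergodic (mu : set M -> \bar R) (T : M -> M) :=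
  forall A, measurable A -> T @^-1` A = A -> mu A = 0%E \/ mu (~` A) = 0%E.

Definition conservative (mu : set M -> \bar R) (T : M -> M) :=
  forall A, measurable A ->
    trivIset setT (fun n => iter n T @^-1` A) -> mu A = 0%E.

(* t_m(y) *)
Definition birkhoff_sum (T : M -> M) (tau : M -> R) (m : nat) (y : M) : R :=
  \sum_(0 <= k < m) tau (iter k T y).

(* n_t(y); the set is finite as soon as tau is bounded below by a positive
   constant, and its supremum is 0 by convention when t < 0. *)
Definition lap (T : M -> M) (tau : M -> R) (t : R) (y : M) : nat :=
  supremum 0%N [set n | birkhoff_sum T tau n y <= t].

(* The suspension space is a subset of M * R rather than a type; functions on it
   are total functions on M * R of which only the values on [susp tau] matter. *)
Definition susp (tau : M -> R) : set (M * measurableTypeR R) :=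
  [set p | 0 <= p.2 < tau p.1].

Definition susp_flow (T : M -> M) (tau : M -> R) (t : R)
    (p : M * measurableTypeR R) : M * measurableTypeR R :=
  let n := lap T tau (t + p.2) p.1 in
  (iter n T p.1, t + p.2 - birkhoff_sum T tau n p.1).

Lemma measurable_susp (tau : M -> R) :
  measurable_fun setT tau -> measurable (susp tau).
Proof.
move=> mtau.
have m2 : measurable_fun setT (fun p : M * measurableTypeR R => p.2 : R).
  exact: measurable_snd.
have mt1 : measurable_fun setT (fun p : M * measurableTypeR R => tau p.1).
  exact: (measurableT_comp mtau measurable_fst).
have := measurable_realfun.measurable_fun_ler (@measurable_cst _ _ _ _ setT (0 : R)) m2.
move=> /(_ measurableT [set true]) h1.
have := measurable_realfun.measurable_fun_ltr m2 mt1 => /(_ measurableT [set true]) h2.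
have -> : susp tau =
    (setT `&` (fun p : M * measurableTypeR R => 0 <= p.2) @^-1` [set true])
    `&` (setT `&`
      (fun p : M * measurableTypeR R => p.2 < tau p.1) @^-1` [set true]).
  apply/seteqP; split=> p /=.
    by move=> /andP[p0 pt]; rewrite /susp /= p0 pt.
  by move=> [[_ p0] [_ pt]]; rewrite /susp /= p0 pt.
by apply: measurableI; [exact: h1|exact: h2].
Qed.

Definition susp_measure (mu : {sigma_finite_measure set M -> \bar R})
    (tau : M -> R) (mtau : measurable_fun setT tau) :=
  mrestr (mu \x (@lebesgue_measure R))%E (measurable_susp mtau).

(* F(x, y), the integral of f(x, .) over the fibre above y *)
Definition roof_integral n (tau : M -> R)
    (f : 'rV[R]_n -> M * measurableTypeR R -> 'rV[R]_n)
    (x : 'rV[R]_n) (y : M) : 'rV[R]_n :=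
  mxint 0 (tau y) (fun s => f x (y, s)).

End dynamics.

Section convergence.
Context {R : realType}.

(* C([0, S], V), as a subset of the functions R -> V under the topology of uniform
   convergence on [0, S]; this topology only sees the restrictions to [0, S]. *)
Definition cpaths (V : normedModType R) (S : R) : set {uniform` `[0, S] -> V} :=
  [set h | {within `[0, S], continuous (h : R -> V)}].
Arguments cpaths : clear implicits.

Definition continuous_process (V : normedModType R) dO (O : measurableType dO)
    (D : set O) (S : R) (Z : O -> R -> V) :=
  (forall w, D w -> cpaths V S (Z w)) /\
  (forall t, t \in `[0, S] -> measurable_fun D (fun w => Z w t : borel V)).

(* Convergence in distribution, as e tends to 0 from the right, of random elements
   Z e of C: convergence of the expectations of all bounded functions that are
   continuous on C. The Z e are defined on a set D of full P-measure. *)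
Definition weak_cvg (E : topologicalType) (C : set E)
    dO (O : measurableType dO) (P : probability O R) (D : set O)
    (Z : R -> O -> E)
    dO' (O' : measurableType dO') (P' : probability O' R) (Y : O' -> E) :=
  forall g : E -> R, {within C, continuous g} ->
    (exists K, forall h, C h -> `|g h| <= K) ->
    (\int[P]_(w in D) g (Z e w)) @[e --> 0^'+] --> \int[P']_w g (Y w).

Definition cvg_distr_C (V : normedModType R) (S : R)
    dO (O : measurableType dO) (P : probability O R) (D : set O)
    (Z : R -> O -> R -> V)
    dO' (O' : measurableType dO') (P' : probability O' R) (Y : O' -> R -> V) :=
  [/\ forall e, 0 < e -> continuous_process D S (Z e),
      continuous_process setT S Y
    & @weak_cvg {uniform` `[0, S] -> V} (cpaths V S) _ _ P D Z _ _ P' Y].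

Definition cvg_distr_fd (V : normedModType R)
    dO (O : measurableType dO) (P : probability O R) (Z : R -> O -> R -> V)
    dO' (O' : measurableType dO') (P' : probability O' R) (Y : O' -> R -> V) :=
  [/\ forall e t, 0 < e -> 0 <= t ->
        measurable_fun setT (fun w => Z e w t : borel V),
      forall t, 0 <= t -> measurable_fun setT (fun w => Y w t : borel V)
    & forall (k : nat) (ts : 'I_k -> R), (forall i, 0 <= ts i) ->
  @weak_cvg {ptws 'I_k -> V} setT _ _ P setT (fun e w i => Z e w (ts i))
    _ _ P' (fun w i => Y w (ts i))].

(* Tightness in C([0, S], V) of (Z e) as e tends to 0. Since the topology does not
   separate functions that agree on [0, S], K is required to be closed: it is then
   determined by the restrictions of its elements. *)
Definition tight_C (V : normedModType R) (S : R)
    dO (O : measurableType dO) (P : probability O R) (Z : R -> O -> R -> V) :=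
  (forall e, 0 < e -> continuous_process setT S (Z e)) /\
  forall eta : R, 0 < eta ->
    exists K : set {uniform` `[0, S] -> V},
      [/\ compact K, closed K, K `<=` cpaths V S
        & \forall e \near 0^'+, (P [set w | ~ K (Z e w)] <= eta%:E)%E].

Definition cvg_prob_unif (S : R)
    dO (O : measurableType dO) (P : probability O R) (Z : R -> O -> R -> R)
    (h : R -> R) :=
  forall eta : R, 0 < eta ->
    P [set w | eta < sup [set `|Z e w t - h t| | t in `[0, S]]]
      @[e --> 0^'+] --> 0%E.

(* Strong convergence in distribution with respect to nu, for the local topology
   of C([0, +oo[, V); D is the set carrying nu. *)
Definition strong_cvg_distr (V : normedModType R)
    dO (O : measurableType dO) (nu : set O -> \bar R) (D : set O)
    (Z : R -> O -> R -> V)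
    dO' (O' : measurableType dO') (P' : probability O' R) (Y : O' -> R -> V) :=
  forall P : probability O R, P `<< nu ->
    forall S, 0 < S -> cvg_distr_C S P D Z P' Y.

End convergence.

Section odes.
Context {R : realType} (n : nat).

Definition ode_solution (g : 'rV[R]_n -> 'rV[R]_n) (x : 'rV[R]_n)
    (h : R -> 'rV[R]_n) :=
  [/\ h 0 = x, {within `[0, +oo[, continuous h}
    & forall t : R, 0 < t -> is_derive t 1 h (g (h t))].

(* Solution of h'(t) = g(t, h(t)), h(0) = x when g is only measurable in t: the
   derivative exists almost everywhere and the equation is meant in integral
   form. *)
Definition caratheodory_solution (g : R -> 'rV[R]_n -> 'rV[R]_n)
    (x : 'rV[R]_n) (h : R -> 'rV[R]_n) :=
  {within `[0, +oo[, continuous h} /\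
  forall t, 0 <= t -> h t = x + mxint 0 t (fun s => g s (h s)).

(* Vectors are rows: 'd g x h = h *m 'J g x. *)
Definition C2_bounded (C : R) (g : 'rV[R]_n -> 'rV[R]_n) :=
  [/\ forall x, differentiable g x,
      forall x, differentiable (jacobian g) x,
      forall x, `|g x| <= C,
      forall x, `|'J g x| <= C
    & forall x h, `|'d (jacobian g) x h| <= C * `|h|].

End odes.

(* Main.v *)
Require Import Defs.
From HB Require Import structures.
From mathcomp Require Import all_boot all_order all_algebra.
From mathcomp Require Import all_classical all_reals all_analysis.
From mathcomp Require Import measurable_realfun ring lra.

Set Implicit Arguments.
Unset Strict Implicit.
Unset Printing Implicit Defensive.

Import Order.TTheory GRing.Theory Num.Theory.
Import numFieldNormedType.Exports.

Local Open Scope classical_set_scope.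
Local Open Scope ring_scope.

(** The normalised error solves, up to negligible terms, a linear equation whose
    forcing is the fluctuation process [v^e]; its solution is a continuous functional
    of the forcing, so that it converges with [v^e].

    For one path started at height 0 above [y], the displacement of [X] over the lap
    above [T^n y] is [e * F (X, T^n y)] up to [O(e^2)], apart from the averaged drift.
    Let slow time count laps, in units of [e], and let [clock] be the real time as a
    function of slow time. Expanding [F] to first order at the averaged path [w], in
    the displacement [H = X o clock - w], gives [error_decomposition]: [a / e] times
    the error is [v^e] at slow time [e * n_(t/e)], plus the integral of [H] against
    the linearised fluctuation, plus [a / e] times a quadratic remainder and the
    difference of the averaged drifts, plus [O(a)]. Here [H] is the error itself plus
    [W o clock - w], and the latter is [o(sqrt (e / a))] by the first part of (d) and
    Gronwall's inequality ([averaged_clock_deviation]). As [H] is Lipschitz, its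
    integral against the linearised fluctuation is controlled by the oscillation of
    the latter ([mxint_block_bound]), which is where its tightness serves. A first
    Gronwall argument bounds the error by [O(e / a)] ([apriori_bound]). Then the
    integral and the quadratic remainder are negligible, and by (c) and the modulus of
    continuity of [v^e] slow time may be replaced by [t / taubar]. What is left is
    [y_t = v^e_(t / taubar) + int_0^t y_s D fbar (W_s) ds] up to a small residual,
    hence [error_linear_response]. This linear equation is solved by variation of
    constants with the ordered exponential ([linear_responseE]), which yields the
    formula for the limit.

    The estimates hold outside an event of small probability for [mubar]
    ([mostly_linear_response]), so that the integral of every bounded Lipschitz
    functional of the error converges; such functionals decide convergence in
    distribution ([weak_cvg_lipschitz]).

    It remains to replace [mubar] by an arbitrary law that is absolutely continuous on
    the suspension. Moving the starting point from [y] to [T y], or up the fibre,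
    shifts time by [O(e)] and changes the normalised error by [O(a)]
    ([error_shift]). Thus a Lipschitz functional of the error is asymptotically
    invariant under [T]. By ergodicity and conservativity the integrals of such
    functions have the same limit under all absolutely continuous probabilities
    ([asymptotic_invariance]): the filling scheme carries almost all of the mass of
    one of them onto the other by finitely many applications of [T], because almost
    every orbit meets every set of positive measure ([sweeping]). *)
(** * Matrix-valued integrals *)

Section mxnorm.
Context {R : realType}.

Lemma mxnorm_entry m n (A : 'M[R]_(m, n)) i j : `|A i j| <= `|A|.
Proof.
rewrite [leRHS]/Num.Def.normr /= mx_normrE; apply/bigmax_geP; right => /=.
by exists (i, j).
Qed.

Lemma mxnorm_le m n (A : 'M[R]_(m, n)) (c : R) :
  0 <= c -> (forall i j, `|A i j| <= c) -> `|A| <= c.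
Proof.
move=> c0 Ac; rewrite [leLHS]/Num.Def.normr /= mx_normrE.
by apply/bigmax_leP; split => // -[i j] _; exact: Ac.
Qed.

Lemma mxnorm_mul m n p (A : 'M[R]_(m, n)) (B : 'M[R]_(n, p)) :
  `|A *m B| <= n%:R * `|A| * `|B|.
Proof.
apply: mxnorm_le => [|i j]; first by rewrite !mulr_ge0.
rewrite mxE (le_trans (ler_norm_sum _ _ _))//.
apply: (@le_trans _ _ (\sum_(k < n) `|A| * `|B|)).
  by apply: ler_sum => k _; rewrite normrM ler_pM// mxnorm_entry.
by rewrite sumr_const card_ord -[leLHS]mulr_natl mulrA.
Qed.

Lemma mxnorm1 n : `|1%:M : 'M[R]_n| <= 1.
Proof. by apply: mxnorm_le => // i j; rewrite mxE; case: eqP => _; rewrite ?normr1 ?normr0. Qed.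

End mxnorm.

Section mxint.
Context {R : realType}.
Local Notation mu := (@lebesgue_measure R).

(** The integrands of [mxint]: the slopes of Caratheodory equations are
   discontinuous in time, so that continuity would not be enough here. *)
Definition bounded_meas m n (a b : R) (g : R -> 'M[R]_(m, n)) :=
  (forall i j, measurable_fun `[a, b] (fun s => g s i j)) /\
  exists C, forall s, s \in `[a, b] -> `|g s| <= C.

Lemma bounded_meas_integrable m n (a b : R) (g : R -> 'M[R]_(m, n)) i j :
  bounded_meas a b g -> mu.-integrable `[a, b] (EFin \o (fun s => g s i j)).
Proof.
move=> [mg [C gC]]; apply: measurable_bounded_integrable => //.
  by rewrite /= lebesgue_measure_itv/=; case: ifPn => // _; rewrite -EFinB ltry.
  exact: mg.
exists C; split; first exact: num_real.
move=> x Cx s /= sab; apply: le_trans (ltW Cx).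
by apply: le_trans (gC s _) => //; exact: mxnorm_entry.
Qed.

Lemma eq_bounded_meas m n (a b : R) (g h : R -> 'M[R]_(m, n)) :
  (forall s, s \in `[a, b] -> g s = h s) ->
  bounded_meas a b g -> bounded_meas a b h.
Proof.
move=> gh [mg [C gC]]; split.
  move=> i j; apply: eq_measurable_fun (mg i j) => s sab.
  by rewrite gh//; rewrite inE in sab.
by exists C => s sab; rewrite -gh// gC.
Qed.

Lemma bounded_measS m n (a b : R) a' b' (g : R -> 'M[R]_(m, n)) :
  a <= a' -> b' <= b -> bounded_meas a b g -> bounded_meas a' b' g.
Proof.
move=> aa bb [mg [C gC]]; split.
  move=> i j; apply: measurable_funS (mg i j) => //.
  by apply: subset_itv; rewrite bnd_simp.
exists C => s; rewrite in_itv/= => /andP[h1 h2]; apply: gC.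
by rewrite in_itv/= (le_trans aa)// (le_trans h2).
Qed.

Lemma bounded_meas_cst m n (a b : R) (A : 'M[R]_(m, n)) : bounded_meas a b (fun=> A).
Proof. by split => [i j|]; [exact: measurable_cst|exists `|A|]. Qed.

Lemma bounded_measD m n (a b : R) (g h : R -> 'M[R]_(m, n)) :
  bounded_meas a b g -> bounded_meas a b h ->
  bounded_meas a b (fun s => g s + h s).
Proof.
move=> [mg [C gC]] [mh [D hD]]; split.
  move=> i j; apply: (eq_measurable_fun (fun s => g s i j + h s i j)).
    by move=> s _; rewrite mxE.
  exact: measurable_funD.
by exists (C + D) => s sab; apply: le_trans (ler_normD _ _) _; rewrite lerD ?gC ?hD.
Qed.

Lemma bounded_measM m n p a b (g : R -> 'M[R]_(m, n)) (h : R -> 'M[R]_(n, p)) :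
  bounded_meas a b g -> bounded_meas a b h ->
  bounded_meas a b (fun s => g s *m h s).
Proof.
move=> [mg [C gC]] [mh [D hD]]; split.
  move=> i j; apply: (eq_measurable_fun (fun s => \sum_k g s i k * h s k j)).
    by move=> s _; rewrite mxE.
  by apply: measurable_sum => k; exact: measurable_funM.
exists (n%:R * C * D) => s sab; apply: le_trans (mxnorm_mul _ _) _.
by rewrite ler_pM// ?mulr_ge0 ?ler_pM ?gC ?hD.
Qed.

Lemma bounded_measZ m n (a b : R) (c : R -> R) (g : R -> 'M[R]_(m, n)) :
  measurable_fun `[a, b] c -> (exists C, forall s, s \in `[a, b] -> `|c s| <= C) ->
  bounded_meas a b g -> bounded_meas a b (fun s => c s *: g s).
Proof.
move=> mc [D cD] [mg [C gC]]; split.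
  move=> i j; apply: (eq_measurable_fun (fun s => c s * g s i j)).
    by move=> s _; rewrite mxE.
  exact: measurable_funM.
exists (D * C) => s sab; rewrite normrZ.
by rewrite ler_pM// ?gC ?cD.
Qed.

Lemma bounded_measZc m n (a b : R) (c : R) (g : R -> 'M[R]_(m, n)) :
  bounded_meas a b g -> bounded_meas a b (fun s => c *: g s).
Proof. by apply: bounded_measZ; [exact: measurable_cst|exists `|c|]. Qed.

Lemma bounded_measN m n (a b : R) (g : R -> 'M[R]_(m, n)) :
  bounded_meas a b g -> bounded_meas a b (fun s => - g s).
Proof.
move=> /(bounded_measZc (-1)); apply: eq_bounded_meas => s _.
by rewrite scaleN1r.
Qed.

Lemma bounded_measB m n (a b : R) (g h : R -> 'M[R]_(m, n)) :
  bounded_meas a b g -> bounded_meas a b h ->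
  bounded_meas a b (fun s => g s - h s).
Proof. by move=> bg /bounded_measN; exact: bounded_measD. Qed.

Lemma continuous_bounded_meas m n (a b : R) (g : R -> 'M[R]_(m, n)) :
  {within `[a, b], continuous g} -> bounded_meas a b g.
Proof.
move=> cg; split.
  move=> i j; apply: subspace_continuous_measurable_fun => //.
  move=> s; apply: (@continuous_comp _ _ _ _ (fun A : 'M[R]_(m, n) => A i j)).
    exact: cg.
  exact: coord_continuous.
have /compact_bounded[M [_ mrt]] := continuous_compact cg (@segment_compact _ a b).
by exists (M + 1) => s sab; apply: mrt; [rewrite ltrDl|exists s].
Qed.

Lemma lipschitz_within_continuous (V : normedModType R) (a b L : R) (g : R -> V) :
  (forall s t, s \in `[a, b] -> t \in `[a, b] -> `|g s - g t| <= L * `|s - t|) ->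
  {within `[a, b], continuous g}.
Proof.
move=> gL; apply/subspace_continuousP => s sab.
apply/cvgrPdist_le => e e0; rewrite near_withinE.
have L0 : 0 < `|L| + 1 by rewrite ltr_wpDl.
near=> t => tab.
apply: le_trans (gL _ _ _ _) _ => //.
have st : `|s - t| <= e / (`|L| + 1).
  by near: t; apply: cvgr_dist_le; rewrite ?divr_gt0//; exact: cvg_id.
rewrite ler_pdivlMr// mulrC in st; apply: le_trans st.
by rewrite ler_wpM2r// (le_trans (ler_norm _))// lerDl.
Unshelve. all: by end_near. Qed.

Lemma lipschitz_bounded_meas m n (a b L : R) (g : R -> 'M[R]_(m, n)) :
  (forall s t, s \in `[a, b] -> t \in `[a, b] -> `|g s - g t| <= L * `|s - t|) ->
  bounded_meas a b g.
Proof. by move=> /lipschitz_within_continuous /continuous_bounded_meas. Qed.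

Lemma eq_mxint m n (a b : R) (g h : R -> 'M[R]_(m, n)) :
  (forall s, s \in `[a, b] -> g s = h s) -> mxint a b g = mxint a b h.
Proof.
move=> gh; apply/matrixP => i j; rewrite !mxE; apply: eq_Rintegral => s.
by rewrite inE => sab; rewrite gh.
Qed.

Lemma mxint_xx m n a (g : R -> 'M[R]_(m, n)) : mxint a a g = 0.
Proof. by apply/matrixP => i j; rewrite !mxE set_itv1 Rintegral_set1. Qed.

Lemma fine_lebesgue_segment (a b : R) : a <= b -> fine (mu `[a, b]) = b - a.
Proof.
rewrite /= lebesgue_measure_itv/= lte_fin le_eqVlt.
by case/predU1P => [->|->]; rewrite ?ltxx ?subrr// -EFinD.
Qed.

Lemma mxint_cst m n (a b : R) (A : 'M[R]_(m, n)) :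
  a <= b -> mxint a b (fun=> A) = (b - a) *: A.
Proof.
move=> ab; apply/matrixP => i j; rewrite !mxE Rintegral_cst//.
by rewrite (_ : fine _ = b - a) 1?mulrC//; exact: fine_lebesgue_segment.
Qed.

Lemma mxintD m n (a b : R) (g h : R -> 'M[R]_(m, n)) :
  bounded_meas a b g -> bounded_meas a b h ->
  mxint a b (fun s => g s + h s) = mxint a b g + mxint a b h.
Proof.
move=> bg bh; apply/matrixP => i j; rewrite !mxE.
rewrite -RintegralD//; [|exact: bounded_meas_integrable..].
by apply: eq_Rintegral => s _; rewrite mxE.
Qed.

Lemma mxintZ m n (a b : R) (c : R) (g : R -> 'M[R]_(m, n)) :
  bounded_meas a b g -> mxint a b (fun s => c *: g s) = c *: mxint a b g.
Proof.
move=> bg; apply/matrixP => i j; rewrite !mxE.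
rewrite -RintegralZl//; [|exact: bounded_meas_integrable..].
by apply: eq_Rintegral => s _; rewrite mxE.
Qed.

Lemma mxintB m n (a b : R) (g h : R -> 'M[R]_(m, n)) :
  bounded_meas a b g -> bounded_meas a b h ->
  mxint a b (fun s => g s - h s) = mxint a b g - mxint a b h.
Proof.
move=> bg bh; rewrite mxintD//; last exact: bounded_measN.
congr (_ + _); rewrite -scaleN1r -mxintZ//.
by apply: eq_mxint => s _; rewrite scaleN1r.
Qed.

Lemma mxint_split m n a c b (g : R -> 'M[R]_(m, n)) :
  a <= c -> c <= b -> bounded_meas a b g ->
  mxint a b g = mxint a c g + mxint c b g.
Proof.
move=> ac cb bg; apply/matrixP => i j; rewrite !mxE.
have ib := @bounded_meas_integrable _ _ _ _ _ i j bg.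
apply/eqP; rewrite -subr_eq0 opprD addrA subr_eq0; apply/eqP.
rewrite (@Rintegral_itvB _ _ (BLeft a) (BRight b) c ib) ?bnd_simp//.
rewrite Rintegral_itv_obnd_cbnd//; apply: integrableS ib => //.
by apply: subset_itv; rewrite bnd_simp.
Qed.

Lemma mxint_normr m n (a b : R) (g : R -> 'M[R]_(m, n)) (phi : R -> R) :
  bounded_meas a b g -> mu.-integrable `[a, b] (EFin \o phi) ->
  (forall s, s \in `[a, b] -> `|g s| <= phi s) ->
  `|mxint a b g| <= \int[mu]_(s in `[a, b]) phi s.
Proof.
move=> bg iphi gphi; apply: mxnorm_le => [|i j].
  by apply: Rintegral_ge0 => s sab; apply: le_trans (gphi s _).
have ib := @bounded_meas_integrable _ _ _ _ _ i j bg.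
rewrite mxE (le_trans (le_normr_Rintegral _ ib))//; apply: le_Rintegral => //.
  exact: (integrable_norm ib).
by move=> s sab; apply: le_trans (gphi s _) => //; exact: mxnorm_entry.
Qed.

Lemma mxint_norm m n (a b : R) (g : R -> 'M[R]_(m, n)) (C : R) :
  a <= b -> bounded_meas a b g ->
  (forall s, s \in `[a, b] -> `|g s| <= C) -> `|mxint a b g| <= C * (b - a).
Proof.
move=> ab bg gC.
apply: le_trans (mxint_normr bg _ gC) _.
  have := @bounded_meas_integrable _ _ a b _ 0 0 (@bounded_meas_cst 1 1 a b (const_mx C)).
  by apply: eq_integrable => // s _ /=; rewrite mxE.
by rewrite Rintegral_cst//= (_ : fine _ = b - a)//; exact: fine_lebesgue_segment.
Qed.

Lemma is_derive_expMl (K : R) (x : R) :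
  is_derive x (1 : R) (fun s => expR (K * s)) (K * expR (K * x)).
Proof.
have -> : (fun s => expR (K * s)) = expR \o (fun s => K * s) by [].
have d1 : is_derive x (1 : R) (fun s : R => K * s) K.
  have := is_deriveZ K (is_derive_id x (1 : R)).
  by rewrite /GRing.scale/= mulr1; exact.
have := @is_derive1_comp _ expR (fun s => K * s) x (expR (K * x)) K.
by rewrite [K * expR _]mulrC; apply; exact: is_derive_expR || exact: d1.
Qed.

Lemma cvg_expMl (K x : R) (F : set_system R) : Filter F -> F --> x ->
  expR (K * s) @[s --> F] --> expR (K * x).
Proof.
move=> FF Fx; have : {for x, continuous (fun s => expR (K * s))}.
  apply: differentiable_continuous; apply/derivable1_diffP.
  exact: (@ex_derive _ _ _ _ _ _ _ (is_derive_expMl K x)).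
by apply: cvg_trans; apply: cvg_app.
Qed.

Lemma Rintegral_expMl (K a b : R) : 0 < K -> a <= b ->
  \int[mu]_(s in `[a, b]) expR (K * s) = (expR (K * b) - expR (K * a)) / K.
Proof.
move=> K0; rewrite le_eqVlt => /predU1P[->|ab].
  by rewrite set_itv1 Rintegral_set1 subrr mul0r.
have K1 : K^-1 * K = 1 by rewrite mulVf// gt_eqF.
have dF (x : R) : is_derive x (1 : R) (fun s => K^-1 * expR (K * s)) (expR (K * x)).
  have := is_deriveZ K^-1 (is_derive_expMl K x).
  by rewrite /GRing.scale/= mulrA K1 mul1r.
rewrite /Rintegral (@continuous_FTC2 _ _ (fun s => K^-1 * expR (K * s)))//=.
- by rewrite -mulrBr mulrC.
- apply: continuous_subspaceT => x; exact: cvg_expMl.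
- split.
  + by move=> x _; have [] := dF x.
  + by apply: cvgMr; apply: cvg_expMl; exact: cvg_at_right_filter.
  + by apply: cvgMr; apply: cvg_expMl; exact: cvg_at_left_filter.
- by move=> x _; rewrite derive1E; have [_ ->] := dF x.
Qed.

(** Integration gains a factor [K^-1] on exponentially weighted bounds; this
   makes the integral operators below contractions for a weighted norm. *)
Lemma mxint_norm_expD m n a b (g : R -> 'M[R]_(m, n)) (M A K : R) : 0 < K -> 0 <= M ->
  a <= b -> bounded_meas a b g ->
  (forall s, s \in `[a, b] -> `|g s| <= M * expR (K * s) + A) ->
  `|mxint a b g| <= M / K * expR (K * b) + A * (b - a).
Proof.
move=> K0 M0 ab bg gM; have ie : mu.-integrable `[a, b] (EFin \o (fun s => expR (K * s))).
  apply: continuous_compact_integrable; first exact: segment_compact.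
  by apply: continuous_subspaceT => x; exact: cvg_expMl.
have ie' : mu.-integrable `[a, b] (EFin \o (fun s => M * expR (K * s))).
  have := integrableZl _ M ie => /(_ (measurable_itv _)).
  by apply: eq_integrable => // s _ /=; rewrite EFinM.
have iA : mu.-integrable `[a, b] (EFin \o cst A).
  have := @bounded_meas_integrable _ _ a b _ 0 0 (@bounded_meas_cst 1 1 a b (const_mx A)).
  by apply: eq_integrable => // s _ /=; rewrite mxE.
have ieA : mu.-integrable `[a, b] (EFin \o (fun s => M * expR (K * s) + A)).
  have := integrableD _ ie' iA => /(_ (measurable_itv _)).
  by apply: eq_integrable => // s _ /=; rewrite EFinD.
apply: le_trans (mxint_normr bg ieA gM) _.
rewrite RintegralD// Rintegral_cst//= (_ : fine _ = b - a); last exact: fine_lebesgue_segment.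
rewrite lerD2r RintegralZl// Rintegral_expMl// mulrA mulrAC ler_wpM2l ?divr_ge0//; first exact: ltW.
by rewrite gerBl expR_ge0.
Qed.

Lemma mxint_norm_exp m n a b (g : R -> 'M[R]_(m, n)) (M K : R) : 0 < K -> 0 <= M ->
  a <= b -> bounded_meas a b g ->
  (forall s, s \in `[a, b] -> `|g s| <= M * expR (K * s)) ->
  `|mxint a b g| <= M / K * expR (K * b).
Proof.
move=> K0 M0 ab bg gM.
have := @mxint_norm_expD _ _ a b g M 0 K K0 M0 ab bg; rewrite mul0r addr0; apply.
by move=> s /gM; rewrite addr0.
Qed.

Lemma eq_mxint_co m n a b (g h : R -> 'M[R]_(m, n)) :
  bounded_meas a b g -> bounded_meas a b h ->
  (forall s, a <= s < b -> g s = h s) -> mxint a b g = mxint a b h.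
Proof.
move=> bg bh gh; apply/matrixP => i j; rewrite !mxE.
have co (u : R -> 'M[R]_(m, n)) : bounded_meas a b u ->
    mu.-integrable `[a, b[ (EFin \o (fun s => u s i j)).
  move=> /bounded_meas_integrable => /(_ i j); apply: integrableS => //.
  by apply: subset_itv; rewrite bnd_simp.
rewrite -!Rintegral_itv_bndo_bndc; [|exact: co..].
by apply: eq_Rintegral => s; rewrite inE/= in_itv/= => sab; rewrite gh.
Qed.

Lemma Rintegral_sum (I : Type) (l : seq I) (D : set R) (h : I -> R -> R) :
  measurable D -> (forall i, mu.-integrable D (EFin \o h i)) ->
  \int[mu]_(x in D) (\sum_(i <- l) h i x) = \sum_(i <- l) \int[mu]_(x in D) h i x.
Proof.
move=> mD ih; suff [] : \int[mu]_(x in D) (\sum_(i <- l) h i x) =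
    \sum_(i <- l) \int[mu]_(x in D) h i x /\
  mu.-integrable D (EFin \o (fun x => \sum_(i <- l) h i x)) by [].
elim: l => [|i l [IH1 IH2]].
  under eq_Rintegral do rewrite big_nil.
  rewrite big_nil Rintegral_cst// mul0r; split => //.
  apply: (eq_integrable _ (cst 0%E)) => //; last exact: integrable0.
  by move=> x _ /=; rewrite big_nil.
split.
  under eq_Rintegral do rewrite big_cons.
  by rewrite big_cons RintegralD// IH1.
have := integrableD _ (ih i) IH2 => /(_ mD).
by apply: eq_integrable => // x _ /=; rewrite big_cons EFinD.
Qed.

Lemma mulmx_mxint m n p a b (A : 'M[R]_(m, n)) (g : R -> 'M[R]_(n, p)) :
  bounded_meas a b g -> A *m mxint a b g = mxint a b (fun s => A *m g s).
Proof.
move=> bg; apply/matrixP => i j; rewrite !mxE.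
have ig k := @bounded_meas_integrable _ _ _ _ _ k j bg.
transitivity (\int[mu]_(s in `[a, b]) \sum_k A i k * g s k j); last first.
  by apply: eq_Rintegral => s _; rewrite mxE.
rewrite Rintegral_sum// => [|k].
  by apply: eq_bigr => k _; rewrite mxE RintegralZl.
have := integrableZl _ (A i k) (ig k) => /(_ (measurable_itv _)).
by apply: eq_integrable => // x _ /=; rewrite EFinM.
Qed.

Lemma mxint_mulmx m n p a b (A : 'M[R]_(n, p)) (g : R -> 'M[R]_(m, n)) :
  bounded_meas a b g -> mxint a b g *m A = mxint a b (fun s => g s *m A).
Proof.
move=> bg; apply/matrixP => i j; rewrite !mxE.
have ig k := @bounded_meas_integrable _ _ _ _ _ i k bg.
transitivity (\int[mu]_(s in `[a, b]) \sum_k A k j * g s i k); last first.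
  by apply: eq_Rintegral => s _; rewrite mxE; apply: eq_bigr => k _; rewrite mulrC.
rewrite Rintegral_sum// => [|k].
  by apply: eq_bigr => k _; rewrite mxE RintegralZl// mulrC.
have := integrableZl _ (A k j) (ig k) => /(_ (measurable_itv _)).
by apply: eq_integrable => // x _ /=; rewrite EFinM.
Qed.

End mxint.

(** * From local to global estimates *)

Section elementary.
Context {R : realType}.

Lemma le_geometric (x y C : R) : 0 <= C -> (forall n, x <= y + C / 2 ^+ n) -> x <= y.
Proof.
move=> C0 h; rewrite leNgt; apply/negP => yx.
have d0 : 0 < x - y by rewrite subr_gt0.
have Cd : 0 <= C / (x - y) by rewrite divr_ge0// ltW.
set n := Num.truncn (C / (x - y)).
have : C / (x - y) < 2 ^+ n.+1.
  apply: lt_le_trans (truncnS_gt _) _.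
  by rewrite -natrX ler_nat ltnW// ltn_expl.
rewrite ltr_pdivrMr// mulrC -ltr_pdivrMr ?exprn_gt0// => Cn.
by have := h n.+1; rewrite leNgt => /negP; apply; rewrite addrC -ltrBrDr.
Qed.

(** Gronwall's inequality with the integral hidden in [h]: an operator that
   halves the norm weighted by [expR (K * t)] cannot amplify [A] by more than 2. *)
Lemma weighted_gronwall (u : R -> R) (S A B K : R) : 0 <= A -> 0 <= B -> 0 <= K ->
  (forall t, 0 <= t <= S -> u t <= B) ->
  (forall m t, 0 <= m -> 0 <= t <= S ->
     (forall s, 0 <= s <= t -> u s <= m * expR (K * s)) ->
     u t <= A + m / 2 * expR (K * t)) ->
  forall t, 0 <= t <= S -> u t <= 2 * A * expR (K * t).
Proof.
move=> A0 B0 K0 uB h t tS.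
have e1 s : 0 <= s -> 1 <= expR (K * s).
  by move=> s0; rewrite -expR0 ler_expR mulr_ge0.
have main n : forall s, 0 <= s <= S -> u s <= (2 * A + B / 2 ^+ n) * expR (K * s).
  elim: n => [|n IH] s sS; have /andP[s0 sS'] := sS.
    rewrite expr0 divr1; apply: le_trans (uB _ sS) _.
    apply: le_trans (ler_peMr _ (e1 _ s0)); last by lra.
    by rewrite lerDr; lra.
  have m0 : 0 <= 2 * A + B / 2 ^+ n by rewrite addr_ge0 ?divr_ge0 ?exprn_ge0//; lra.
  have := h _ s m0 sS => /(_ _)/le_trans; apply.
    by move=> r /andP[r0 rs]; apply: IH; rewrite r0 (le_trans rs).
  rewrite [(2 * A + B / 2 ^+ n.+1)](_ : _ = A + (2 * A + B / 2 ^+ n) / 2); last first.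
    by rewrite exprSr invfM; field; rewrite expf_neq0.
  by rewrite [leRHS]mulrDl lerD2r ler_peMr ?e1.
have et : 0 < expR (K * t) by exact: expR_gt0.
rewrite -ler_pdivrMr//; apply: (@le_geometric _ _ B) => // n.
by rewrite ler_pdivrMr// main.
Qed.

End elementary.

Section local_to_global.
Context {R : realType} {V : normedModType R}.

(** Cut [a, b] into many equal pieces. With [c = 0] this stands for the argument
   that a function with zero derivative is constant, when increments are known
   only up to [o(t - s)], uniformly. *)
Lemma local_to_global (G : R -> V) (a b c : R) : 0 <= c -> a <= b ->
  (forall eta, 0 < eta -> exists2 delta, 0 < delta &
     forall s t, a <= s -> s <= t -> t <= b -> t - s <= delta ->
       `|G t - G s| <= (c + eta) * (t - s)) ->
  `|G b - G a| <= c * (b - a).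
Proof.
move=> c0; rewrite le_eqVlt => /predU1P[->|ab] H; first by rewrite !subrr normr0 mulr0.
have ba0 : 0 < b - a by rewrite subr_gt0.
suff main eta : 0 < eta -> `|G b - G a| <= (c + eta) * (b - a).
  apply/ler_addgt0Pr => e e0; apply: le_trans (main (e / (b - a)) _) _.
    by rewrite divr_gt0.
  by rewrite mulrDl divfK// gt_eqF.
move=> eta0; have [delta d0 h] := H _ eta0.
pose N := (Num.truncn ((b - a) / delta)).+1.
have N0 : 0 < N%:R :> R by rewrite ltr0n.
pose w := (b - a) / N%:R.
have w0 : 0 <= w by rewrite divr_ge0 ?ltW.
have wd : w <= delta.
  by rewrite /w ler_pdivrMr// mulrC -ler_pdivrMr// ltW// truncnS_gt.
have wN : N%:R * w = b - a by rewrite /w mulrC divfK// gt_eqF.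
have step k : (k <= N)%N -> `|G (a + k%:R * w) - G a| <= (c + eta) * (k%:R * w).
  elim: k => [|k IH] kN; first by rewrite mul0r addr0 subrr normr0 mulr0.
  have e1 : a + k.+1%:R * w - (a + k%:R * w) = w by rewrite -natr1; ring.
  have := h (a + k%:R * w) (a + k.+1%:R * w).
  rewrite e1 lerDl mulr_ge0// => /(_ isT).
  rewrite lerD2l ler_wpM2r// ?ler_nat// => /(_ isT).
  rewrite -lerBrDl -wN ler_wpM2r// ?ler_nat// => /(_ isT wd) h1.
  rewrite -(subrKA (G (a + k%:R * w))).
  apply: le_trans (ler_normD _ _) _.
  apply: le_trans (lerD h1 (IH (ltnW kN))) _.
  by rewrite -mulrDr -natr1 [X in _ <= _ * X]mulrDl mul1r [w + _]addrC.
by have := step _ (leqnn N); rewrite wN [a + _]addrC subrK.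
Qed.

End local_to_global.

(** * Integration by parts against Lipschitz integrands *)

Section integration_by_parts.
Context {R : realType} (m n k : nat).

(** [int H dV] for a Lipschitz [H] only sees the oscillation of [V = int J] and
   the size of [H], not the size of [J]: the function
   [t |-> int_p^t H J + H_t int_t^q J] has increments at most [L eta]. *)
Lemma mxint_lipschitz_mul (H : R -> 'M[R]_(m, n)) (J : R -> 'M[R]_(n, k))
    (p q L h eta : R) : p <= q -> 0 <= L -> 0 <= eta ->
  (forall s t, s \in `[p, q] -> t \in `[p, q] -> `|H s - H t| <= L * `|s - t|) ->
  `|H p| <= h -> bounded_meas p q J ->
  (forall r, r \in `[p, q] -> `|mxint r q J| <= eta) ->
  `|mxint p q (fun s => H s *m J s)| <= n%:R * (h * eta + L * eta * (q - p)).
Proof.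
move=> pq L0 eta0 HL Hh bJ Jeta.
have bH := lipschitz_bounded_meas HL.
have bHJ := bounded_measM bH bJ.
have pin : p \in `[p, q] by rewrite in_itv/= lexx.
pose G t := mxint p t (fun s => H s *m J s) + H t *m mxint t q J.
have Gq : G q = mxint p q (fun s => H s *m J s).
  by rewrite /G mxint_xx mulmx0 addr0.
have Gp : G p = H p *m mxint p q J by rewrite /G mxint_xx add0r.
have [C JC] := bJ.2.
have C0 : 0 <= C by apply: le_trans (JC _ pin).
suff GG : `|G q - G p| <= n%:R * (L * eta) * (q - p).
  rewrite -Gq -(subrK (G p) (G q)) (le_trans (ler_normD _ _))// mulrDr addrC.
  rewrite lerD//; last by rewrite mulrA.
  rewrite Gp (le_trans (mxnorm_mul _ _))// -mulrA ler_wpM2l// ler_pM//.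
  exact: Jeta.
apply: local_to_global => // [|e e0]; first by rewrite !mulr_ge0.
have D0 : 0 < n%:R * (L * C) + 1 by rewrite ltr_wpDl// !mulr_ge0.
exists (e / (n%:R * (L * C) + 1)) => [|s t ps st tq tse]; first by rewrite divr_gt0.
have sin : s \in `[p, q] by rewrite in_itv/= ps (le_trans st).
have tin : t \in `[p, q] by rewrite in_itv/= tq (le_trans ps).
have bJst : bounded_meas s t J by apply: bounded_measS bJ.
have bHst : bounded_meas s t H by apply: bounded_measS bH.
have -> : G t - G s = mxint s t (fun r => (H r - H s) *m J r)
                      + (H t - H s) *m mxint t q J.
  rewrite /G (@mxint_split _ _ _ p s t) //; last by apply: bounded_measS bHJ.
  rewrite (@mxint_split _ _ _ s t q J)//; last exact: bounded_measS bJ.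
  have -> : mxint s t (fun r => (H r - H s) *m J r) =
      mxint s t (fun r => H r *m J r) - H s *m mxint s t J.
    rewrite mulmx_mxint//.
    rewrite -mxintB; last 2 first.
    - exact: bounded_measM.
    - by apply: bounded_measM => //; exact: bounded_meas_cst.
    by apply: eq_mxint => r _; rewrite mulmxBl.
  rewrite mulmxDr mulmxBl !opprD !addrA; apply/matrixP => i j; rewrite !mxE; ring.
have ts0 : 0 <= t - s by rewrite subr_ge0.
have HsL r : r \in `[s, t] -> `|H r - H s| <= L * (t - s).
  rewrite in_itv/= => /andP[sr rt]; apply: le_trans (HL _ _ _ _) _ => //.
    by rewrite in_itv/= (le_trans ps)// (le_trans rt).
  by rewrite ger0_norm ?subr_ge0// ler_wpM2l// lerB.
apply: le_trans (ler_normD _ _) _; rewrite [leRHS]mulrDl addrC lerD//.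
- apply: le_trans (mxnorm_mul _ _) _.
  rewrite -!mulrA ler_wpM2l// [eta * _]mulrC !mulrA ler_pM//; last exact: Jeta.
  by apply: HsL; rewrite in_itv/= lexx andbT.
- apply: (@le_trans _ _ (n%:R * (L * (t - s)) * C * (t - s))).
    apply: mxint_norm => // [|r rst].
      apply: bounded_measM => //; apply: bounded_measB => //.
      exact: bounded_meas_cst.
    apply: le_trans (mxnorm_mul _ _) _; rewrite ler_pM ?mulr_ge0//.
      by rewrite ler_wpM2l// HsL.
    by apply: JC; move: rst; rewrite !in_itv/= => /andP[sr rt]; rewrite (le_trans ps) ?(le_trans rt).
  rewrite ler_wpM2r//; rewrite ler_pdivlMr// in tse; apply: le_trans tse.
  rewrite (_ : n%:R * (L * (t - s)) * C = (t - s) * (n%:R * (L * C))); last by ring.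
  by rewrite ler_wpM2l// lerDl.
Qed.

End integration_by_parts.

(** * Affine changes of variables *)

Section affine.
Context {R : realType}.
Local Notation mu := (@lebesgue_measure R).
Context (c e : R) (e0 : 0 < e).

Local Notation RM := (measurableTypeR R).

Let phi : RM -> RM := fun u => c + e * u.

Lemma measurable_affine (D : set R) : measurable_fun D (fun u : R => c + e * u).
Proof. by apply: measurable_funD => //; exact: mulrl_measurable. Qed.

Let mphi : measurable_fun setT phi. Proof. exact: measurable_affine. Qed.

Lemma preimage_affine_segment (a b : R) :
  (fun u => c + e * u) @^-1` `[c + e * a, c + e * b] = `[a, b]%classic.
Proof.
by apply/seteqP; split => x /=; rewrite !in_itv/= !lerD2l !ler_pM2l.
Qed.

Let pf : {measure set RM -> \bar R} :=
  measure_function_pushforward__canonical__measure_function_Measure mu mphi.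

Lemma lebesgue_measure_affine (A : set RM) : measurable A ->
  mscale (NngNum (ltW e0)) pf A = mu A.
Proof.
move=> mA; apply/esym/(@lebesgue_measure_unique _ (mscale (NngNum (ltW e0)) pf)) => //.
move=> _ [[a b]] _ <-.
transitivity (e%:E * mu (phi @^-1` `]a, b]))%E; last by [].
rewrite /=.
have -> : phi @^-1` `]a, b] = `](a - c) / e, (b - c) / e]%classic.
  apply/seteqP; split => x /=; rewrite /phi !in_itv/= ltr_pdivrMr// ler_pdivlMr//;
  by rewrite [x * _]mulrC ltrBlDl lerBrDl.
rewrite !lebesgue_measure_itv/= !lte_fin ltr_pM2r ?invr_gt0// ltrD2r.
case: ifPn => ab; last by rewrite mule0.
rewrite -!EFinB -EFinM; congr EFin; field; exact: lt0r_neq0.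
Qed.

Let ge0_affine (D : set RM) (h : RM -> \bar R) : measurable D ->
  measurable_fun setT h -> (forall x, (0 <= h x)%E) ->
  (\int[mu]_(r in D) h r = e%:E * \int[mu]_(r in phi @^-1` D) (h \o phi) r)%E.
Proof.
move=> mD mh h0; have mh' : measurable_fun D h by exact: measurable_funTS.
rewrite -(@ge0_integral_pushforward _ _ _ _ _ phi mphi mu D h mD mh') => [|y _//].
rewrite -(ge0_integral_mscale pf mD (NngNum (ltW e0)) mh') => [|x _//].
by apply: eq_measure_integral => A mA _; exact/esym/lebesgue_measure_affine.
Qed.

Lemma Rintegral_affine (a b : R) (g : R -> R) :
  measurable_fun `[c + e * a, c + e * b] g ->
  mu.-integrable `[a, b] (EFin \o (fun u => g (c + e * u))) ->
  \int[mu]_(r in `[c + e * a, c + e * b]) g r =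
  e * \int[mu]_(u in `[a, b]) g (c + e * u).
Proof.
move=> mg ig; set D : set RM := `[c + e * a, c + e * b]%classic.
pose G : RM -> \bar R := (EFin \o g) \_ D.
have mD : measurable D by exact: measurable_itv.
have mG : measurable_fun setT G by apply/(measurable_restrictT _ mD)/measurable_EFinP.
have GE : {in D, EFin \o g =1 G} by move=> r rD; rewrite /G patchE rD.
have GE' : {in `[a, b]%classic, (fun u => (g (c + e * u))%:E) =1 G \o phi}.
  move=> u uab; rewrite /= -GE//; move: uab; rewrite -preimage_affine_segment.
  by rewrite !inE.
have iG : mu.-integrable `[a, b] (G \o phi).
  by apply: eq_integrable ig => // u /GE'.
rewrite /Rintegral (eq_integral _ _ GE).
rewrite (_ : (\int[mu]_(u in `[a, b]) (g (c + e * u))%:E)%E =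
    (\int[mu]_(u in `[a, b]) (G \o phi) u)%E); last by apply: eq_integral => u /GE'.
rewrite integralE [in RHS]integralE.
have p1 := @ge0_affine D _ mD (measurable_funepos mG) (funepos_ge0 G).
have p2 := @ge0_affine D _ mD (measurable_funeneg mG) (funeneg_ge0 G).
rewrite p1 p2 preimage_affine_segment.
have f1 := integrable_pos_fin_num _ iG; move: f1 => /(_ (measurable_itv _)) f1.
have f2 := integrable_neg_fin_num _ iG; move: f2 => /(_ (measurable_itv _)) f2.
have c1 : (G^\+ \o phi = (G \o phi)^\+)%E by rewrite funepos_comp.
have c2 : (G^\- \o phi = (G \o phi)^\-)%E by rewrite funeneg_comp.
rewrite c1 c2.
rewrite -muleBr//; last by rewrite fin_num_adde_defr.
by rewrite fineM// fin_numB; apply/andP.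
Qed.

End affine.

Section mxint_affine.
Context {R : realType} (m n : nat).

Lemma bounded_meas_affine (c e a b : R) (g : R -> 'M[R]_(m, n)) : 0 < e ->
  bounded_meas (c + e * a) (c + e * b) g -> bounded_meas a b (fun u => g (c + e * u)).
Proof.
move=> e0 [mg [C gC]]; split => [i j|].
  apply: (measurable_comp _ _ (mg i j)) => //; last exact: measurable_affine.
  move=> _ [u /= uab <-]; move: uab; rewrite !in_itv/= => /andP[h1 h2].
  by rewrite !lerD2l !ler_pM2l// h1.
exists C => u; rewrite in_itv/= => /andP[h1 h2]; apply: gC.
by rewrite in_itv/= !lerD2l !ler_pM2l// h1.
Qed.

Lemma mxint_affine (c e a b : R) (g : R -> 'M[R]_(m, n)) : 0 < e ->
  bounded_meas (c + e * a) (c + e * b) g ->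
  mxint (c + e * a) (c + e * b) g = e *: mxint a b (fun u => g (c + e * u)).
Proof.
move=> e0 bg; apply/matrixP => i j; rewrite !mxE.
apply: (@Rintegral_affine _ _ _ e0 _ _ (fun r => g r i j)); first exact: bg.1.
exact: (bounded_meas_integrable _ _ (bounded_meas_affine e0 bg)).
Qed.

End mxint_affine.

(** * Taylor estimates and solutions of ordinary differential equations *)

Section taylor.
Context {R : realType} (n : nat).

Lemma is_derive_entry p q (h : R -> 'M[R]_(p, q)) (t : R) (dh : 'M[R]_(p, q)) i j :
  is_derive t (1 : R) h dh -> is_derive t (1 : R) (fun s => h s i j) (dh i j).
Proof.
move=> [dh1 <-]; have /derivable1_diffP dh' := dh1.
have dij := (derivable_mxP h t (1 : R)).1 dh1 i j.
by apply: DeriveDef => //; rewrite derive_mx// mxE.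
Qed.

Lemma is_derive_line p q (g : 'rV[R]_n -> 'M[R]_(p, q)) (x h : 'rV[R]_n) (t : R) :
  differentiable g (x + t *: h) ->
  is_derive t (1 : R) (fun s => g (x + s *: h)) ('d g (x + t *: h) h).
Proof.
move=> dg; pose l := fun s : R => x + s *: h.
have dl : is_diff t l (cst 0 + *:%R ^~ h).
  exact: is_diffD (is_diff_cst x t) (is_diff_scalel _ _).
have dl1 : differentiable l t by case: dl.
have dgl : differentiable (g \o l) t by exact: differentiable_comp.
apply: DeriveDef; first exact/derivable1_diffP.
rewrite deriveE// (_ : (fun s => g (x + s *: h)) = g \o l)// diff_comp//=.
by case: dl => _ ->; rewrite /= add0r scale1r.
Qed.

Lemma mean_value_entry p q (g : 'rV[R]_n -> 'M[R]_(p, q)) (x h : 'rV[R]_n) i j :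
  (forall y, differentiable g y) ->
  exists2 c : R, 0 <= c <= 1 & (g (x + h) - g x) i j = ('d g (x + c *: h) h) i j.
Proof.
move=> dg; pose f := fun s : R => g (x + s *: h) i j.
have df (s : R) : is_derive s (1 : R) f (('d g (x + s *: h) h) i j).
  by apply: is_derive_entry; exact: is_derive_line.
have [|c c01] := @MVT_segment _ f (fun s => ('d g (x + s *: h) h) i j) 0 1 ler01.
- apply: continuous_subspaceT => s; apply: differentiable_continuous.
  exact/derivable1_diffP/(@ex_derive _ _ _ _ _ _ _ (df s)).
rewrite /f scale1r scale0r addr0 subr0 mulr1 => E.
by exists c; [move: c01; rewrite in_itv|rewrite !mxE].
Qed.

Lemma diff_jacobian m (g : 'rV[R]_n -> 'rV[R]_m) x h :
  differentiable g x -> 'd g x h = h *m 'J g x.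
Proof. by move=> dg; rewrite -deriveEjacobian// deriveE. Qed.

Section C2.
Context (C : R) (g : 'rV[R]_n -> 'rV[R]_n) (gC : C2_bounded C g).

Lemma C2_bounded_ge0 : 0 <= C.
Proof. by have [_ _ /(_ 0) + _ _] := gC; apply: le_trans. Qed.

Lemma C2_bounded_lipschitz x y : `|g y - g x| <= n%:R * C * `|y - x|.
Proof.
have [dg _ _ JC _] := gC; have C0 := C2_bounded_ge0.
apply: mxnorm_le => [|i j]; first by rewrite !mulr_ge0.
have [c _] := mean_value_entry x (y - x) i j dg.
rewrite [x + _]addrC subrK => ->; rewrite diff_jacobian//.
apply: le_trans (mxnorm_entry _ _ _) _; apply: le_trans (mxnorm_mul _ _) _.
by rewrite mulrAC ler_wpM2r// ler_wpM2l.
Qed.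

Lemma C2_bounded_jacobian_lipschitz x y : `|'J g y - 'J g x| <= C * `|y - x|.
Proof.
have [_ dJ _ _ dJC] := gC; have C0 := C2_bounded_ge0.
apply: mxnorm_le => [|i j]; first by rewrite !mulr_ge0.
have [c _] := mean_value_entry x (y - x) i j dJ.
rewrite [x + _]addrC subrK => ->.
exact: le_trans (mxnorm_entry _ _ _) (dJC _ _).
Qed.

Lemma C2_bounded_taylor x y :
  `|g y - g x - (y - x) *m 'J g x| <= n%:R * C * `|y - x| ^+ 2.
Proof.
have [dg _ _ _ _] := gC; have C0 := C2_bounded_ge0.
apply: mxnorm_le => [|i j]; first by rewrite !mulr_ge0.
have [c /andP[c0 c1]] := mean_value_entry x (y - x) i j dg.
rewrite [x + (y - x)]addrC subrK => E.
rewrite mxE E diff_jacobian// [X in _ + X]mxE.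
rewrite (_ : _ - _ = ((y - x) *m ('J g (x + c *: (y - x)) - 'J g x)) i j); last first.
  by rewrite mulmxBr [RHS]mxE [X in _ = _ + X]mxE.
apply: le_trans (mxnorm_entry _ _ _) _; apply: le_trans (mxnorm_mul _ _) _.
rewrite expr2 mulrA -!mulrA ler_wpM2l// mulrCA ler_wpM2l//.
apply: le_trans (C2_bounded_jacobian_lipschitz _ _) _.
rewrite ler_wpM2l// addrC addKr normrZ ger0_norm// ler_piMl//.
Qed.
End C2.

End taylor.

Section ode.
Context {R : realType} (n : nat).

Lemma ode_solution_mxint (g : 'rV[R]_n -> 'rV[R]_n) x (h : R -> 'rV[R]_n) :
  continuous g -> ode_solution g x h ->
  forall s t, 0 <= s -> s <= t -> h t = h s + mxint s t (g \o h).
Proof.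
move=> cg [h0 ch dh] s t s0; rewrite le_eqVlt => /predU1P[->|st].
  by rewrite mxint_xx addr0.
have ch' : {within `[s, t], continuous h}.
  apply: continuous_subspaceW ch => r /=; rewrite !in_itv/= => /andP[sr _].
  by rewrite (le_trans s0).
have cgh : {within `[s, t], continuous (g \o h)}.
  move=> r; apply: (@continuous_comp _ _ _ (h : subspace `[s, t] -> _) g).
    exact: ch'.
  exact: cg.
apply/eqP; rewrite addrC -subr_eq; apply/eqP/matrixP => i j; rewrite !mxE /Rintegral.
have ce (f : R -> 'rV[R]_n) : {within `[s, t], continuous f} ->
    {within `[s, t], continuous (fun r => f r i j)}.
  move=> cf r; apply: (@continuous_comp _ _ _ _ (fun A : 'rV[R]_n => A i j)).
    exact: cf.
  exact: coord_continuous.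
rewrite (@continuous_FTC2 _ _ (fun r => h r i j))//.
- exact: (ce (g \o h)).
- have /(continuous_within_itvP _ st)[_ h1 h2] := ce _ ch'; split => // r.
  rewrite in_itv/= => /andP[sr _].
  by have [] := is_derive_entry i j (dh r (le_lt_trans s0 sr)).
- move=> r; rewrite in_itv/= => /andP[sr _]; rewrite derive1E.
  by have [_ ->] := is_derive_entry i j (dh r (le_lt_trans s0 sr)).
Qed.

End ode.

(** * The ordered exponential and linear equations *)

Section gronwall.
Context {R : realType} (m n : nat).

Lemma mxint_gronwall (u : R -> R) (a S A B L : R) : 0 <= a -> 0 <= A -> 0 <= B -> 0 <= L ->
  (forall t, a <= t <= S -> 0 <= u t <= B) ->
  (forall t, a <= t <= S -> exists g : R -> 'M[R]_(m, n),
     [/\ bounded_meas a t g, forall r, r \in `[a, t] -> `|g r| <= L * u r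
       & u t <= A + `|mxint a t g|]) ->
  forall t, a <= t <= S -> u t <= 2 * A * expR ((2 * L + 1) * t).
Proof.
move=> a0 A0 B0 L0 uB H t0 /andP[at0 t0S].
have K0 : 0 < 2 * L + 1 by rewrite ltr_wpDl// mulr_ge0.
pose u' t := if t < a then 0 else u t.
have -> : u t0 = u' t0 by rewrite /u' ltNge at0.
apply: (@weighted_gronwall _ u' S A B) => //.
- exact: ltW.
- move=> t /andP[_ tS]; rewrite /u'; case: ltP => // at_.
  by have /(_ _)/andP[|] := uB t; rewrite ?at_ ?tS.
- move=> M t M0 /andP[t00 tS] uM; rewrite {1}/u'; case: ltP => at_.
    by rewrite addr_ge0// mulr_ge0 ?expR_ge0// divr_ge0.
  have [|g [bg gL h]] := H t; first by rewrite at_ tS.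
  apply: le_trans h _; rewrite lerD2l.
  apply: le_trans (@mxint_norm_exp _ _ _ a t g (L * M) _ K0 _ at_ bg _) _.
  + exact: mulr_ge0.
  + move=> s /[dup] sat /gL /le_trans; apply; rewrite -mulrA ler_wpM2l//.
    move: sat; rewrite in_itv/= => /andP[as_ st].
    have := uM s; rewrite {1}/u' ltNge as_ st (le_trans a0)//=; exact.
  + rewrite ler_wpM2r ?expR_ge0// ler_pdivrMr// mulrAC ler_pdivlMr//.
    by rewrite [_ * M]mulrC -mulrA ler_wpM2l//; lra.
- by rewrite (le_trans a0)// at0.
Qed.

End gronwall.

Section volterra.
Context {R : realType} (m n : nat).

(** Exchanges the two integrations in [int_0^t int_r^t k(r, u) A(u) du dr]
   without measurability on the product: over a short time interval both sides
   have the same increment up to the square of its length. *)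
Lemma volterra (k : R -> R -> 'M[R]_(m, n)) (k0 : R -> 'M[R]_(m, n))
    (A : R -> 'M[R]_n) (S B C : R) :
  bounded_meas 0 S k0 -> bounded_meas 0 S A ->
  (forall r, r \in `[0, S] -> `|A r| <= C) ->
  (forall t, 0 <= t <= S -> bounded_meas 0 t (k ^~ t)) ->
  (forall r t, 0 <= r -> r <= t -> t <= S -> bounded_meas r t (k r)) ->
  (forall r t, 0 <= r -> r <= t -> t <= S -> `|k r t| <= B) ->
  (forall r t, 0 <= r -> r <= t -> t <= S ->
     k r t = k0 r + mxint r t (fun u => k r u *m A u)) ->
  forall t, 0 <= t <= S ->
  mxint 0 t (k ^~ t) = mxint 0 t (fun u => k0 u + mxint 0 u (k ^~ u) *m A u).
Proof.
move=> bk0 bA AC bk1 bk2 kB kE t0 /andP[t00 t0S].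
have S0 : 0 <= S by exact: le_trans t0S.
have B0 : 0 <= B by apply: le_trans (kB 0 0 _ _ _).
have C0 : 0 <= C by apply: le_trans (AC 0 _); rewrite // in_itv/= lexx.
have bAS s t : 0 <= s -> t <= S -> bounded_meas s t A.
  by move=> ? ?; apply: bounded_measS bA.
have ACs s t r : 0 <= s -> t <= S -> r \in `[s, t] -> `|A r| <= C.
  move=> s0 tS; rewrite in_itv/= => /andP[sr rt].
  by apply: AC; rewrite in_itv/= (le_trans s0)// (le_trans rt).
have bkA r s t : 0 <= r -> r <= s -> t <= S -> bounded_meas s t (fun u => k r u *m A u).
  move=> r0 rs tS; case: (leP r t) => rt; last first.
    split=> [i j|]; last first.
      by exists 0 => u; rewrite in_itv/= => /andP[su ut]; have := lt_le_trans rt (le_trans rs (le_trans su ut)); rewrite ltxx.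
    rewrite set_itv_ge ?bnd_simp -?ltNge ?(lt_le_trans rt)//; exact: measurable_fun_set0.
  apply: bounded_measM; last by apply: bAS => //; exact: le_trans rs.
  by apply: (@bounded_measS _ _ _ r t) => //; exact: bk2.
have kAB r s t : 0 <= r -> r <= s -> s <= t -> t <= S ->
    `|mxint s t (fun u => k r u *m A u)| <= n%:R * B * C * (t - s).
  move=> r0 rs st tS; apply: mxint_norm => //; first exact: bkA.
  move=> u; rewrite in_itv/= => /andP[su ut].
  apply: le_trans (mxnorm_mul _ _) _; rewrite ler_pM ?mulr_ge0//.
    by rewrite ler_wpM2l// kB// ?(le_trans rs)// (le_trans ut).
  apply: AC; rewrite in_itv/= (le_trans r0)/= ?(le_trans ut)//.
  exact: le_trans su.
have kinc r s t : 0 <= r -> r <= s -> s <= t -> t <= S ->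
    k r t - k r s = mxint s t (fun u => k r u *m A u).
  move=> r0 rs st tS; rewrite (kE r t)// ?(kE r s)// ?(le_trans st)//; last exact: le_trans rs st.
  rewrite (@mxint_split _ _ _ r s t)//; last exact: bkA.
  by rewrite opprD addrACA subrr add0r addrAC subrr add0r.
pose z t := mxint 0 t (k ^~ t).
have zB t : 0 <= t -> t <= S -> `|z t| <= B * S.
  move=> t0_ tS; apply: le_trans (mxint_norm t0_ (bk1 _ _) _) _.
  - by rewrite t0_ tS.
  - by move=> r; rewrite in_itv/= => /andP[r0 rt]; apply: kB.
  - by rewrite subr0 ler_wpM2l.
have bk1s s t u v : 0 <= s -> s <= t -> t <= u -> u <= v -> v <= S -> bounded_meas s t (k ^~ v).
  move=> s0 st tu uv vS; apply: (@bounded_measS _ _ _ 0 v s t) => //; first exact: (le_trans tu).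
  by apply: bk1; rewrite vS andbT (le_trans s0)// (le_trans st)// (le_trans tu).
have zinc s t : 0 <= s -> s <= t -> t <= S ->
    z t - z s = mxint s t (k ^~ t) + mxint 0 s (fun r => k r t - k r s).
  move=> s0 st tS; rewrite /z (@mxint_split _ _ _ 0 s t)//; last first.
    by apply: (@bk1s 0 t t t) => //; exact: le_trans st.
  rewrite mxintB; [by rewrite addrAC addrC|exact: (bk1s _ _ s)|].
  by apply: (bk1s _ _ s) => //; exact: le_trans tS.
have zL s t : 0 <= s -> s <= t -> t <= S -> `|z t - z s| <= (B + n%:R * B * C * S) * (t - s).
  move=> s0 st tS; rewrite zinc// mulrDl; apply: le_trans (ler_normD _ _) _; apply: lerD.
    apply: mxint_norm => //; first by apply: (bk1s _ _ t).
    by move=> r; rewrite in_itv/= => /andP[sr rt]; apply: kB => //; exact: le_trans sr.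
  apply: le_trans (@mxint_norm _ _ _ _ _ _ (n%:R * B * C * (t - s)) s0 _ _) _.
  - apply: bounded_measB; first exact: (bk1s _ _ s).
    by apply: (bk1s _ _ s) => //; exact: le_trans tS.
  - by move=> r; rewrite in_itv/= => /andP[r0 rs]; rewrite kinc//; exact: kAB.
  - rewrite subr0 -!mulrA; do 3 (rewrite ler_wpM2l//).
    by rewrite mulrC ler_wpM2r ?subr_ge0// (le_trans st).
have bz s t : 0 <= s -> t <= S -> bounded_meas s t z.
  move=> s0 tS; apply: (@lipschitz_bounded_meas _ _ _ _ _ (B + n%:R * B * C * S)) => u v.
  rewrite !in_itv/= => /andP[su ut] /andP[sv vt].
  have u0 := le_trans s0 su; have v0 := le_trans s0 sv.
  have uS := le_trans ut tS; have vS := le_trans vt tS.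
  case: (leP u v) => uv.
    by rewrite distrC [`|u - v|]distrC [`|v - u|]ger0_norm ?subr_ge0// zL.
  have vu := ltW uv; by rewrite [`|u - v|]ger0_norm ?subr_ge0// zL.
have bzA s t : 0 <= s -> t <= S -> bounded_meas s t (fun u => k0 u + z u *m A u).
  move=> s0 tS; apply: bounded_measD; first exact: bounded_measS bk0.
  by apply: bounded_measM; [exact: bz|exact: bAS].
pose G t := z t - mxint 0 t (fun u => k0 u + z u *m A u).
have G0 : G 0 = 0 by rewrite /G /z !mxint_xx subr0.
suff : `|G t0 - G 0| <= 0 * (t0 - 0).
  by rewrite mul0r normr_le0 G0 subr0 /G subr_eq0 => /eqP.
pose D1 := n%:R * B * C.
pose D2 := n%:R * ((n%:R * B * C) * C).
pose D3 := n%:R * ((B + n%:R * B * C * S) * C).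
have D0 : 0 < D1 + D2 * S + D3 + 1.
  by rewrite ltr_wpDl// !addr_ge0 ?mulr_ge0 ?addr_ge0 ?mulr_ge0.
apply: local_to_global => // e e0.
exists (e / (D1 + D2 * S + D3 + 1)) => [|s t s0 st tt0 tse]; first by rewrite divr_gt0.
have tS := le_trans tt0 t0S; have sS := le_trans st tS.
have t00' := le_trans s0 st.
have h0 : 0 <= t - s by rewrite subr_ge0.
have -> : G t - G s = mxint s t (fun r => k r t - k0 r)
    + mxint 0 s (fun r => k r t - k r s - k r s *m mxint s t A)
    - mxint s t (fun u => (z u - z s) *m A u).
  have -> : G t - G s = z t - z s - mxint s t (fun u => k0 u + z u *m A u).
    rewrite /G (@mxint_split _ _ _ 0 s t _ s0 st (bzA _ _ _ _))//.
    apply/matrixP => i j; rewrite !mxE; ring.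
  rewrite zinc// [mxint s t (fun u => k0 u + _)]mxintD//; last 2 first.
  - exact: bounded_measS bk0.
  - by apply: bounded_measM; [exact: bz|exact: bAS].
  have bkts : bounded_meas s t (k ^~ t) by exact: (bk1s _ _ t).
  have bkt0 : bounded_meas 0 s (k ^~ t) by exact: (bk1s _ _ s).
  have bks0 : bounded_meas 0 s (k ^~ s) by apply: (bk1s _ _ s).
  have bk0s : bounded_meas s t k0 by exact: bounded_measS bk0.
  have bAst := bAS s t s0 tS.
  have bzst := bz s t s0 tS.
  rewrite [mxint s t (fun r => k r t - k0 r)]mxintB//.
  rewrite [mxint 0 s (fun r => _ - _ *m _)]mxintB; last 2 first.
  - exact: bounded_measB.
  - by apply: bounded_measM => //; exact: bounded_meas_cst.
  rewrite -mxint_mulmx// -/(z s) mulmx_mxint//.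
  have -> : mxint s t (fun u => (z u - z s) *m A u) =
      mxint s t (fun u => z u *m A u) - mxint s t (fun u => z s *m A u).
    rewrite -mxintB; last 2 first.
    - exact: bounded_measM.
    - by apply: bounded_measM => //; exact: bounded_meas_cst.
    by apply: eq_mxint => u _; rewrite mulmxBl.
  move: (mxint s t (k^~ t)) (mxint 0 s (fun r => k r t - k r s)) (mxint s t k0)
    (mxint s t (fun s1 => z s1 *m A s1)) (mxint s t (fun u => z s *m A u)) => a b c e' f'.
  by apply/matrixP => i j; rewrite !mxE; ring.
have b1 : `|mxint s t (fun r => k r t - k0 r)| <= D1 * (t - s) * (t - s).
  apply: mxint_norm => //.
    apply: bounded_measB; first exact: (bk1s _ _ t).
    exact: bounded_measS bk0.
  move=> r; rewrite in_itv/= => /andP[sr rt]; have r0 := le_trans s0 sr.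
  rewrite kE// addrC addKr; apply: le_trans (kAB _ _ _ _ _ _ _) _ => //.
  by rewrite ler_wpM2l ?mulr_ge0// lerB.
have b2 : `|mxint 0 s (fun r => k r t - k r s - k r s *m mxint s t A)|
    <= D2 * (t - s) * (t - s) * S.
  apply: le_trans (@mxint_norm _ _ _ _ _ _ (D2 * (t - s) * (t - s)) s0 _ _) _.
  - apply: bounded_measB; last first.
      apply: bounded_measM; last exact: bounded_meas_cst.
      exact: (bk1s _ _ s).
    by apply: bounded_measB; exact: (bk1s _ _ s).
  - move=> r; rewrite in_itv/= => /andP[r0 rs].
    have bkrA := bkA r s t r0 rs tS.
    rewrite kinc// mulmx_mxint; last exact: bAS.
    rewrite -mxintB//; last first.
      by apply: bounded_measM; [exact: bounded_meas_cst|exact: bAS].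
    apply: mxint_norm => //.
      apply: bounded_measB => //.
      by apply: bounded_measM; [exact: bounded_meas_cst|exact: bAS].
    move=> u ust; rewrite -mulmxBl; apply: le_trans (mxnorm_mul _ _) _.
    rewrite /D2 -mulrA -[leRHS]mulrA ler_wpM2l// mulrAC ler_pM//; last exact: (ACs s t).
    move: ust; rewrite in_itv/= => /andP[su ut].
    rewrite kinc// ?(le_trans ut)//; apply: le_trans (kAB _ _ _ _ _ _ _) _ => //.
      exact: le_trans ut tS.
    by rewrite ler_wpM2l ?mulr_ge0// lerB.
  - by rewrite subr0 ler_wpM2l ?mulr_ge0.
have b3 : `|mxint s t (fun u => (z u - z s) *m A u)| <= D3 * (t - s) * (t - s).
  apply: mxint_norm => //.
    apply: bounded_measM; last exact: bAS.
    by apply: bounded_measB; [exact: bz|exact: bounded_meas_cst].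
  move=> u ust; apply: le_trans (mxnorm_mul _ _) _.
  rewrite /D3 -mulrA -[leRHS]mulrA ler_wpM2l// mulrAC ler_pM//; last exact: (ACs s t).
  move: ust; rewrite in_itv/= => /andP[su ut].
  apply: le_trans (zL _ _ _ _ _) _ => //; first exact: le_trans ut tS.
  by rewrite ler_wpM2l ?lerB// addr_ge0 ?mulr_ge0.
rewrite add0r.
apply: le_trans (ler_normB _ _) _; apply: le_trans (lerD (ler_normD _ _) (lexx _)) _.
apply: le_trans (lerD (lerD b1 b2) b3) _.
rewrite ler_pdivlMr// in tse.
have -> : D1 * (t - s) * (t - s) + D2 * (t - s) * (t - s) * S + D3 * (t - s) * (t - s)
  = ((t - s) * (D1 + D2 * S + D3)) * (t - s) by ring.
rewrite ler_wpM2r//; apply: le_trans tse; rewrite ler_wpM2l//.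
by rewrite lerDl.
Qed.

End volterra.

Section geometric.
Context {R : realType}.

Lemma series_geometric_cvg (V : completeNormedModType R) (u : V^nat) (c : R) : 0 <= c ->
  (forall k, `|u k| <= c / 2 ^+ k) ->
  forall N, `|limn (series u) - series u N| <= 2 * c / 2 ^+ N.
Proof.
move=> c0 uc.
have step N m : `|series u (N + m)%N - series u N| <= 2 * c / 2 ^+ N - 2 * c / 2 ^+ (N + m).
  elim: m => [|m IH]; first by rewrite addn0 !subrr normr0.
  rewrite addnS seriesSr -addrA addrCA; apply: le_trans (ler_normD _ _) _.
  apply: le_trans (lerD (uc _) IH) _.
  by rewrite exprSr invfM le_eqVlt; apply/orP; left; apply/eqP; field; rewrite !expf_neq0.
have stepb N m : `|series u (N + m)%N - series u N| <= 2 * c / 2 ^+ N.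
  by apply: le_trans (step _ _) _; rewrite lerBlDr lerDl divr_ge0 ?mulr_ge0 ?exprn_ge0.
have cv : cvgn (series u).
  apply: normed_cvg; apply: (@series_le_cvg _ _ (geometric c 2^-1)).
  - by move=> k /=.
  - by move=> k; rewrite mulr_ge0// exprn_ge0.
  - by move=> k; rewrite /= exprVn.
  - by apply: is_cvg_geometric_series; rewrite gtr0_norm//; lra.
move=> N; apply/ler_addgt0Pl => e e0.
have /cvgrPdist_le/(_ _ e0) := cv; case=> m _ /(_ (N + m)%N)/= h.
rewrite -(subrKA (series u (N + m)%N)); apply: le_trans (ler_normD _ _) _.
by rewrite lerD// h//= leq_addl.
Qed.

End geometric.

Section ordered_exponential.
Context {R : realType} (n : nat) (A : R -> 'M[R]_n) (S C : R).
Hypothesis bA : bounded_meas 0 S A.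
Hypothesis AC : forall r, r \in `[0, S] -> `|A r| <= C.
Hypothesis C0 : 0 <= C.

Local Notation K := (2 * (n%:R * C) + 1).
Local Notation E := (expR (K * S)).
Local Notation L := (2 * n%:R * C * E).

Let K0 : 0 < K. Proof. by rewrite ltr_wpDl// !mulr_ge0. Qed.
Let E0 : 0 < E. Proof. exact: expR_gt0. Qed.

Let L0 : 0 <= L. Proof. by rewrite !mulr_ge0// ltW. Qed.

Let bAS s t : 0 <= s -> t <= S -> bounded_meas s t A.
Proof. by move=> ? ?; apply: bounded_measS bA. Qed.

Let in0S r s t : 0 <= s -> t <= S -> r \in `[s, t] -> r \in `[0, S].
Proof.
move=> s0 tS; rewrite !in_itv/= => /andP[sr rt].
by rewrite (le_trans s0)// (le_trans rt).
Qed.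

(** Each integration gains a factor 2 in the weighted norm. *)
Lemma iterated_mxint_bound s k : 0 <= s ->
  (forall t, t \in `[s, S] ->
     `|iterated_mxint A k s t| <= expR (- K * s) / 2 ^+ k * expR (K * t)) /\
  (forall t t', t \in `[s, S] -> t' \in `[s, S] ->
     `|iterated_mxint A k s t - iterated_mxint A k s t'| <= L / 2 ^+ k * `|t - t'|).
Proof.
move=> s0; elim: k => [|k [IHb IHl]].
  split=> [t|t t' _ _] /=; last by rewrite subrr normr0 mulr_ge0 ?divr_ge0.
  rewrite in_itv/= => /andP[st _]; apply: le_trans (mxnorm1 _) _.
  rewrite expr0 divr1 -expRD; apply: le_trans (expR_ge1Dx _).
  by rewrite lerDl mulNr addrC subr_ge0 ler_wpM2l// ltW.
have ds : 0 < 2 ^+ k :> R by rewrite exprn_gt0.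
have bI t : t <= S -> bounded_meas s t (iterated_mxint A k s).
  move=> tS; apply: bounded_measS (lexx s) tS _.
  exact: lipschitz_bounded_meas IHl.
have bIA t : t <= S -> bounded_meas s t (fun u => iterated_mxint A k s u *m A u).
  by move=> tS; apply: bounded_measM; [exact: bI|exact: bAS].
split => [t|t t'].
  rewrite in_itv/= => /andP[st tS].
  apply: le_trans (@mxint_norm_exp _ _ _ s t _ (n%:R * C * (expR (- K * s) / 2 ^+ k)) K K0 _ st (bIA _ tS) _) _.
  - by rewrite !mulr_ge0 ?invr_ge0 ?expR_ge0 ?(ltW ds).
  - move=> r rst; apply: le_trans (mxnorm_mul _ _) _.
    rewrite -[leRHS]mulrA -mulrA -[leRHS]mulrA ler_wpM2l// mulrC ler_pM//.
      by apply: AC; exact: in0S rst.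
    apply: IHb; move: rst; rewrite !in_itv/= => /andP[-> rt].
    exact: le_trans tS.
  - rewrite ler_wpM2r ?expR_ge0// ler_pdivrMr// exprSr invfM.
    rewrite (_ : _ * (2 ^- k / 2) * K = (expR (- K * s) / 2 ^+ k) * (K / 2)); last by ring.
    by rewrite mulrC ler_wpM2l ?mulr_ge0 ?expR_ge0 ?invr_ge0 ?(ltW ds)//; lra.
wlog tt' : t t' / t' <= t.
  move=> H tin t'in; case: (leP t' t) => [h|/ltW h]; first exact: H.
  by rewrite distrC [`|t - t'|]distrC; exact: H.
rewrite !in_itv/= => /andP[st tS] /andP[st' t'S].
rewrite [`|t - t'|]ger0_norm ?subr_ge0//=.
rewrite (@mxint_split _ _ _ s t' t)//; last exact: bIA.
rewrite addrC addKr; apply: mxint_norm => //.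
  by apply: bounded_measS (bIA _ tS).
move=> r; rewrite in_itv/= => /andP[t'r rt].
have rin : r \in `[s, S] by rewrite in_itv/= (le_trans st')// (le_trans rt).
apply: le_trans (mxnorm_mul _ _) _.
have -> : L / 2 ^+ k.+1 = n%:R * (E / 2 ^+ k) * C.
  by rewrite exprSr invfM; field; rewrite gt_eqF.
rewrite ler_pM ?mulr_ge0// ?ler_wpM2l//; last first.
  by apply: AC; apply: in0S rin.
apply: le_trans (IHb _ rin) _.
rewrite mulrAC -expRD ler_wpM2r ?invr_ge0 ?(ltW ds)// ler_expR.
rewrite mulNr addrC -mulrBr ler_wpM2l ?(ltW K0)//.
by move: rin; rewrite in_itv/= => /andP[_ rS]; rewrite lerBlDr ler_wpDr.
Qed.

Local Notation U := (mxexp_int A).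

Let US s t N : 0 <= s -> t \in `[s, S] ->
  `|U s t - series (fun k => iterated_mxint A k s t) N| <= 2 * E / 2 ^+ N.
Proof.
move=> s0 tin.
pose V : completeNormedModType R := HB.pack 'M[R]_n (NormedModule.on 'M[R]_n) (Complete.on 'M[R]_n).
apply: (@series_geometric_cvg _ V (fun k => iterated_mxint A k s t)); first exact: ltW.
move=> k; apply: le_trans (proj1 (iterated_mxint_bound k s0) _ tin) _.
rewrite mulrAC -expRD ler_wpM2r ?invr_ge0 ?exprn_ge0// ler_expR.
rewrite mulNr addrC -mulrBr ler_wpM2l ?(ltW K0)//.
by move: tin; rewrite in_itv/= => /andP[_ rS]; rewrite lerBlDr ler_wpDr.
Qed.

Lemma mxexp_int_bound s t : 0 <= s -> t \in `[s, S] -> `|U s t| <= 2 * E.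
Proof.
by move=> s0 tin; have := US 0 s0 tin; rewrite /series/= big_geq// subr0 expr0 divr1.
Qed.

Lemma mxexp_int_lipschitz s t t' : 0 <= s -> t \in `[s, S] -> t' \in `[s, S] ->
  `|U s t - U s t'| <= 2 * L * `|t - t'|.
Proof.
move=> s0 tin t'in; apply: (@le_geometric _ _ _ (4 * E)) => [|N].
  by rewrite mulr_ge0// ltW.
pose sr t := series (fun k => iterated_mxint A k s t) N.
have srL : `|sr t - sr t'| <= 2 * L * `|t - t'| - 2 * L * `|t - t'| / 2 ^+ N.
  rewrite /sr; elim: N {sr} => [|N IH].
    by rewrite /series/= !big_geq// expr0 divr1 !subrr normr0.
  rewrite !seriesSr opprD addrACA; apply: le_trans (ler_normD _ _) _.
  apply: le_trans (lerD IH (proj2 (iterated_mxint_bound N s0) _ _ tin t'in)) _.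
  by rewrite exprSr invfM le_eqVlt; apply/orP; left; apply/eqP; field; rewrite expf_neq0.
have -> : U s t - U s t' = (U s t - sr t) + (sr t - sr t') - (U s t' - sr t').
  by apply/matrixP => i j; rewrite !mxE; ring.
apply: le_trans (ler_normB _ _) _; apply: le_trans (lerD (ler_normD _ _) (lexx _)) _.
apply: le_trans (lerD (lerD (US N s0 tin) srL) (US N s0 t'in)) _.
have : 0 <= 2 * L * `|t - t'| / 2 ^+ N.
  by rewrite divr_ge0 ?exprn_ge0// mulr_ge0// mulr_ge0.
lra.
Qed.

Lemma bounded_meas_mxexp_int s a t : 0 <= s -> s <= a -> t <= S -> bounded_meas a t (U s).
Proof.
move=> s0 sa tS; apply: (@lipschitz_bounded_meas _ _ _ _ _ (2 * L)) => u v.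
rewrite !in_itv/= => /andP[au ut] /andP[av vt]; apply: mxexp_int_lipschitz => //.
  by rewrite in_itv/= (le_trans sa)// (le_trans ut).
by rewrite in_itv/= (le_trans sa)// (le_trans vt).
Qed.

(** The partial sums satisfy the equation up to a shift of the index. *)
Lemma mxexp_intE s t : 0 <= s -> t \in `[s, S] ->
  U s t = 1%:M + mxint s t (fun u => U s u *m A u).
Proof.
move=> s0 /[dup] tin; rewrite in_itv/= => /andP[st tS].
pose sr N t := series (fun k => iterated_mxint A k s t) N.
have bsr N : bounded_meas s t (sr N).
  elim: N => [|N IH].
    apply: eq_bounded_meas (bounded_meas_cst s t 0) => u _.
    by rewrite /sr /series/= big_geq.
  apply: eq_bounded_meas (bounded_measD IH _) => [u _|].
    by rewrite /sr seriesSr.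
  apply: (bounded_measS (lexx s) tS).
  exact: lipschitz_bounded_meas (proj2 (iterated_mxint_bound N s0)).
have bA' := bAS s0 tS.
have srE N : sr N.+1 t = 1%:M + mxint s t (fun u => sr N u *m A u).
  elim: N => [|N IH].
    rewrite /sr seriesSr {1}/series/= big_geq// add0r (eq_mxint (h := fun=> 0)) => [|u _].
      by rewrite mxint_cst// scaler0 addr0.
    by rewrite /series/= big_geq// mul0mx.
  rewrite {1}/sr seriesSr -/(sr N.+1 t) IH -addrA; congr (_ + _).
  rewrite /= -mxintD; [|exact: bounded_measM|apply: bounded_measM => //].
    by apply: eq_mxint => u _; rewrite /sr seriesSr mulmxDl.
  apply: (bounded_measS (lexx s) tS).
  exact: lipschitz_bounded_meas (proj2 (iterated_mxint_bound N s0)).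
apply/eqP; rewrite -subr_eq0 -normr_le0.
pose c := 2 * E + n%:R * (2 * E) * C * (t - s).
apply: (@le_geometric _ _ _ c) => [|N].
  by rewrite addr_ge0 ?mulr_ge0 ?subr_ge0// ltW.
rewrite add0r.
have -> : U s t - (1%:M + mxint s t (fun u => U s u *m A u)) = (U s t - sr N.+1 t) +
   (mxint s t (fun u => sr N u *m A u) - mxint s t (fun u => U s u *m A u)).
  by rewrite srE !opprD !addrA subrK.
rewrite -mxintB; [|exact: bounded_measM|apply: bounded_measM => //]; last first.
  exact: bounded_meas_mxexp_int.
apply: le_trans (ler_normD _ _) _; rewrite mulrDl lerD//.
  apply: le_trans (US N.+1 s0 tin) _; rewrite ler_wpM2l ?mulr_ge0 ?(ltW E0)//.
  by rewrite exprSr invfM ler_piMr ?invr_ge0 ?exprn_ge0//; lra.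
have -> : n%:R * (2 * E) * C * (t - s) / 2 ^+ N = n%:R * (2 * E / 2 ^+ N) * C * (t - s) by ring.
apply: mxint_norm => // [|u uin].
  apply: bounded_measB; apply: bounded_measM => //.
  exact: bounded_meas_mxexp_int.
rewrite -mulmxBl; apply: le_trans (mxnorm_mul _ _) _; rewrite ler_pM ?mulr_ge0//.
  rewrite ler_wpM2l// distrC; apply: US => //.
  by move: uin; rewrite !in_itv/= => /andP[-> ut]; exact: le_trans tS.
by apply: AC; exact: in0S uin.
Qed.

(** On [s', S] both [U s] and [U s'] solve the same linear equation, from initial
   values [U s s'] and [1], which differ by [O(s' - s)]. *)
Lemma mxexp_int_lipschitz_left s s' t : 0 <= s -> s <= s' -> t \in `[s', S] ->
  `|U s t - U s' t| <= 2 * (2 * L * (s' - s)) * E.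
Proof.
move=> s0 ss'; rewrite in_itv/= => /[dup] s'tS /andP[s't tS].
have s'0 := le_trans s0 ss'.
have ss'0 : 0 <= s' - s by rewrite subr_ge0.
have h := @mxint_gronwall _ n n (fun t => `|U s t - U s' t|) s' S (2 * L * (s' - s)) (4 * E) (n%:R * C).
apply: le_trans (h _ _ _ _ _ _ t s'tS) _ => //.
- by rewrite mulr_ge0// mulr_ge0.
- by rewrite mulr_ge0// ltW.
- move=> r /andP[s'r rS]; rewrite normr_ge0/=; apply: le_trans (ler_normB _ _) _.
  have b1 : `|U s r| <= 2 * E.
    by apply: mxexp_int_bound => //; rewrite in_itv/= rS (le_trans ss').
  have b2 : `|U s' r| <= 2 * E by apply: mxexp_int_bound => //; rewrite in_itv/= rS s'r.
  lra.
- move=> r /andP[s'r rS].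
  have b1 : bounded_meas s' r (U s) by exact: bounded_meas_mxexp_int.
  have b2 : bounded_meas s' r (U s') by exact: bounded_meas_mxexp_int.
  have bAr : bounded_meas s' r A by exact: bAS.
  exists (fun u => (U s u - U s' u) *m A u); split.
  + by apply: bounded_measM => //; exact: bounded_measB.
  + move=> u uin; apply: le_trans (mxnorm_mul _ _) _.
    rewrite mulrAC ler_wpM2r// ler_wpM2l//; apply: AC; exact: in0S uin.
  + have s'in : s' \in `[s, S] by rewrite in_itv/= ss' (le_trans s'r).
    rewrite (@mxexp_intE s r) ?(@mxexp_intE s' r)//; last 2 first.
    * by rewrite in_itv/= s'r rS.
    * by rewrite in_itv/= (le_trans ss')//.
    rewrite (@mxint_split _ _ _ s s' r)//; last first.
      by apply: bounded_measM; [exact: bounded_meas_mxexp_int|exact: bAS].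
    rewrite addrA -(mxexp_intE s0 s'in) opprD addrACA.
    apply: le_trans (ler_normD _ _) _; apply: lerD.
      have sin : s \in `[s, S] by rewrite in_itv/= lexx (le_trans ss')// (le_trans s'r).
      have Uss : U s s = 1%:M by rewrite mxexp_intE// mxint_xx addr0.
      rewrite -[s' - s]ger0_norm// -Uss.
      exact: mxexp_int_lipschitz s0 s'in sin.
    rewrite -mxintB; [|exact: bounded_measM..].
    by rewrite le_eqVlt; apply/orP; left; apply/eqP; congr `|_|; apply: eq_mxint => u _; rewrite mulmxBl.
- rewrite ler_wpM2l ?mulr_ge0// ler_expR mulrDl [X in _ <= X]mulrDl.
  by rewrite lerD// ?mul1r// ler_wpM2l// mulr_ge0// mulr_ge0.
Qed.

End ordered_exponential.

(** * The linearised equation *)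

Section linear_equation.
Context {R : realType} (n : nat) (A : R -> 'M[R]_n) (S C : R).
Hypothesis bA : bounded_meas 0 S A.
Hypothesis AC : forall r, r \in `[0, S] -> `|A r| <= C.
Hypothesis C0 : 0 <= C.

(** The solution of [y_t = V_t + int_0^t y_s A_s ds] by variation of constants. *)
Definition linear_response (V : R -> 'rV[R]_n) (t : R) : 'rV[R]_n :=
  V t + mxint 0 t (fun s => V s *m A s *m mxexp_int A s t).

Let bV_A_U (V : R -> 'rV[R]_n) t : bounded_meas 0 S V -> 0 <= t <= S ->
  bounded_meas 0 t (fun s => V s *m A s *m mxexp_int A s t).
Proof.
move=> bV /andP[t0 tS]; apply: bounded_measM.
  by apply: bounded_measS (lexx 0) tS _; exact: bounded_measM.
apply: (@lipschitz_bounded_meas _ _ _ _ _ (2 * (2 * (2 * n%:R * C * expR ((2 * (n%:R * C) + 1) * S))) * expR ((2 * (n%:R * C) + 1) * S))) => s s'.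
wlog ss' : s s' / s <= s'.
  move=> H sin s'in; case: (leP s s') => [h|/ltW h]; first exact: H.
  by rewrite distrC [`|s - s'|]distrC; exact: H.
rewrite !in_itv/= => /andP[s0 st] /andP[s'0 s't].
apply: le_trans (mxexp_int_lipschitz_left bA AC C0 s0 ss' _) _.
  by rewrite in_itv/= s't tS.
rewrite [`|s - s'|]distrC [`|s' - s|]ger0_norm ?subr_ge0//.
by rewrite le_eqVlt; apply/orP; left; apply/eqP; ring.
Qed.

Lemma linear_response_lipschitz (V : R -> 'rV[R]_n) : bounded_meas 0 S V ->
  exists L, forall s t, s \in `[0, S] -> t \in `[0, S] ->
    `|(linear_response V s - V s) - (linear_response V t - V t)| <= L * `|s - t|.
Proof.
move=> bV; have [BV VB] := bV.2.
pose E := expR ((2 * (n%:R * C) + 1) * S); have E0 : 0 <= E by exact: expR_ge0.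
pose L0 := 2 * (2 * n%:R * C * E).
pose B := n%:R * (n%:R * BV * C).
exists (B * (2 * E) + B * L0 * S).
suff H s t : 0 <= s -> s <= t -> t <= S ->
    `|(linear_response V t - V t) - (linear_response V s - V s)|
    <= (B * (2 * E) + B * L0 * S) * (t - s).
  move=> s t; rewrite !in_itv/= => /andP[s0 sS] /andP[t0 tS].
  case: (leP s t) => st; last first.
    by rewrite [`|s - t|]ger0_norm ?subr_ge0 ?H// ltW.
  by rewrite distrC [`|s - t|]distrC [`|t - s|]ger0_norm ?subr_ge0 ?H.
move=> s0 st tS; have t0 := le_trans s0 st; have sS := le_trans st tS.
have BV0 : 0 <= BV by apply: le_trans (VB s _); rewrite ?in_itv/= ?s0.
have VAB r : r \in `[0, S] -> `|V r *m A r| <= n%:R * BV * C.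
  by move=> rin; apply: le_trans (mxnorm_mul _ _) _; rewrite ler_pM ?mulr_ge0 ?ler_wpM2l ?VB// AC.
rewrite /linear_response ![V _ + _]addrC !addrK.
have bt : bounded_meas 0 t (fun r => V r *m A r *m mxexp_int A r t).
  by apply: bV_A_U => //; rewrite t0 tS.
have bs : bounded_meas 0 s (fun r => V r *m A r *m mxexp_int A r s).
  by apply: bV_A_U => //; rewrite s0 sS.
have bt' : bounded_meas 0 s (fun r => V r *m A r *m mxexp_int A r t).
  exact: bounded_measS bt.
rewrite (@mxint_split _ _ _ 0 s t)// addrAC -mxintB// addrC.
apply: le_trans (ler_normD _ _) _; rewrite mulrDl lerD//.
  apply: mxint_norm => //; first exact: bounded_measS bt.
  move=> r; rewrite in_itv/= => /andP[sr rt].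
  apply: le_trans (mxnorm_mul _ _) _; rewrite ler_pM ?mulr_ge0//.
    by rewrite ler_wpM2l// VAB// in_itv/= (le_trans s0)// (le_trans rt).
  apply: (mxexp_int_bound bA AC C0) => //; first exact: le_trans sr.
  by rewrite in_itv/= rt.
apply: le_trans (@mxint_norm _ _ _ _ _ _ (B * (L0 * (t - s))) s0 _ _) _.
- exact: bounded_measB.
- move=> r; rewrite in_itv/= => /andP[r0 rs].
  rewrite -mulmxBr; apply: le_trans (mxnorm_mul _ _) _; rewrite ler_pM ?mulr_ge0//.
    by rewrite ler_wpM2l// VAB// in_itv/= r0 (le_trans rs).
  rewrite -[t - s]ger0_norm ?subr_ge0//.
  apply: (mxexp_int_lipschitz bA AC C0) => //; rewrite in_itv/= ?rs//.
  by rewrite (le_trans rs st).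
- rewrite subr0 (_ : B * L0 * S * (t - s) = B * (L0 * (t - s)) * S); last by ring.
  by rewrite ler_wpM2l// !mulr_ge0 ?subr_ge0.
Qed.

Lemma bounded_meas_linear_response (V : R -> 'rV[R]_n) :
  bounded_meas 0 S V -> bounded_meas 0 S (linear_response V).
Proof.
move=> bV; have [L /lipschitz_bounded_meas bL] := linear_response_lipschitz bV.
by apply: eq_bounded_meas (bounded_measD bL bV) => s _; rewrite subrK.
Qed.

(** By [mxexp_intE] the kernel [k s t = V s *m A s *m mxexp_int A s t] satisfies
   [k s t = k s s + int_s^t k s u A u du]; integrate over [s] and exchange. *)
Lemma linear_responseE (V : R -> 'rV[R]_n) : bounded_meas 0 S V ->
  forall t, 0 <= t <= S ->
  linear_response V t = V t + mxint 0 t (fun s => linear_response V s *m A s).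
Proof.
move=> bV; have [BV VB] := bV.2.
move=> t0 t0S; rewrite /linear_response; congr (_ + _).
have BV0 : 0 <= BV by apply: le_trans (VB t0 _).
pose E := expR ((2 * (n%:R * C) + 1) * S).
pose k s t := V s *m A s *m mxexp_int A s t.
rewrite (@volterra _ _ _ k (fun s => V s *m A s) A S (n%:R * (n%:R * BV * C) * (2 * E)) C)//.
- by apply: eq_mxint => u _; rewrite mulmxDl.
- exact: bounded_measM.
- by move=> t tS; exact: bV_A_U.
- move=> r t r0 rt tS; apply: bounded_measM; first exact: bounded_meas_cst.
  exact: (bounded_meas_mxexp_int bA AC C0).
- move=> r t r0 rt tS; have rin : r \in `[0, S] by rewrite in_itv/= r0 (le_trans rt).
  apply: le_trans (mxnorm_mul _ _) _; rewrite ler_pM ?mulr_ge0//.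
    rewrite ler_wpM2l//; apply: le_trans (mxnorm_mul _ _) _.
    by rewrite ler_pM ?mulr_ge0 ?ler_wpM2l// ?VB// AC.
  by apply: (mxexp_int_bound bA AC C0 r0); rewrite in_itv/= rt.
- move=> r t r0 rt tS; rewrite /k {1}(mxexp_intE bA AC C0 r0) ?in_itv/= ?rt//.
  rewrite mulmxDr mulmx1 mulmx_mxint; last first.
    apply: bounded_measM; first exact: (bounded_meas_mxexp_int bA AC C0).
    by apply: bounded_measS bA.
  by congr (_ + _); apply: eq_mxint => u _; rewrite !mulmxA.
Qed.

Lemma linear_response_bounded (V : R -> 'rV[R]_n) (eta : R) : bounded_meas 0 S V ->
  0 <= eta -> (forall s, s \in `[0, S] -> `|V s| <= eta) ->
  forall t, 0 <= t <= S -> `|linear_response V t| <=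
    (1 + n%:R * (n%:R * C) * (2 * expR ((2 * (n%:R * C) + 1) * S)) * S) * eta.
Proof.
move=> bV eta0 Veta t /[dup] t0S /andP[t0 tS]; rewrite mulrDl mul1r.
apply: le_trans (ler_normD _ _) _; apply: lerD; first by apply: Veta; rewrite in_itv/=.
pose E := expR ((2 * (n%:R * C) + 1) * S); have E0 : 0 <= E by exact: expR_ge0.
apply: le_trans (@mxint_norm _ _ _ _ _ _ (n%:R * (n%:R * eta * C) * (2 * E)) t0 (bV_A_U bV t0S) _) _.
- move=> r; rewrite in_itv/= => /andP[r0 rt].
  have rin : r \in `[0, S] by rewrite in_itv/= r0 (le_trans rt).
  apply: le_trans (mxnorm_mul _ _) _; rewrite ler_pM ?mulr_ge0//.
    rewrite ler_wpM2l//; apply: le_trans (mxnorm_mul _ _) _.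
    by rewrite ler_pM ?mulr_ge0 ?ler_wpM2l// ?Veta// AC.
  by apply: (mxexp_int_bound bA AC C0 r0); rewrite in_itv/= rt.
- rewrite subr0 -/E.
  rewrite (_ : _ * S * eta = n%:R * (n%:R * eta * C) * (2 * E) * S); last by ring.
  by rewrite ler_wpM2l// ?mulr_ge0.
Qed.

Lemma linear_responseB (V V' : R -> 'rV[R]_n) t : bounded_meas 0 S V ->
  bounded_meas 0 S V' -> 0 <= t <= S ->
  linear_response V t - linear_response V' t = linear_response (fun s => V s - V' s) t.
Proof.
move=> bV bV' tS; rewrite /linear_response opprD addrACA; congr (_ + _).
rewrite -mxintB; [|exact: bV_A_U..].
by apply: eq_mxint => u _; rewrite !mulmxBl.
Qed.

(** Gronwall for the difference, the response being an exact solution. The bound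
   [B] only starts the iteration of [weighted_gronwall]. *)
Lemma linear_response_stable (V y : R -> 'rV[R]_n) (B r : R) :
  bounded_meas 0 S V -> bounded_meas 0 S y -> 0 <= r -> 0 <= B ->
  (forall t, 0 <= t <= S -> `|y t - linear_response V t| <= B) ->
  (forall t, 0 <= t <= S -> `|y t - (V t + mxint 0 t (fun s => y s *m A s))| <= r) ->
  forall t, 0 <= t <= S ->
    `|y t - linear_response V t| <= 2 * r * expR ((2 * (n%:R * C) + 1) * t).
Proof.
move=> bV by_ r0 B0 yB yr.
have bL := bounded_meas_linear_response bV.
apply: (@mxint_gronwall _ 1 n _ 0 S r B (n%:R * C)) => //; first by rewrite mulr_ge0.
  by move=> t tS; rewrite normr_ge0/= yB.
move=> t /[dup] t0S /andP[t0 tS].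
have bt (g : R -> 'rV[R]_n) : bounded_meas 0 S g -> bounded_meas 0 t (fun s => g s *m A s).
  by move=> bg; apply: (bounded_measS (lexx 0) tS); exact: bounded_measM.
exists (fun s => (y s - linear_response V s) *m A s); split.
- by apply: bt; exact: bounded_measB.
- move=> s; rewrite in_itv/= => /andP[s0 st]; apply: le_trans (mxnorm_mul _ _) _.
  by rewrite mulrAC ler_wpM2r// ler_wpM2l// AC// in_itv/= s0 (le_trans st).
- rewrite [linear_response V t](linear_responseE bV t0S).
  have -> : mxint 0 t (fun s => (y s - linear_response V s) *m A s) =
      mxint 0 t (fun s => y s *m A s) - mxint 0 t (fun s => linear_response V s *m A s).
    rewrite -mxintB; [|exact: bt..].
    by apply: eq_mxint => u _; rewrite mulmxBl.
  move: (yr t t0S); set I1 := mxint 0 t _; set I2 := mxint 0 t _ => h.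
  have -> : y t - (V t + I2) = (y t - (V t + I1)) + (I1 - I2).
    by apply/matrixP => i j; rewrite !mxE; ring.
  by apply: le_trans (ler_normD _ _) _; rewrite lerD2r.
Qed.

End linear_equation.

(** * Measurability tools *)

Section measurability_tools.
Context d d' (T : measurableType d) (T' : measurableType d').

Lemma measurable_fun_cases (D : set T) (idx : T -> nat) (g : nat -> T -> T') :
  measurable D -> (forall k, measurable (D `&` [set x | idx x = k])) ->
  (forall k, measurable_fun (D `&` [set x | idx x = k]) (g k)) ->
  measurable_fun D (fun x => g (idx x) x).
Proof.
move=> mD midx mg.
have -> : D = \bigcup_k (D `&` [set x | idx x = k]).
  by apply/seteqP; split => [x Dx|x [k _ []//]]; exists (idx x).
apply/(measurable_fun_bigcup _ midx) => k.
apply: eq_measurable_fun (mg k) => x; rewrite inE => -[_ /= ->//].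
Qed.

Lemma measurable_fun_patch (D : set T) (f : T -> T') (y : T') : measurable D ->
  measurable_fun D f -> measurable_fun setT (fun x => if x \in D then f x else y).
Proof.
move=> mD mf.
have DT : [set: T] = D `|` ~` D by rewrite setUv.
rewrite DT; apply/measurable_funU => //; first exact: measurableC.
split; first by apply: eq_measurable_fun mf => x ->.
apply: (eq_measurable_fun (cst y)); last exact: measurable_cst.
by move=> x; rewrite inE /= => nD; rewrite ifF//; apply/negbTE; rewrite notin_setE.
Qed.

End measurability_tools.

Lemma measurable_fun_pairD d d1 d2 (T : measurableType d) (T1 : measurableType d1)
    (T2 : measurableType d2) (D : set T) (f : T -> T1) (g : T -> T2) :
  measurable D -> measurable_fun D f -> measurable_fun D g ->
  measurable_fun D (fun x => (f x, g x)).
Proof.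
move=> mD mf mg.
have := measurable_fun_pair (measurable_fun_patch point mD mf)
  (measurable_fun_patch point mD mg).
by move/(@measurable_funTS _ _ _ _ D); apply: eq_measurable_fun => x ->.
Qed.

Lemma measurable_fun_lt_set d (T : measurableType d) (R : realType) (D : set T)
    (f g : T -> R) : measurable D -> measurable_fun D f -> measurable_fun D g ->
  measurable (D `&` [set x | f x < g x]).
Proof.
move=> mD mf mg; have := measurable_fun_ltr mf mg mD => /(_ [set true] I).
by congr (measurable (_ `&` _)); apply/seteqP.
Qed.

Lemma measurable_fun_le_set d (T : measurableType d) (R : realType) (D : set T)
    (f g : T -> R) : measurable D -> measurable_fun D f -> measurable_fun D g ->
  measurable (D `&` [set x | f x <= g x]).
Proof.
move=> mD mf mg; have := measurable_fun_ler mf mg mD => /(_ [set true] I).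
by congr (measurable (_ `&` _)); apply/seteqP.
Qed.

Section borel_matrices.
Context {R : realType} (m n : nat).
Context d (T : measurableType d).

Let box (c : 'M[rat]_(m, n)) (k : nat) : set 'M[R]_(m, n) :=
  [set B | forall i j, `|B i j - ratr (c i j)| < k.+1%:R^-1].

Let box_open (U : set 'M[R]_(m, n)) (B : 'M[R]_(m, n)) : open U -> U B ->
  exists c k, box c k B /\ box c k `<=` U.
Proof.
move=> oU UB; have : nbhs B U by exact: open_nbhs_nbhs.
move=> /nbhs_ballP[e /= e0 eU].
have [k ke] : exists k, k.+1%:R^-1 < e / 2.
  exists (Num.truncn (e / 2)^-1).
  by rewrite invf_plt ?posrE ?divr_gt0// truncnS_gt.
have k0 : 0 < k.+1%:R^-1 :> R by rewrite invr_gt0.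
have ex (x : R) : exists q : rat, `|x - ratr q| < k.+1%:R^-1.
  have [|q] := @rat_in_itvoo _ (x - k.+1%:R^-1) (x + k.+1%:R^-1).
    by rewrite ltrBlDr -addrA ltrDl addr_gt0.
  rewrite in_itv/= => /andP[q1 q2]; exists q.
  by rewrite ltr_norml; apply/andP; split; move: q1 q2; move: (ratr q) (_^-1) => u v; lra.
have [c cB] : {c : 'M[rat]_(m, n) | forall i j, `|B i j - ratr (c i j)| < k.+1%:R^-1}.
  exists (\matrix_(i, j) sval (cid (ex (B i j)))) => i j; rewrite mxE.
  by case: cid.
exists c, k; split => // B' B'c; apply: eU; split => // i j.
rewrite /ball/= -(subrKA (ratr (c i j))) (le_lt_trans (ler_normD _ _))//.
rewrite [X in _ + X]distrC (lt_trans (ltrD (cB i j) (B'c i j)))//.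
by rewrite (lt_le_trans (ltrD ke ke))// -splitr.
Qed.

(** Boxes with rational centres and radii [1 / k.+1] form a countable base of the
   topology, so that entrywise measurability is enough. *)
Lemma borel_mx_measurable (D : set T) (h : T -> 'M[R]_(m, n)) : measurable D ->
  (forall i j, measurable_fun D (fun w => h w i j)) ->
  measurable_fun D (h : T -> borel 'M[R]_(m, n)).
Proof.
move=> mD mh; apply: (@measurability _ _ _ (borel 'M[R]_(m, n)) _ _ (@open 'M[R]_(m, n))) => //.
move=> _ [U oU <-].
pose F (x : 'M[rat]_(m, n) * nat) : set T :=
  if pselect (box x.1 x.2 `<=` U) then D `&` h @^-1` box x.1 x.2 else set0.
have -> : D `&` h @^-1` U = \bigcup_x F x.
  apply/seteqP; split => [w [Dw /= Uw]|w [x _]]; rewrite /F; last first.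
    by case: pselect => // xU [Dw /xU].
  have [c [k [b1 b2]]] := box_open oU Uw.
  by exists (c, k) => //; rewrite /F; case: pselect.
apply: countable_bigcupT_measurable => [|[c k]]; first exact: countableP.
rewrite /F; case: pselect => //= _.
have -> : D `&` h @^-1` box c k = D `&` \bigcap_(ij in [set: 'I_m * 'I_n])
    (D `&` [set w | `|h w ij.1 ij.2 - ratr (c ij.1 ij.2)| < k.+1%:R^-1]).
  apply/seteqP; split => [w [Dw /= bw]|w [Dw bw]]; split => //.
    by move=> [i j] _; split => //=; exact: bw.
  by move=> i j; have [] := bw (i, j) I.
apply: measurableI => //; apply: fin_bigcap_measurable => // -[i j] _ /=.
apply: measurable_fun_lt_set => //; apply: measurableT_comp => //.
exact: measurable_funB.
Qed.

Lemma borel_mx_entry (D : set T) (h : T -> 'M[R]_(m, n)) i j :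
  measurable_fun D (h : T -> borel 'M[R]_(m, n)) -> measurable_fun D (fun w => h w i j).
Proof.
move=> mh; apply: (@measurable_comp _ _ _ _ (borel 'M[R]_(m, n)) _ setT
  (fun B : borel 'M[R]_(m, n) => (B : 'M[R]_(m, n)) i j)) mh => //.
apply: (measurability _ (RGenOpens.measurableE R)).
move=> _ [_ [a [b ->] <-]]; rewrite setTI.
apply: sub_sigma_algebra.
apply: (@open_comp _ _ (fun B : 'M[R]_(m, n) => B i j)) => [B _|]; first exact: coord_continuous.
exact: interval_open.
Qed.

Lemma borel_continuous (D : set T) (h : T -> 'M[R]_(m, n)) p q (g : 'M[R]_(m, n) -> 'M[R]_(p, q)) :
  continuous g -> measurable_fun D (h : T -> borel 'M[R]_(m, n)) ->
  measurable_fun D (g \o h : T -> borel 'M[R]_(p, q)).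
Proof.
move=> cg; apply: (@measurable_comp _ _ _ _ (borel 'M[R]_(m, n)) (borel 'M[R]_(p, q)) setT g) => //.
apply: (@measurability _ _ (borel 'M[R]_(m, n)) (borel 'M[R]_(p, q)) _ _ (@open 'M[R]_(p, q))) => //.
move=> _ [U oU <-]; rewrite setTI; apply: sub_sigma_algebra.
by apply: open_comp => // B _; exact: cg.
Qed.

End borel_matrices.

Section parametric_integral.
Context {R : realType} d (T : measurableType d).
Local Notation mu := (@lebesgue_measure R).

Lemma measurable_fun_Rintegral (D : set T) (a b C : R) (g : T -> R -> R) :
  measurable D -> a <= b ->
  (forall w s, D w -> s \in `[a, b] -> `|g w s| <= C) ->
  measurable_fun (D `*` `[a, b]) (fun p : T * measurableTypeR R => g p.1 p.2) ->
  measurable_fun D (fun w => \int[mu]_(s in `[a, b]) g w s).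
Proof.
move=> mD ab gC mg.
set E : set (T * measurableTypeR R) := D `*` `[a, b].
have mE : measurable E by apply: measurableX => //; exact: measurable_itv.
pose G (p : T * measurableTypeR R) : R := if p \in E then g p.1 p.2 + C else 0.
have mG : measurable_fun setT G.
  apply: (measurable_fun_patch (0 : R) mE); exact: measurable_funD.
have G0 p : (0 <= (G p)%:E)%E.
  rewrite /G lee_fin; case: ifPn => //; rewrite inE => -[/= Dp pab].
  by have := gC _ _ Dp pab; rewrite ler_norml => /andP[+ _]; lra.
have mGE : measurable_fun setT (EFin \o G) by exact/measurable_EFinP.
have := @measurable_fun_fubini_tonelli_F _ _ _ _ R mu (EFin \o G) mGE G0.
move/(@measurable_funTS _ _ _ _ D) => mF.
have mF' : measurable_fun D (fun w => fine (fubini_F mu (EFin \o G) w)).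
  exact: measurableT_comp.
have h := measurable_funB mF' (@measurable_cst _ _ _ _ D (C * (b - a))).
apply: eq_measurable_fun h => w; rewrite inE => Dw.
rewrite /fubini_F/=.
have mgw : measurable_fun `[a, b] (g w).
  have := measurable_comp mE _ mg (@measurable_funTS _ _ _ _ `[a, b] _ (pair1_measurable w)).
  by apply => // _ [s sab <-]; split.
have ig : mu.-integrable `[a, b] (EFin \o g w).
  apply: measurable_bounded_integrable => //.
    by rewrite /= lebesgue_measure_itv/=; case: ifPn => // _; rewrite -EFinB ltry.
  exists C; split; first exact: num_real.
  by move=> x Cx s /= sab; apply: le_trans (ltW Cx); exact: gC.
have iC : mu.-integrable `[a, b] (EFin \o cst C).
  apply: measurable_bounded_integrable => //; last exact: bounded_cst.
  by rewrite /= lebesgue_measure_itv/=; case: ifPn => // _; rewrite -EFinB ltry.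
have -> : (\int[mu]_y (G (w, y))%:E = \int[mu]_(y in `[a, b]) (g w y + C)%:E)%E.
  rewrite [RHS]integral_mkcond; apply: eq_integral => y _.
  rewrite /G patchE /E in_setX/= mem_set//.
  by rewrite andTb; case: ifPn.
rewrite -/(Rintegral mu `[a, b] (fun y => g w y + C)) RintegralD//.
by rewrite Rintegral_cst//= (_ : fine _ = b - a) ?addrK//; exact: fine_lebesgue_segment.
Qed.

End parametric_integral.

(** * The suspension flow *)

Section suspension.
Context dM (M : measurableType dM) (R : realType).
Context (T : M -> M) (tau : M -> R) (tau1 tau2 : R).
Hypotheses (tau1_gt0 : 0 < tau1) (tauB : forall y, tau1 <= tau y <= tau2).

Local Notation S_ n y := (birkhoff_sum T tau n y).
Local Notation lap := (lap T tau).
Local Notation flow := (susp_flow T tau).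

Let tau_gt0 y : 0 < tau y.
Proof. by have /andP[h _] := tauB y; exact: lt_le_trans h. Qed.

Lemma birkhoff_sum0 y : S_ 0 y = 0.
Proof. by rewrite /birkhoff_sum big_geq. Qed.

Lemma birkhoff_sumSr n y : S_ n.+1 y = S_ n y + tau (iter n T y).
Proof. by rewrite /birkhoff_sum big_nat_recr. Qed.

Lemma birkhoff_sumS n y : S_ n.+1 y = tau y + S_ n (T y).
Proof.
rewrite /birkhoff_sum big_nat_recl//; congr (_ + _).
by apply: eq_bigr => i _; rewrite iterSr.
Qed.

Lemma birkhoff_sum_le m n y : (m <= n)%N -> S_ m y <= S_ n y.
Proof.
move/subnK <-; elim: (n - m)%N => // k IH.
by rewrite addSn birkhoff_sumSr (le_trans IH)// lerDl ltW.
Qed.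

Lemma birkhoff_sum_ge n y : n%:R * tau1 <= S_ n y.
Proof.
elim: n => [|n IH]; first by rewrite mul0r birkhoff_sum0.
rewrite birkhoff_sumSr -natr1 mulrDl mul1r lerD//.
by have /andP[] := tauB (iter n T y).
Qed.

Lemma lap_eq n t y : S_ n y <= t -> t < S_ n.+1 y -> lap t y = n.
Proof.
move=> nt tn; rewrite /Defs.lap /supremum.
set A := [set _ | _].
have A0 : A != set0 by apply/set0P; exists n.
rewrite (negbTE A0); case: xgetP => [k -> [kub klb]|/(_ n)[]].
  apply/eqP; rewrite eqn_leq; apply/andP; split; last by exact: kub.
  rewrite -leEnat; apply: klb => m /= mt; rewrite leEnat leqNgt; apply/negP => nm.
  by have := lt_le_trans tn (le_trans (birkhoff_sum_le y nm) mt); rewrite ltxx.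
split=> [m /= mt|m]; last by apply.
rewrite leEnat leqNgt; apply/negP => nm.
by have := lt_le_trans tn (le_trans (birkhoff_sum_le y nm) mt); rewrite ltxx.
Qed.

Lemma lapP t y : 0 <= t -> S_ (lap t y) y <= t < S_ (lap t y).+1 y.
Proof.
move=> t0; have ex : exists n, t < S_ n.+1 y.
  exists (Num.truncn (t / tau1)); apply: lt_le_trans (birkhoff_sum_ge _ y).
  by rewrite -ltr_pdivrMr// truncnS_gt.
case: (ex_minnP ex) => n tn nmin.
have nt : S_ n y <= t.
  case: n tn nmin => [|n] tn nmin; first by rewrite birkhoff_sum0.
  by rewrite leNgt; apply/negP => /nmin; rewrite ltnn.
by rewrite (lap_eq nt tn) nt.
Qed.

Lemma lap_bound t y : 0 <= t -> (lap t y)%:R * tau1 <= t.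
Proof.
by move=> /(lapP y)/andP[h _]; apply: le_trans h; exact: birkhoff_sum_ge.
Qed.

Lemma lap_shift t y : 0 <= t -> lap (t + tau y) y = (lap t (T y)).+1.
Proof.
move=> /(lapP (T y))/andP[h1 h2].
by apply: lap_eq; rewrite birkhoff_sumS [tau y + _]addrC ?lerD2r ?ltrD2r.
Qed.

Lemma susp_zero y : susp tau (y, 0).
Proof. by rewrite /susp/= lexx tau_gt0. Qed.

Lemma susp_flow_susp t p : 0 <= t -> susp tau p -> susp tau (flow t p).
Proof.
move=> t0; rewrite /susp /= => /andP[p0 _].
have := @lapP (t + p.2) p.1; rewrite addr_ge0// => /(_ isT)/andP[h1 h2].
by rewrite subr_ge0 h1/= ltrBlDl -birkhoff_sumSr.
Qed.

Lemma susp_flow_fibre t p : flow t p = flow (t + p.2) (p.1, 0).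
Proof. by rewrite /susp_flow/= !addr0. Qed.

Lemma susp_flow_base t y : 0 <= t -> flow t (T y, 0) = flow (t + tau y) (y, 0).
Proof.
move=> t0; rewrite /susp_flow/= !addr0 lap_shift// -iterSr.
by rewrite birkhoff_sumS opprD addrA addrK.
Qed.

Section measurability.
Hypotheses (mT : measurable_fun setT T) (mtau : measurable_fun setT tau).

Lemma measurable_iter n : measurable_fun setT (iter n T).
Proof.
elim: n => [|n IH]; first exact: measurable_id.
exact: (measurableT_comp mT IH).
Qed.

Lemma measurable_birkhoff_sum n : measurable_fun setT (birkhoff_sum T tau n).
Proof.
elim: n => [|n IH].
  apply: (eq_measurable_fun (cst (0 : R))) => [y _|]; last exact: measurable_cst.
  by rewrite birkhoff_sum0.
apply: (eq_measurable_fun (fun y => birkhoff_sum T tau n y + tau (iter n T y))) => [y _|].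
  by rewrite birkhoff_sumSr.
by apply: measurable_funD => //; exact: measurableT_comp (measurable_iter n).
Qed.

Lemma measurable_lap_eq d (Z : measurableType d) (D : set Z) (g : Z -> R) (h : Z -> M) n :
  measurable D -> (forall z, D z -> 0 <= g z) ->
  measurable_fun D g -> measurable_fun D h ->
  measurable (D `&` [set z | lap (g z) (h z) = n]).
Proof.
move=> mD g0 mg mh.
have -> : D `&` [set z | lap (g z) (h z) = n] =
    (D `&` [set z | birkhoff_sum T tau n (h z) <= g z]) `&`
    (D `&` [set z | g z < birkhoff_sum T tau n.+1 (h z)]).
  apply/seteqP; split => z /=.
    by move=> [Dz <-]; have /andP[] := lapP (h z) (g0 z Dz).
  by move=> [[Dz h1] [_ h2]]; split => //; exact: lap_eq.
apply: measurableI.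
  apply: measurable_fun_le_set => //; exact: measurableT_comp (measurable_birkhoff_sum n) mh.
apply: measurable_fun_lt_set => //; exact: measurableT_comp (measurable_birkhoff_sum n.+1) mh.
Qed.

Lemma measurable_susp_flow d (Z : measurableType d) (D : set Z) (g : Z -> R)
    (h : Z -> M * measurableTypeR R) :
  measurable D -> (forall z, D z -> 0 <= g z) -> (forall z, D z -> susp tau (h z)) ->
  measurable_fun D g -> measurable_fun D h ->
  measurable_fun D (fun z => flow (g z) (h z)).
Proof.
move=> mD g0 hs mg mh.
have mh1 : measurable_fun D (fun z => (h z).1) by exact: measurableT_comp measurable_fst mh.
have mh2 : measurable_fun D (fun z => (h z).2 : R) by exact: measurableT_comp measurable_snd mh.
have mgh : measurable_fun D (fun z => g z + (h z).2) by exact: measurable_funD.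
pose G n (z : Z) : M * measurableTypeR R :=
  (iter n T (h z).1, g z + (h z).2 - birkhoff_sum T tau n (h z).1).
have mE n : measurable (D `&` [set z | lap (g z + (h z).2) (h z).1 = n]).
  apply: measurable_lap_eq => // z Dz; rewrite addr_ge0 ?g0//.
  by have /andP[] := hs z Dz.
apply: (@measurable_fun_cases _ _ Z _ D (fun z => lap (g z + (h z).2) (h z).1) G) => // n.
apply: measurable_fun_pairD => //.
  apply: (measurableT_comp (measurable_iter n)).
  exact: measurable_funS mh1.
apply: measurable_funB; first exact: measurable_funS mgh.
apply: (measurableT_comp (measurable_birkhoff_sum n)).
exact: measurable_funS mh1.
Qed.

End measurability.
End suspension.

(** * Driven paths *)

Section step_index.
Context {R : realType} (e : R) (e0 : 0 < e).

Local Notation idx r := (Num.truncn (r / e)).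

Lemma idxP r : 0 <= r -> e * (idx r)%:R <= r < e * (idx r).+1%:R.
Proof.
move=> r0; have re : 0 <= r / e by rewrite divr_ge0// ltW.
have /andP[h1 h2] := truncn_itv re.
by rewrite mulrC -ler_pdivlMr// h1/= mulrC -ltr_pdivrMr.
Qed.

Lemma idx_eq r k : e * k%:R <= r -> r < e * k.+1%:R -> idx r = k.
Proof.
move=> h1 h2; apply: truncn_def.
by rewrite ler_pdivlMr// ltr_pdivrMr// ![_ * e]mulrC h1.
Qed.

Lemma bounded_meas_cases m n (a b C : R) (G : nat -> R -> 'M[R]_(m, n)) : 0 <= a ->
  (forall k, bounded_meas a b (G k)) ->
  (forall k r, r \in `[a, b] -> `|G k r| <= C) ->
  bounded_meas a b (fun r => G (idx r) r).
Proof.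
move=> a0 bG GC; split; last by exists C => r rab; exact: GC.
move=> i j.
have mid : measurable_fun `[a, b] (fun r : R => r) by exact: measurable_id.
have mI k : measurable (`[a, b]%classic `&` [set r | idx r = k]).
  have -> : `[a, b]%classic `&` [set r | idx r = k] =
      (`[a, b]%classic `&` [set r | e * k%:R <= r]) `&`
      (`[a, b]%classic `&` [set r | r < e * k.+1%:R]).
    apply/seteqP; split => r /=.
      move=> [/[dup] rab + <-]; rewrite in_itv/= => /andP[ar _].
      by have /andP[] := idxP (le_trans a0 ar).
    by move=> [[rab h1] [_ h2]]; split => //; exact: idx_eq.
  by apply: measurableI; [apply: measurable_fun_le_set|apply: measurable_fun_lt_set].
apply: (@measurable_fun_cases _ _ R R `[a, b]%classic (fun r => idx r) (fun k r => G k r i j)) => //.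
move=> k; have [mG _] := bG k; apply: measurable_funS (mG i j) => //.
Qed.

End step_index.

Lemma lipschitz_setT_continuous (R : realType) (V W : normedModType R) (g : V -> W) (L : R) :
  0 <= L -> (forall x y, `|g x - g y| <= L * `|x - y|) -> continuous g.
Proof.
move=> L0 gL x; apply/cvgrPdist_le => e e0.
have L1 : 0 < L + 1 by rewrite ltr_wpDl.
near=> y; apply: le_trans (gL _ _) _.
have xy : `|x - y| <= e / (L + 1).
  by near: y; apply: cvgr_dist_le; rewrite ?divr_gt0//; exact: cvg_id.
rewrite ler_pdivlMr// mulrC in xy; apply: le_trans xy.
by rewrite ler_wpM2r// lerDl.
Unshelve. all: by end_near. Qed.

Section driven.
Context dM (M : measurableType dM) (R : realType) (d : nat).
Context (T : M -> M) (tau : M -> R) (tau1 tau2 : R).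
Hypotheses (tau1_gt0 : 0 < tau1) (tauB : forall y, tau1 <= tau y <= tau2).
Hypotheses (mT : measurable_fun setT T) (mtau : measurable_fun setT tau).
Local Notation RM := (measurableTypeR R).
Context (f : 'rV[R]_d -> M * RM -> 'rV[R]_d) (Cf Lf : R).
Hypothesis mf : measurable_fun setT
  (fun p : borel 'rV[R]_d * (M * RM) => f p.1 p.2 : borel 'rV[R]_d).
Hypotheses (fC : forall x p, `|f x p| <= Cf)
  (fL : forall x y p, `|f x p - f y p| <= Lf * `|x - y|).
Context (fbar : 'rV[R]_d -> 'rV[R]_d) (Cb Lb : R).
Hypotheses (bC : forall x, `|fbar x| <= Cb)
  (bL : forall x y, `|fbar x - fbar y| <= Lb * `|x - y|).
Hypotheses (Lf0 : 0 <= Lf) (Lb0 : 0 <= Lb).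

Local Notation flow := (susp_flow T tau).
Local Notation lap := (lap T tau).

Lemma Cf_ge0 (p : M * RM) : 0 <= Cf. Proof. exact: le_trans (fC 0 p). Qed.
Lemma Cb_ge0 : 0 <= Cb. Proof. exact: le_trans (bC 0). Qed.

Lemma continuous_fbar : continuous fbar.
Proof. exact: lipschitz_setT_continuous Lb0 bL. Qed.

Lemma measurable_field d' (Z : measurableType d') (D : set Z) (h : Z -> 'rV[R]_d)
    (q : Z -> M * RM) i j : measurable D ->
  (forall i j, measurable_fun D (fun z => h z i j)) -> measurable_fun D q ->
  measurable_fun D (fun z => f (h z) (q z) i j).
Proof.
move=> mD mh mq; apply: borel_mx_entry.
have mhq : measurable_fun D (fun z => (h z : borel 'rV[R]_d, q z)).
  by apply: measurable_fun_pairD => //; exact: borel_mx_measurable.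
exact: (measurableT_comp mf mhq).
Qed.

Lemma bounded_meas_field a b (h : R -> 'rV[R]_d) (q : R -> M * RM) :
  bounded_meas a b h -> measurable_fun `[a, b] q ->
  bounded_meas a b (fun s => f (h s) (q s)).
Proof.
move=> [mh _] mq; split; last by exists Cf => s _; exact: fC.
by move=> i j; apply: measurable_field.
Qed.

Lemma bounded_meas_fbar a b (h : R -> 'rV[R]_d) :
  {within `[a, b], continuous h} -> bounded_meas a b (fbar \o h).
Proof.
move=> ch; apply: continuous_bounded_meas => r.
apply: (@continuous_comp _ _ _ (h : subspace `[a, b] -> _) fbar); first exact: ch.
exact: continuous_fbar.
Qed.

Lemma measurable_flow_time (a b e r : R) p : 0 < e -> 0 <= a -> 0 <= r -> susp tau p ->
  measurable_fun `[a, b] (fun s : R => flow (s / e + r) p).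
Proof.
move=> e0 a0 r0 ps; apply: (measurable_susp_flow tau1_gt0 tauB mT mtau) => //.
- move=> s /=; rewrite in_itv/= => /andP[as_ _]; rewrite addr_ge0// divr_ge0//.
    exact: le_trans as_.
  exact: ltW.
- by apply: measurable_funD => //; exact: measurable_funM.
Qed.

(** The phase [r] serves to compare paths that are started at different points of
   one orbit of the flow. *)
Definition driven (e r : R) (x : 'rV[R]_d) (p : M * RM) (X : R -> 'rV[R]_d) :=
  caratheodory_solution (fun t z => f z (flow (t / e + r) p) + fbar z) x X.

Section path.
Context (e r : R) (x : 'rV[R]_d) (p : M * RM) (X : R -> 'rV[R]_d).
Hypotheses (e0 : 0 < e) (r0 : 0 <= r) (ps : susp tau p) (XE : driven e r x p X).

Local Notation field s := (f (X s) (flow (s / e + r) p) + fbar (X s)).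

Let cX a b : 0 <= a -> {within `[a, b], continuous X}.
Proof.
move=> a0; apply: continuous_subspaceW (proj1 XE) => s /=.
by rewrite !in_itv/= => /andP[as_ _]; rewrite (le_trans a0).
Qed.

Lemma driven_bounded_meas a b : 0 <= a -> bounded_meas a b X.
Proof. by move=> a0; apply: continuous_bounded_meas; exact: cX. Qed.

Lemma driven_bounded_meas_f a b : 0 <= a ->
  bounded_meas a b (fun s => f (X s) (flow (s / e + r) p)).
Proof.
move=> a0; apply: bounded_meas_field; first exact: driven_bounded_meas.
exact: measurable_flow_time.
Qed.

Lemma driven_bounded_meas_fbar a b : 0 <= a -> bounded_meas a b (fun s => fbar (X s)).
Proof. by move=> a0; apply: bounded_meas_fbar; exact: cX. Qed.

Lemma driven0 : X 0 = x.
Proof. by rewrite (proj2 XE 0 (lexx 0)) mxint_xx addr0. Qed.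

Lemma drivenE s t : 0 <= s -> s <= t -> X t = X s + mxint s t (fun s => field s).
Proof.
move=> s0 st; rewrite (proj2 XE t) ?(le_trans s0)// (proj2 XE s)// -addrA; congr (_ + _).
apply: mxint_split => //; apply: bounded_measD.
  exact: driven_bounded_meas_f.
exact: driven_bounded_meas_fbar.
Qed.

Lemma driven_lipschitz s t : 0 <= s -> 0 <= t -> `|X s - X t| <= (Cf + Cb) * `|s - t|.
Proof.
wlog st : s t / s <= t.
  move=> H s0 t0; case: (leP s t) => [h|/ltW h]; first exact: H.
  by rewrite distrC [`|s - t|]distrC; exact: H.
move=> s0 t0; rewrite distrC [`|s - t|]distrC [`|t - s|]ger0_norm ?subr_ge0//.
rewrite (drivenE s0 st) addrC addKr; apply: mxint_norm => // [|u _].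
  by apply: bounded_measD; [exact: driven_bounded_meas_f|exact: driven_bounded_meas_fbar].
by rewrite (le_trans (ler_normD _ _))// lerD ?fC ?bC.
Qed.

End path.

(** Restarted at time [e * r], [X] solves the equation of [X'] from a point that is
   [O(e * r)] away from [x]. *)
Lemma driven_shift e r x p X X' S : 0 < e -> 0 <= r -> susp tau p -> 0 <= S ->
  driven e 0 x p X -> driven e r x p X' ->
  forall t, 0 <= t <= S -> `|X' t - X t| <=
    e * r * (Cf + Cb) * (1 + 2 * expR ((2 * (Lf + Lb) + 1) * S)).
Proof.
move=> e0 r0 ps S0 XE X'E t0 /andP[t00 t0S].
have CC : 0 <= Cf + Cb by rewrite addr_ge0 ?(Cf_ge0 p) ?Cb_ge0.
have er0 : 0 <= e * r by rewrite mulr_ge0// ltW.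
have XL := driven_lipschitz e0 (lexx 0) ps XE.
have X'L := driven_lipschitz e0 r0 ps X'E.
pose Xs t := X (e * r + 1 * t).
have XsE t : 0 <= t -> Xs t = X (e * r) +
    mxint 0 t (fun s => f (Xs s) (flow (s / e + r) p) + fbar (Xs s)).
  move=> tt; rewrite /Xs (@drivenE e 0 x p X e0 (lexx 0) ps XE (e * r))//; last by rewrite lerDl mul1r.
  have er1 : e * r = e * r + 1 * 0 by rewrite mulr0 addr0.
  congr (_ + _); rewrite {1}er1 mxint_affine//; last first.
    rewrite -er1; apply: bounded_measD.
      exact: (driven_bounded_meas_f e0 (lexx 0) ps XE).
    exact: (driven_bounded_meas_fbar XE).
  rewrite scale1r; apply: eq_mxint => s _ /=.
  have -> : (e * r + 1 * s) / e + 0 = s / e + r by field; rewrite gt_eqF.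
  by [].
have XsL s t : 0 <= s -> 0 <= t -> `|Xs s - Xs t| <= (Cf + Cb) * `|s - t|.
  move=> s0 t0_; apply: le_trans (XL _ _ _ _) _; rewrite ?addr_ge0 ?mul1r//.
  by rewrite opprD addrACA subrr add0r.
have bX' a b : 0 <= a -> bounded_meas a b X'.
  by move=> a0; exact: (driven_bounded_meas X'E).
have cXs a b : 0 <= a -> {within `[a, b], continuous Xs}.
  move=> a0; apply: (@lipschitz_within_continuous _ _ _ _ (Cf + Cb)) => s t.
  by rewrite !in_itv/= => /andP[sa _] /andP[ta _]; apply: XsL; exact: le_trans a0 _.
have bfXs a b : 0 <= a -> bounded_meas a b (fun s => f (Xs s) (flow (s / e + r) p) + fbar (Xs s)).
  move=> a0; apply: bounded_measD; last by apply: bounded_meas_fbar; exact: cXs.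
  apply: bounded_meas_field; last exact: measurable_flow_time.
  by apply: continuous_bounded_meas; exact: cXs.
have bfX' a b : 0 <= a -> bounded_meas a b (fun s => f (X' s) (flow (s / e + r) p) + fbar (X' s)).
  move=> a0; apply: bounded_measD.
    exact: (driven_bounded_meas_f e0 r0 ps X'E).
  exact: (driven_bounded_meas_fbar X'E).
have key : forall t, 0 <= t <= S -> `|X' t - Xs t| <=
    2 * (e * r * (Cf + Cb)) * expR ((2 * (Lf + Lb) + 1) * t).
  apply: (@mxint_gronwall _ 1 d _ 0 S _ ((Cf + Cb) * (2 * S + e * r))) => //.
  - exact: mulr_ge0.
  - by rewrite mulr_ge0// addr_ge0// mulr_ge0.
  - exact: addr_ge0.
  - move=> t /andP[tt tS]; rewrite normr_ge0/=.
    rewrite -(subrKA x) (le_trans (ler_normD _ _))//.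
    have h1 : `|X' t - x| <= (Cf + Cb) * S.
      rewrite -{1}(driven0 X'E); apply: le_trans (X'L _ _ tt (lexx 0)) _.
      by rewrite subr0 ger0_norm// ler_wpM2l.
    have h2 : `|x - Xs t| <= (Cf + Cb) * (S + e * r).
      rewrite -{1}(driven0 XE) distrC; apply: le_trans (XL _ _ _ (lexx 0)) _.
        by rewrite addr_ge0// mul1r.
      rewrite subr0 mul1r ger0_norm ?addr_ge0// ler_wpM2l// addrC lerD2r//.
    by apply: le_trans (lerD h1 h2) _; rewrite -mulrDr addrA -mulr2n -[S *+ 2]mulr_natl.
  - move=> t /andP[tt tS].
    exists (fun s => (f (X' s) (flow (s / e + r) p) + fbar (X' s)) -
                     (f (Xs s) (flow (s / e + r) p) + fbar (Xs s))); split.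
    + by apply: bounded_measB; [exact: bfX'|exact: bfXs].
    + move=> s _; rewrite opprD addrACA mulrDl.
      by apply: le_trans (ler_normD _ _) _; rewrite lerD ?fL ?bL.
    + rewrite mxintB; [|exact: bfX'|exact: bfXs].
      rewrite (XsE t)// (proj2 X'E t)//.
      set I1 := mxint 0 t _; set I2 := mxint 0 t _.
      rewrite opprD addrACA (le_trans (ler_normD _ _))// lerD2r.
      rewrite -{1}(driven0 XE); apply: le_trans (XL _ _ (lexx 0) er0) _.
      by rewrite sub0r normrN ger0_norm// mulrC.
have t0in : 0 <= t0 <= S by rewrite t00 t0S.
rewrite -(subrKA (Xs t0)) (le_trans (ler_normD _ _))// mulrDr mulr1 addrC lerD//.
  apply: le_trans (XL _ _ _ _) _ => //; first by rewrite addr_ge0// mul1r.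
  by rewrite mul1r addrK ger0_norm// mulrC.
apply: le_trans (key _ t0in) _; rewrite [2 * (_ * _)]mulrC -[leLHS]mulrA.
apply: ler_wpM2l; first exact: mulr_ge0.
by rewrite ler_wpM2l// ler_expR ler_wpM2l// addr_ge0// mulr_ge0// addr_ge0.
Qed.

End driven.

(** * The clock of the base dynamics *)

Section clock.
Context dM (M : measurableType dM) (R : realType).
Context (T : M -> M) (tau : M -> R) (tau1 tau2 : R).
Hypotheses (tau1_gt0 : 0 < tau1) (tauB : forall y, tau1 <= tau y <= tau2).
Context (e : R) (e0 : 0 < e) (y : M).

(** The base point seen at slow time [r]. *)
Definition slow_orbit (r : R) : M := iter (Num.truncn (r / e)) T y.

(** The real time at which the suspension flow has completed [r / e] laps. *)
Definition clock (r : R) : R :=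
  mxint 0 r (fun s => (tau (slow_orbit s))%:M : 'M[R]_1) ord0 ord0.

Let tau_norm z : `|tau z| <= tau2.
Proof.
have /andP[h1 h2] := tauB z.
by rewrite ger0_norm// (le_trans _ h1)// ltW.
Qed.

Lemma mxnorm_scalar n (c : R) : `|c%:M : 'M[R]_n| <= `|c|.
Proof. by apply: mxnorm_le => // i j; rewrite mxE; case: eqP => _; rewrite ?mulr1n// mulr0n normr0. Qed.

Lemma bounded_meas_slow m n a b (G : M -> R -> 'M[R]_(m, n)) C : 0 <= a ->
  (forall z, bounded_meas a b (G z)) ->
  (forall z r, r \in `[a, b] -> `|G z r| <= C) ->
  bounded_meas a b (fun r => G (slow_orbit r) r).
Proof.
move=> a0 bG GC.
by apply: (@bounded_meas_cases _ e e0 _ _ a b C (fun k r => G (iter k T y) r)) => // k r; exact: GC.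
Qed.

Lemma bounded_meas_tau a b (h : R -> R) : 0 <= a -> (exists L, forall z, `|h (tau z)| <= L) ->
  bounded_meas a b (fun s => (h (tau (slow_orbit s)))%:M : 'M[R]_1).
Proof.
move=> a0 [L hL].
apply: (@bounded_meas_slow 1 1 a b (fun z _ => (h (tau z))%:M) L) => //.
  by move=> z; exact: bounded_meas_cst.
by move=> z r _; apply: le_trans (mxnorm_scalar _ _) _.
Qed.

Let bid a b : 0 <= a -> bounded_meas a b (fun s => (tau (slow_orbit s))%:M : 'M[R]_1).
Proof. by move=> a0; apply: (bounded_meas_tau (h := id) b a0); exists tau2. Qed.

Lemma bounded_meas_tauZ m n a b (g : R -> 'M[R]_(m, n)) : 0 <= a -> bounded_meas a b g ->
  bounded_meas a b (fun s => tau (slow_orbit s) *: g s).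
Proof.
move=> a0 bg; apply: bounded_measZ => //; last by exists tau2.
have [m1 _] := bid b a0; apply: eq_measurable_fun (m1 ord0 ord0) => s _.
by rewrite mxE eqxx mulr1n.
Qed.

Lemma clockE s t : 0 <= s -> s <= t ->
  mxint s t (fun r => (tau (slow_orbit r))%:M : 'M[R]_1) = (clock t - clock s)%:M.
Proof.
move=> s0 st; rewrite [LHS]mx11_scalar /clock (mxint_split s0 st (bid t (lexx 0))).
by rewrite [in RHS]mxE addrAC subrr add0r.
Qed.

Lemma clockZ m n s t (v : 'M[R]_(m, n)) : 0 <= s -> s <= t ->
  mxint s t (fun r => tau (slow_orbit r) *: v) = (clock t - clock s) *: v.
Proof.
move=> s0 st; have := clockE s0 st => /matrixP/(_ ord0 ord0); rewrite !mxE eqxx mulr1n => E.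
apply/matrixP => i j; rewrite !mxE -E.
have it := @bounded_meas_integrable _ _ _ _ _ _ ord0 ord0 (bid t s0).
rewrite mulrC -RintegralZl//.
by apply: eq_Rintegral => r _; rewrite !mxE eqxx mulr1n mulrC.
Qed.

Lemma clock_le s t : 0 <= s -> s <= t -> clock t - clock s <= tau2 * (t - s).
Proof.
move=> s0 st; have E := clockE s0 st.
have : `|mxint s t (fun r => (tau (slow_orbit r))%:M : 'M[R]_1)| <= tau2 * (t - s).
  apply: mxint_norm => // [|r _]; first exact: bid.
  exact: le_trans (mxnorm_scalar _ _) (tau_norm _).
rewrite E; apply: le_trans; apply: le_trans (mxnorm_entry _ ord0 ord0).
by rewrite mxE eqxx mulr1n ler_norm.
Qed.

Lemma clock_ge s t : 0 <= s -> s <= t -> tau1 * (t - s) <= clock t - clock s.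
Proof.
move=> s0 st.
have : `|mxint s t (fun r => tau2%:M - (tau (slow_orbit r))%:M : 'M[R]_1)| <= (tau2 - tau1) * (t - s).
  apply: mxint_norm => // [|r _].
    by apply: bounded_measB; [exact: bounded_meas_cst|exact: bid].
  rewrite -raddfB; apply: le_trans (mxnorm_scalar _ _) _.
  by have /andP[h1 h2] := tauB (slow_orbit r); rewrite ger0_norm ?subr_ge0// lerB.
rewrite mxintB; [|exact: bounded_meas_cst|exact: bid].
rewrite mxint_cst// clockE// => h.
have := le_trans (mxnorm_entry _ ord0 ord0) h; rewrite !mxE eqxx !mulr1n.
by move/(le_trans (ler_norm _)); lra.
Qed.

Lemma clock0 : clock 0 = 0. Proof. by rewrite /clock mxint_xx mxE. Qed.

Lemma clock_ge0 s : 0 <= s -> 0 <= clock s.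
Proof.
move=> s0; have := clock_ge (lexx 0) s0; rewrite clock0 !subr0; apply: le_trans.
by rewrite mulr_ge0// ltW.
Qed.

Lemma clock_homo s t : 0 <= s -> s <= t -> clock s <= clock t.
Proof.
move=> s0 st; rewrite -subr_ge0 (le_trans _ (clock_ge s0 st))//.
by rewrite mulr_ge0 ?subr_ge0// ltW.
Qed.

Lemma mxint_slow_step m n k (G : M -> R -> 'M[R]_(m, n)) C :
  (forall z, bounded_meas (e * k%:R) (e * k.+1%:R) (G z)) ->
  (forall z r, r \in `[e * k%:R, e * k.+1%:R] -> `|G z r| <= C) ->
  mxint (e * k%:R) (e * k.+1%:R) (fun r => G (slow_orbit r) r) =
  mxint (e * k%:R) (e * k.+1%:R) (G (iter k T y)).
Proof.
move=> bG GC; apply: eq_mxint_co => //.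
  by apply: (@bounded_meas_slow _ _ _ _ G C) => //; rewrite mulr_ge0// ltW.
by move=> r /andP[h1 h2]; rewrite /slow_orbit (idx_eq e0 h1 h2).
Qed.

Lemma step_length k : e * k.+1%:R - e * k%:R = e.
Proof. by rewrite -natr1 mulrDr mulr1 addrAC subrr add0r. Qed.

Lemma step_le k : e * k%:R <= e * k.+1%:R.
Proof. by rewrite ler_wpM2l ?ler_nat// ltW. Qed.

Lemma step_ge0 k : 0 <= e * k%:R.
Proof. by rewrite mulr_ge0// ltW. Qed.

Lemma clock_grid k : clock (e * k%:R) = e * birkhoff_sum T tau k y.
Proof.
elim: k => [|k IH]; first by rewrite mulr0 clock0 birkhoff_sum0 mulr0.
rewrite birkhoff_sumSr mulrDr -IH; apply/eqP; rewrite addrC -subr_eq; apply/eqP.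
have := clockE (step_ge0 k) (step_le k).
rewrite (@mxint_slow_step _ _ k (fun z _ => (tau z)%:M) tau2); last 2 first.
- by move=> z; exact: bounded_meas_cst.
- by move=> z r _; apply: le_trans (mxnorm_scalar _ _) _.
rewrite mxint_cst ?step_le// step_length => /matrixP/(_ ord0 ord0).
by rewrite !mxE eqxx !mulr1n.
Qed.

End clock.

Section averaged_flow.
Context dM (M : measurableType dM) (R : realType) (d : nat).
Context (T : M -> M) (tau : M -> R) (tau1 tau2 : R).
Hypotheses (tau1_gt0 : 0 < tau1) (tauB : forall y, tau1 <= tau y <= tau2).
Context (fbar : 'rV[R]_d -> 'rV[R]_d) (Cb Lb : R).
Hypotheses (bC : forall x, `|fbar x| <= Cb)
  (bL : forall x y, `|fbar x - fbar y| <= Lb * `|x - y|) (Lb0 : 0 <= Lb).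
Context (taubar : R) (taubar0 : 0 < taubar).
Context (x : 'rV[R]_d) (W : R -> 'rV[R]_d).
Hypothesis W_ode : ode_solution fbar x W.
Context (e : R) (e0 : 0 < e) (y : M).

Local Notation Q := (slow_orbit T e y).
Local Notation th := (clock T tau e y).
Local Notation w r := (W (taubar * r)).

Let Cb0 : 0 <= Cb. Proof. exact: le_trans (bC 0). Qed.
Let cfbar : continuous fbar. Proof. exact: lipschitz_setT_continuous Lb0 bL. Qed.
Let tau2_ge0 : 0 <= tau2.
Proof. by have /andP[h1 h2] := tauB y; rewrite (le_trans _ h2)// (le_trans _ h1)// ltW. Qed.

Lemma averaged_lipschitz s t : 0 <= s -> 0 <= t -> `|W s - W t| <= Cb * `|s - t|.
Proof.
wlog st : s t / s <= t.
  move=> H s0 t0; case: (leP s t) => [h|/ltW h]; first exact: H.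
  by rewrite distrC [`|s - t|]distrC; exact: H.
move=> s0 t0; rewrite distrC [`|s - t|]distrC [`|t - s|]ger0_norm ?subr_ge0//.
rewrite (ode_solution_mxint cfbar W_ode s0 st) addrC addKr; apply: mxint_norm => // [|u _].
  apply: bounded_meas_fbar bL Lb0 _ _ _ _.
  have [_ cW _] := W_ode; apply: continuous_subspaceW cW => r /=.
  by rewrite !in_itv/= => /andP[as_ _]; rewrite (le_trans s0).
exact: bC.
Qed.

Lemma averaged0 : W 0 = x. Proof. by have [] := W_ode. Qed.

Let bW a b : 0 <= a -> bounded_meas a b (fun r => fbar (W r)).
Proof.
move=> a0; apply: (@lipschitz_bounded_meas _ _ _ _ _ (Lb * Cb)) => s t.
rewrite !in_itv/= => /andP[s0 _] /andP[t0 _]; apply: le_trans (bL _ _) _.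
by rewrite -mulrA ler_wpM2l// averaged_lipschitz// (le_trans a0).
Qed.

Lemma bounded_meas_fbarw a b : 0 <= a -> bounded_meas a b (fun r => fbar (w r)).
Proof.
move=> a0; apply: (@lipschitz_bounded_meas _ _ _ _ _ (Lb * (Cb * taubar))) => s t.
rewrite !in_itv/= => /andP[s0 _] /andP[t0 _]; apply: le_trans (bL _ _) _.
rewrite -!mulrA ler_wpM2l//; apply: le_trans (averaged_lipschitz _ _) _.
- by apply: mulr_ge0; [exact: ltW|exact: le_trans s0].
- by apply: mulr_ge0; [exact: ltW|exact: le_trans t0].
- by rewrite -mulrBr normrM gtr0_norm.
Qed.

Lemma clock_lipschitz s t : 0 <= s -> 0 <= t -> `|th s - th t| <= tau2 * `|s - t|.
Proof.
wlog st : s t / s <= t.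
  move=> H s0 t0; case: (leP s t) => [h|/ltW h]; first exact: H.
  by rewrite distrC [`|s - t|]distrC; exact: H.
move=> s0 t0; rewrite distrC [`|s - t|]distrC [`|t - s|]ger0_norm ?subr_ge0//.
rewrite ger0_norm ?subr_ge0; first exact: (clock_le T tau1_gt0 tauB).
exact: (clock_homo T tau1_gt0 tauB).
Qed.

Lemma bounded_meas_fbarth a b : 0 <= a -> bounded_meas a b (fun r => fbar (W (th r))).
Proof.
move=> a0; apply: (@lipschitz_bounded_meas _ _ _ _ _ (Lb * (Cb * tau2))) => s t.
rewrite !in_itv/= => /andP[as_ _] /andP[at_ _]; apply: le_trans (bL _ _) _.
have s0 := le_trans a0 as_; have t0 := le_trans a0 at_.
rewrite -!mulrA ler_wpM2l//; apply: le_trans (averaged_lipschitz _ _) _.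
- exact: (clock_ge0 T tau1_gt0 tauB).
- exact: (clock_ge0 T tau1_gt0 tauB).
- by rewrite ler_wpM2l// clock_lipschitz.
Qed.

Lemma averaged_scaled s : 0 <= s -> w s = x + mxint 0 s (fun r => taubar *: fbar (w r)).
Proof.
move=> s0; have ts0 : 0 <= taubar * s by rewrite mulr_ge0// ltW.
rewrite (ode_solution_mxint cfbar W_ode (lexx 0) ts0) averaged0; congr (_ + _).
rewrite mxintZ; last exact: bounded_meas_fbarw.
have {1}-> : taubar * s = 0 + taubar * s by rewrite add0r.
have {1}-> : 0 = 0 + taubar * 0 :> R by rewrite mulr0 addr0.
rewrite mxint_affine//; last by rewrite mulr0 addr0; exact: bW.
by congr (_ *: _); apply: eq_mxint => r _ /=; rewrite add0r.
Qed.

(** The chain rule for [W] along the clock, which is only piecewise smooth. *)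
Lemma averaged_clock s : 0 <= s ->
  W (th s) = x + mxint 0 s (fun r => tau (Q r) *: fbar (W (th r))).
Proof.
move=> s0; pose I t := mxint 0 t (fun r => tau (Q r) *: fbar (W (th r))).
have bI a b : 0 <= a -> bounded_meas a b (fun r => tau (Q r) *: fbar (W (th r))).
  by move=> a0; apply: (bounded_meas_tauZ T tau1_gt0 tauB) => //; exact: bounded_meas_fbarth.
pose G t := W (th t) - I t.
have G0 : G 0 = x by rewrite /G /I mxint_xx clock0 averaged0 subr0.
suff : `|G s - G 0| <= 0 * (s - 0).
  by rewrite mul0r normr_le0 G0 subr_eq0 => /eqP <-; rewrite /G subrK.
pose c := Lb * Cb * tau2 * tau2.
have c0 : 0 <= c by rewrite !mulr_ge0.
apply: local_to_global => // eta eta0.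
exists (eta / (2 * c + 1)) => [|r t r0 rt ts tr]; first by rewrite divr_gt0// ltr_wpDl// mulr_ge0.
have thr := clock_ge0 T tau1_gt0 tauB e0 y r0.
have thrt := clock_homo T tau1_gt0 tauB e0 y r0 rt.
have th2 := clock_le T tau1_gt0 tauB e0 y r0 rt.
have tr0 : 0 <= t - r by rewrite subr_ge0.
have trc0 : 0 <= th t - th r by rewrite subr_ge0.
have -> : G t - G r =
   mxint (th r) (th t) (fun u => fbar (W u) - fbar (W (th r)))
   - mxint r t (fun u => tau (Q u) *: (fbar (W (th u)) - fbar (W (th r)))).
  rewrite mxintB; [|exact: bW|exact: bounded_meas_cst].
  rewrite mxint_cst// -(clockZ T tau1_gt0 tauB e0 y _ r0 rt).
  rewrite [mxint r t (fun u => _ *: (_ - _))](eq_mxint (h := fun u =>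
    tau (Q u) *: fbar (W (th u)) - tau (Q u) *: fbar (W (th r)))); last first.
    by move=> u _; rewrite scalerBr.
  rewrite mxintB; [|exact: bI|]; last first.
    by apply: (bounded_meas_tauZ T tau1_gt0 tauB) => //; exact: bounded_meas_cst.
  have IE : I t = I r + mxint r t (fun u => tau (Q u) *: fbar (W (th u))).
    by apply: mxint_split => //; exact: bI.
  have WE : W (th t) = W (th r) + mxint (th r) (th t) (fun u => fbar (W u)).
    exact: (ode_solution_mxint cfbar W_ode thr thrt).
  rewrite /G IE WE; move: (W (th r)) (I r) (mxint (th r) (th t) _) (mxint r t _) (mxint r t _).
  move=> i1 i2 i3 i4 i5; by apply/matrixP => i j; rewrite !mxE; ring.
have b1 : `|mxint (th r) (th t) (fun u => fbar (W u) - fbar (W (th r)))| <= c * (t - r) * (t - r).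
  apply: (@le_trans _ _ (Lb * (Cb * (th t - th r)) * (th t - th r))).
    apply: mxint_norm => // [|u]; first by apply: bounded_measB; [exact: bW|exact: bounded_meas_cst].
    rewrite in_itv/= => /andP[ru ut]; apply: le_trans (bL _ _) _; rewrite ler_wpM2l//.
    apply: le_trans (averaged_lipschitz _ _) _ => //; first exact: le_trans ru.
    by rewrite ler_wpM2l// ger0_norm ?subr_ge0// lerB.
  have -> : c * (t - r) * (t - r) = Lb * (Cb * (tau2 * (t - r))) * (tau2 * (t - r)) by rewrite /c; ring.
  by rewrite ler_pM ?mulr_ge0// ler_wpM2l// ler_wpM2l.
have b2 : `|mxint r t (fun u => tau (Q u) *: (fbar (W (th u)) - fbar (W (th r))))| <= c * (t - r) * (t - r).
  apply: mxint_norm => // [|u].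
    apply: (bounded_meas_tauZ T tau1_gt0 tauB) => //.
    by apply: bounded_measB; [exact: bounded_meas_fbarth|exact: bounded_meas_cst].
  rewrite in_itv/= => /andP[ru ut]; rewrite normrZ.
  have -> : c * (t - r) = tau2 * (Lb * (Cb * (tau2 * (t - r)))) by rewrite /c; ring.
  have u0 := le_trans r0 ru.
  rewrite ler_pM//.
    have /andP[h1 h2] := tauB (Q u); rewrite ger0_norm// (le_trans _ h1)// ltW//.
  apply: le_trans (bL _ _) _; rewrite ler_wpM2l//.
  apply: le_trans (averaged_lipschitz _ _) _ => //; first exact: (clock_ge0 T tau1_gt0 tauB).
  rewrite ler_wpM2l//; apply: le_trans (clock_lipschitz _ _) _ => //.
  by rewrite ler_wpM2l// ger0_norm ?subr_ge0// lerB.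
rewrite add0r; apply: le_trans (ler_normB _ _) _; apply: le_trans (lerD b1 b2) _.
rewrite ler_pdivlMr ?ltr_wpDl ?mulr_ge0// in tr.
rewrite -mulrDl ler_wpM2r//; apply: le_trans tr.
lra.
Qed.

(** The fluctuation of the clock displaces [W] by as much as it displaces the
   first order term, up to Gronwall. *)
Lemma averaged_clock_deviation (S zeta : R) : 0 <= S -> 0 <= zeta ->
  (forall s, 0 <= s <= S ->
     `|mxint 0 s (fun r => (tau (Q r) - taubar) *: fbar (w r))| <= zeta) ->
  forall s, 0 <= s <= S ->
    `|W (th s) - w s| <= 2 * zeta * expR ((2 * (tau2 * Lb) + 1) * s).
Proof.
move=> S0 zeta0 zB.
have th0 := clock_ge0 T tau1_gt0 tauB e0 y.
have tn u : `|tau (Q u)| <= tau2.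
  by have /andP[h1 h2] := tauB (Q u); rewrite ger0_norm// (le_trans _ h1)// ltW.
apply: (@mxint_gronwall _ 1 d _ 0 S zeta (Cb * (tau2 * S) + Cb * (taubar * S))) => //.
- by rewrite addr_ge0// !mulr_ge0// ltW.
- by rewrite mulr_ge0.
- move=> s /andP[s0 sS]; rewrite normr_ge0/=.
  rewrite -(subrKA x) (le_trans (ler_normD _ _))// -averaged0; apply: lerD.
    apply: le_trans (averaged_lipschitz _ _) _ => //; first exact: th0.
    rewrite ler_wpM2l//; have := clock_lipschitz s0 (lexx 0).
    by rewrite clock0 !subr0 => /le_trans; apply; rewrite ger0_norm// ler_wpM2l.
  have ws0 : 0 <= taubar * s by rewrite mulr_ge0// ltW.
  rewrite distrC; apply: le_trans (averaged_lipschitz _ _) _ => //.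
  by rewrite ler_wpM2l// subr0 ger0_norm// ler_wpM2l// ltW.
- move=> s /[dup] sin /andP[s0 sS].
  have b1 : bounded_meas 0 s (fun r => tau (Q r) *: fbar (W (th r))).
    by apply: (bounded_meas_tauZ T tau1_gt0 tauB) => //; exact: bounded_meas_fbarth.
  have b2 : bounded_meas 0 s (fun r => tau (Q r) *: fbar (w r)).
    by apply: (bounded_meas_tauZ T tau1_gt0 tauB) => //; exact: bounded_meas_fbarw.
  have b3 : bounded_meas 0 s (fun r => taubar *: fbar (w r)).
    by apply: bounded_measZc; exact: bounded_meas_fbarw.
  exists (fun r => tau (Q r) *: (fbar (W (th r)) - fbar (w r))); split.
  + apply: (bounded_meas_tauZ T tau1_gt0 tauB) => //; apply: bounded_measB.
      exact: bounded_meas_fbarth.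
    exact: bounded_meas_fbarw.
  + by move=> r _; rewrite normrZ -mulrA ler_pM ?bL.
  + rewrite averaged_clock// averaged_scaled//.
    have := zB s sin.
    rewrite (eq_mxint (h := fun r => tau (Q r) *: fbar (w r) - taubar *: fbar (w r))); last first.
      by move=> r _; rewrite scalerBl.
    rewrite mxintB// [mxint 0 s (fun r => _ *: (_ - _))](eq_mxint (h := fun r =>
      tau (Q r) *: fbar (W (th r)) - tau (Q r) *: fbar (w r))); last first.
      by move=> r _; rewrite scalerBr.
    rewrite mxintB//.
    set i1 := mxint 0 s _; set i2 := mxint 0 s _; set i3 := mxint 0 s _ => h.
    have -> : x + i3 - (x + i2) = (i1 - i2) + (i3 - i1).
      by apply/matrixP => i j; rewrite !mxE; ring.
    by apply: le_trans (ler_normD _ _) _; rewrite lerD2r.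
Qed.

End averaged_flow.

(** * The normalised error of one path *)

Section blocks.
Context {R : realType} (m n k : nat).

(** Summing [mxint_lipschitz_mul] over blocks of length [delta]: [h] is paid once
   per block, but [L] only against the oscillation [eta] within a block. *)
Lemma mxint_block_bound (H : R -> 'M[R]_(m, n)) (J : R -> 'M[R]_(n, k))
    (S L h eta delta : R) : 0 <= L -> 0 <= eta -> 0 <= h -> 0 < delta ->
  (forall s t, s \in `[0, S] -> t \in `[0, S] -> `|H s - H t| <= L * `|s - t|) ->
  (forall s, s \in `[0, S] -> `|H s| <= h) -> bounded_meas 0 S J ->
  (forall p q, 0 <= p -> p <= q -> q <= S -> q - p <= delta -> `|mxint p q J| <= eta) ->
  forall s, 0 <= s <= S ->
    `|mxint 0 s (fun r => H r *m J r)| <=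
      n%:R * ((S / delta + 1) * (h * eta) + L * eta * S).
Proof.
move=> L0 eta0 h0 d0 HL Hh bJ osc s /andP[s0 sS].
have bH := lipschitz_bounded_meas HL.
have bHJ := bounded_measM bH bJ.
pose g j : R := Num.min (j%:R * delta) s.
have g0 : g 0%N = 0 by rewrite /g mul0r min_l.
have gS j : 0 <= g j <= S.
  rewrite /g le_min mulr_ge0 ?s0//=; last exact: ltW.
  by rewrite ge_min sS orbT.
have gle j : g j <= g j.+1.
  rewrite /g le_min !ge_min lexx orbT andbT; apply/orP; left.
  by rewrite ler_wpM2r ?ler_nat// ltW.
have gd j : g j.+1 - g j <= delta.
  rewrite /g lerBlDr; have [h1|h1] := leP (j%:R * delta) s.
    by rewrite ge_min -natr1 mulrDl mul1r addrC lexx.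
  by rewrite ge_min; apply/orP; right; rewrite lerDr ltW.
have step j : `|mxint 0 (g j) (fun r => H r *m J r)| <=
    n%:R * (j%:R * (h * eta) + L * eta * g j).
  elim: j => [|j IH]; first by rewrite g0 mxint_xx normr0 mul0r mulr0 addr0 mulr0.
  have /andP[gj0 gjS] := gS j; have /andP[gj0' gjS'] := gS j.+1.
  rewrite (@mxint_split _ _ _ 0 (g j) (g j.+1))//; last exact: bounded_measS bHJ.
  apply: le_trans (ler_normD _ _) _.
  have : `|mxint (g j) (g j.+1) (fun r => H r *m J r)| <=
      n%:R * (h * eta + L * eta * (g j.+1 - g j)).
    have sub r : r \in `[g j, g j.+1] -> r \in `[0, S].
      by rewrite !in_itv/= => /andP[r1 r2]; rewrite (le_trans gj0)// (le_trans r2).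
    apply: mxint_lipschitz_mul => //.
    - by move=> u v /sub us /sub vs; exact: HL.
    - by apply: Hh; rewrite in_itv/= gj0.
    - exact: bounded_measS bJ.
    - move=> r; rewrite in_itv/= => /andP[r1 r2]; apply: osc => //.
        exact: le_trans r1.
      by apply: le_trans (gd j); rewrite lerB.
  move=> h1; apply: le_trans (lerD IH h1) _.
  by rewrite -mulrDr ler_wpM2l// -natr1; lra.
pose N := (Num.truncn (S / delta)).+1.
have gN : g N = s.
  rewrite /g min_r// (le_trans sS)// -ler_pdivrMr// ltW//; exact: truncnS_gt.
have := step N; rewrite gN => /le_trans; apply; rewrite ler_wpM2l// lerD//.
  rewrite ler_wpM2r ?mulr_ge0// /N -natr1 lerD2r truncn_le divr_ge0//; last exact: ltW.
  exact: le_trans sS.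
by rewrite ler_wpM2l// mulr_ge0.
Qed.

End blocks.

Section error.
Context dM (M : measurableType dM) (R : realType) (d : nat).
Context (T : M -> M) (tau : M -> R) (tau1 tau2 : R).
Hypotheses (tau1_gt0 : 0 < tau1) (tauB : forall y, tau1 <= tau y <= tau2).
Hypotheses (mT : measurable_fun setT T) (mtau : measurable_fun setT tau).
Local Notation RM := (measurableTypeR R).
Context (f : 'rV[R]_d -> M * RM -> 'rV[R]_d) (Cf Lf : R).
Hypothesis mf : measurable_fun setT
  (fun p : borel 'rV[R]_d * (M * RM) => f p.1 p.2 : borel 'rV[R]_d).
Hypotheses (fC : forall x p, `|f x p| <= Cf)
  (fL : forall x y p, `|f x p - f y p| <= Lf * `|x - y|) (Lf0 : 0 <= Lf).
Context (fbar : 'rV[R]_d -> 'rV[R]_d) (C : R).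
Hypotheses (F_C2 : forall y, C2_bounded C ((roof_integral tau f) ^~ y))
  (fbar_C2 : C2_bounded C fbar).
Context (taubar : R) (taubar0 : 0 < taubar).
Context (x : 'rV[R]_d) (W : R -> 'rV[R]_d).
Hypothesis W_ode : ode_solution fbar x W.
Context (e k : R) (e0 : 0 < e) (k0 : 0 < k) (y : M) (X : R -> 'rV[R]_d).
Hypothesis XE : driven T tau f fbar e 0 x (y, 0) X.

Local Notation F z y := (roof_integral tau f z y).
Local Notation Q := (slow_orbit T e y).
Local Notation th := (clock T tau e y).
Local Notation w r := (W (taubar * r)).
Local Notation lap := (lap T tau).
Local Notation S_ n := (birkhoff_sum T tau n y).
Local Notation flow := (susp_flow T tau).

Let C0 : 0 <= C. Proof. exact: C2_bounded_ge0 fbar_C2. Qed.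
Let bC u : `|fbar u| <= C. Proof. by have [_ _ h _ _] := fbar_C2. Qed.
Let bL u v : `|fbar u - fbar v| <= d%:R * C * `|u - v|.
Proof. exact: C2_bounded_lipschitz. Qed.
Let dC0 : 0 <= d%:R * C. Proof. exact: mulr_ge0. Qed.
Let FC z u : `|F z u| <= C. Proof. by have [_ _ h _ _] := F_C2 u. Qed.
Let FL z z' u : `|F z u - F z' u| <= d%:R * C * `|z - z'|.
Proof. exact: (C2_bounded_lipschitz (F_C2 u)). Qed.
Let ps : susp tau (y, 0). Proof. exact: susp_zero tau1_gt0 tauB y. Qed.
Let tau_ge0 z : 0 <= tau z.
Proof. by have /andP[h _] := tauB z; rewrite (le_trans _ h)// ltW. Qed.
Let tau2_ge0 : 0 <= tau2.
Proof. by have /andP[_ h] := tauB y; rewrite (le_trans _ h). Qed.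

Local Notation CX := (Cf + C).
Let Cf0 : 0 <= Cf. Proof. exact: Cf_ge0 fC (y, 0). Qed.
Let CX0 : 0 <= CX. Proof. exact: addr_ge0. Qed.

Let XL s t : 0 <= s -> 0 <= t -> `|X s - X t| <= CX * `|s - t|.
Proof. exact: (driven_lipschitz tau1_gt0 tauB mT mtau mf fC bC bL dC0 e0 (lexx 0) ps XE). Qed.
Let X0 : X 0 = x. Proof. exact: driven0 XE. Qed.
Let WL s t : 0 <= s -> 0 <= t -> `|W s - W t| <= C * `|s - t|.
Proof. exact: (averaged_lipschitz bC bL dC0 W_ode). Qed.
Let W0 : W 0 = x. Proof. exact: averaged0 W_ode. Qed.
Let th0 s : 0 <= s -> 0 <= th s.
Proof. exact: (clock_ge0 T tau1_gt0 tauB). Qed.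
Let thL s t : 0 <= s -> 0 <= t -> `|th s - th t| <= tau2 * `|s - t|.
Proof. exact: (clock_lipschitz T tau1_gt0 tauB). Qed.

Let bX a b : 0 <= a -> bounded_meas a b X.
Proof. by move=> a0; exact: (driven_bounded_meas XE). Qed.

Let in0 (a b s : R) : 0 <= a -> s \in `[a, b] -> 0 <= s.
Proof. by move=> a0; rewrite in_itv/= => /andP[as_ _]; exact: le_trans as_. Qed.

(** [G z r] is integrated along the base orbit, jumping at the multiples of [e]. *)
Lemma bounded_meas_orbit m n a b (G : M -> R -> 'M[R]_(m, n)) L K : 0 <= a ->
  (forall z s t, 0 <= s -> 0 <= t -> `|G z s - G z t| <= L * `|s - t|) ->
  (forall z s, 0 <= s -> `|G z s| <= K) ->
  bounded_meas a b (fun r => G (Q r) r).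
Proof.
move=> a0 GL GK; apply: (@bounded_meas_slow _ _ _ T e e0 y m n a b G K a0).
  move=> z; apply: (@lipschitz_bounded_meas _ _ _ _ _ L) => s t sab tab.
  by apply: GL; [exact: in0 sab|exact: in0 tab].
by move=> z r rab; apply: GK; exact: in0 rab.
Qed.

Let FXL z s t : 0 <= s -> 0 <= t ->
  `|F (X (th s)) z - F (X (th t)) z| <= d%:R * C * (CX * tau2) * `|s - t|.
Proof.
move=> s0 t0; apply: le_trans (FL _ _ _) _; rewrite -!mulrA; do 2 rewrite ler_wpM2l//.
apply: le_trans (XL _ _) _; [exact: th0|exact: th0|].
by rewrite ler_wpM2l// thL.
Qed.

Lemma bounded_meas_FX a b : 0 <= a -> bounded_meas a b (fun r => F (X (th r)) (Q r)).
Proof.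
move=> a0.
apply: (@bounded_meas_orbit _ _ _ _ (fun z r => F (X (th r)) z) _ C a0 FXL).
by move=> z s _; exact: FC.
Qed.

Let wL s t : 0 <= s -> 0 <= t -> `|w s - w t| <= taubar * C * `|s - t|.
Proof.
move=> s0 t0; apply: le_trans (WL _ _) _.
- by rewrite mulr_ge0// ltW.
- by rewrite mulr_ge0// ltW.
- by rewrite -mulrBr normrM gtr0_norm// mulrA [C * _]mulrC.
Qed.

Lemma bounded_meas_Fw a b : 0 <= a -> bounded_meas a b (fun r => F (w r) (Q r)).
Proof.
move=> a0; apply: (@bounded_meas_orbit _ _ _ _ (fun z r => F (w r) z) (d%:R * C * (taubar * C)) C a0).
- move=> z s t s0 t0; apply: le_trans (FL _ _ _) _; rewrite -!mulrA; do 2 rewrite ler_wpM2l//.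
  by rewrite mulrA; exact: wL.
- by move=> z s _; exact: FC.
Qed.

Lemma bounded_meas_Jw a b : 0 <= a -> bounded_meas a b (fun r => 'J (roof_integral tau f ^~ (Q r)) (w r)).
Proof.
move=> a0.
apply: (@bounded_meas_orbit _ _ _ _ (fun z r => 'J (roof_integral tau f ^~ z) (w r)) (C * (taubar * C)) C a0).
- move=> z s t s0 t0; apply: le_trans (C2_bounded_jacobian_lipschitz (F_C2 z) _ _) _.
  by rewrite -mulrA ler_wpM2l//; exact: wL.
- by move=> z s _; have [_ _ _ h _] := F_C2 z; exact: h.
Qed.

Local Notation c2 := (Lf * (CX * tau2) * tau2 + d%:R * C * (CX * tau2)).

Let phi s := f (X s) (flow (s / e + 0) (y, 0)).

Let bphi a b : 0 <= a -> bounded_meas a b phi.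
Proof. by move=> a0; exact: (driven_bounded_meas_f tau1_gt0 tauB mT mtau mf fC e0 (lexx 0) ps XE). Qed.

Let phi_lap n s : e * S_ n <= s < e * S_ n.+1 -> phi s = f (X s) (iter n T y, s / e - S_ n).
Proof.
move=> /andP[h1 h2]; rewrite /phi /susp_flow/= !addr0.
by rewrite (@lap_eq _ _ _ T tau tau1 tau2 tau1_gt0 tauB n)// ?ler_pdivlMr ?ltr_pdivrMr// mulrC.
Qed.

(** The [n]-th lap lasts [e * tau] in real time and [e] in slow time. Over it [f]
   integrates to [e * F] if [X] is frozen, and freezing [X] costs [O(e)] on a lap
   of length [O(e)]. *)
Lemma lap_step n :
  `|mxint (e * S_ n) (e * S_ n.+1) phi -
    mxint (e * n%:R) (e * n.+1%:R) (fun r => F (X (th r)) (Q r))| <= e ^+ 2 * c2.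
Proof.
set z := iter n T y; have [tz1 tz2] := andP (tauB z).
have Sn0 : 0 <= S_ n by have := birkhoff_sum_ge T tauB n y; apply: le_trans; rewrite mulr_ge0// ltW.
have eS0 : 0 <= e * S_ n by rewrite mulr_ge0// ltW.
have eS1 : e * S_ n.+1 = e * S_ n + e * tau z by rewrite birkhoff_sumSr mulrDr.
have eS00 : e * S_ n = e * S_ n + e * 0 by rewrite mulr0 addr0.
pose g (s : R) := f (X s) (z, s / e - S_ n).
have bg : bounded_meas (e * S_ n) (e * S_ n.+1) g.
  apply: (bounded_meas_field mf fC); first exact: bX.
  apply: measurable_fun_pairD => //; apply: measurable_funB => //; exact: measurable_funM.
have -> : mxint (e * S_ n) (e * S_ n.+1) phi = e *: mxint 0 (tau z) (fun u => f (X (e * S_ n + e * u)) (z, u)).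
  rewrite (eq_mxint_co (bphi _ eS0) bg); last by move=> s /phi_lap.
  rewrite eS1 {1}eS00 mxint_affine//; last by rewrite -eS00 -eS1.
  congr (_ *: _); apply: eq_mxint => u _; rewrite /g; congr (f _ (_, _)).
  by field; rewrite gt_eqF.
have bu : bounded_meas 0 (tau z) (fun u => f (X (e * S_ n + e * u)) (z, u)).
  have := @bounded_meas_affine _ _ _ (e * S_ n) e 0 (tau z) g e0.
  rewrite -eS00 -eS1 => /(_ bg); apply: eq_bounded_meas => u _; rewrite /g; congr (f _ (_, _)).
  by field; rewrite gt_eqF.
have bu0 : bounded_meas 0 (tau z) (fun u => f (X (e * S_ n)) (z, u)).
  apply: (bounded_meas_field mf fC); first exact: bounded_meas_cst.
  by apply: measurable_fun_pairD.
have th_n : th (e * n%:R) = e * S_ n by exact: (clock_grid T tau1_gt0 tauB e0).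
have en0 := step_ge0 e0 n; have enS := step_le e0 n.
have -> : mxint (e * n%:R) (e * n.+1%:R) (fun r => F (X (th r)) (Q r)) =
          mxint (e * n%:R) (e * n.+1%:R) (fun r => F (X (th r)) z).
  apply: (@mxint_slow_step _ _ _ T e e0 y _ _ n (fun z r => F (X (th r)) z) C) => //.
  move=> z'; apply: (@lipschitz_bounded_meas _ _ _ _ _ (d%:R * C * (CX * tau2))) => s t sab tab.
  by apply: FXL; [exact: in0 sab|exact: in0 tab].
set F0 := F (X (e * S_ n)) z.
rewrite -(subrKA (e *: F0)) mulrDr; apply: le_trans (ler_normD _ _) _; apply: lerD.
  rewrite -scalerBr normrZ gtr0_norm// expr2 -mulrA ler_wpM2l//; first exact: ltW.
  rewrite /F0 /roof_integral -mxintB//.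
  apply: (@le_trans _ _ (Lf * (CX * (e * tau2)) * (tau z - 0))).
    apply: mxint_norm => // [|u]; first exact: bounded_measB.
    rewrite in_itv/= => /andP[u0 uz]; apply: le_trans (fL _ _ _) _; rewrite ler_wpM2l//.
    apply: le_trans (XL _ eS0) _; first by rewrite addr_ge0// mulr_ge0// ltW.
    rewrite ler_wpM2l// addrAC subrr add0r ger0_norm; last by rewrite mulr_ge0// ltW.
    by rewrite ler_wpM2l ?(le_trans uz)// ltW.
  rewrite subr0; have -> : e * (Lf * (CX * tau2) * tau2) = Lf * (CX * (e * tau2)) * tau2 by ring.
  by rewrite ler_wpM2l// mulr_ge0// mulr_ge0// mulr_ge0// ltW.
have -> : e *: F0 = mxint (e * n%:R) (e * n.+1%:R) (fun=> F0).
  by rewrite mxint_cst ?step_le// step_length.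
have bFz : bounded_meas (e * n%:R) (e * n.+1%:R) (fun r => F (X (th r)) z).
  apply: (@lipschitz_bounded_meas _ _ _ _ _ (d%:R * C * (CX * tau2))) => s t sab tab.
  by apply: FXL; [exact: in0 sab|exact: in0 tab].
rewrite -mxintB//; last exact: bounded_meas_cst.
have -> : e ^+ 2 * (d%:R * C * (CX * tau2)) =
    e * (d%:R * C * (CX * tau2)) * (e * n.+1%:R - e * n%:R).
  by rewrite step_length; ring.
apply: mxint_norm => //.
  by apply: bounded_measB => //; exact: bounded_meas_cst.
move=> r rin; have r0 := in0 en0 rin; move: rin; rewrite in_itv/= => /andP[r1 r2].
rewrite distrC /F0 -th_n; apply: le_trans (FXL _ r0 en0) _.
rewrite mulrC ler_wpM2r ?mulr_ge0// ger0_norm ?subr_ge0//.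
by rewrite -[leRHS](step_length e n) lerB.
Qed.

Lemma lap_sum n :
  `|mxint 0 (e * S_ n) phi - mxint 0 (e * n%:R) (fun r => F (X (th r)) (Q r))|
  <= n%:R * (e ^+ 2 * c2).
Proof.
elim: n => [|n IH].
  by rewrite birkhoff_sum0 !mulr0 mul0r !mxint_xx subrr normr0.
have eS0 j : 0 <= e * S_ j.
  apply: mulr_ge0; first exact: ltW.
  by have := birkhoff_sum_ge T tauB j y; apply: le_trans; rewrite mulr_ge0// ltW.
rewrite (@mxint_split _ _ _ 0 (e * S_ n) (e * S_ n.+1))//; last 2 first.
- by rewrite ler_wpM2l ?(birkhoff_sum_le T tau1_gt0 tauB)// ltW.
- exact: bphi.
rewrite (@mxint_split _ _ _ 0 (e * n%:R) (e * n.+1%:R))//; last 3 first.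
- exact: step_ge0.
- exact: step_le.
- exact: bounded_meas_FX.
rewrite opprD addrACA; apply: le_trans (ler_normD _ _) _.
by apply: le_trans (lerD IH (lap_step n)) _; rewrite -[X in _ + X]mul1r -mulrDl natr1.
Qed.

Local Notation N t := (lap (t / e) y).

Lemma slow_lap_bound t : 0 <= t -> e * (N t)%:R <= t / tau1.
Proof.
move=> t0; have te : 0 <= t / e by rewrite divr_ge0// ltW.
have := lap_bound T tau1_gt0 tauB y te; rewrite ler_pdivlMr// => h.
by rewrite ler_pdivlMr// -mulrA mulrC.
Qed.

Lemma clock_lap t : 0 <= t -> th (e * (N t)%:R) <= t < th (e * (N t)%:R) + e * tau2.
Proof.
move=> t0; have te : 0 <= t / e by rewrite divr_ge0// ltW.
rewrite (clock_grid T tau1_gt0 tauB e0).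
have /andP[h1 h2] := lapP T tau1_gt0 tauB y te.
have tE : t = e * (t / e) by rewrite mulrC divfK// gt_eqF.
rewrite -mulrDr [X in _ <= X]tE [X in X < _]tE ler_pM2l// ltr_pM2l// h1/=.
apply: lt_le_trans h2 _; rewrite birkhoff_sumSr lerD2l.
by have /andP[] := tauB (iter (N t) T y).
Qed.

Local Notation c3 S := (c2 * (S / tau1) + Cf * tau2).

Let c20 : 0 <= c2. Proof. by rewrite addr_ge0 ?mulr_ge0. Qed.

(** There are [O(1 / e)] complete laps, each with an error [O(e ^+ 2)]; the last,
   incomplete one contributes [O(e)]. *)
Lemma lap_integral S t : 0 <= t <= S ->
  `|mxint 0 t phi - mxint 0 (e * (N t)%:R) (fun r => F (X (th r)) (Q r))| <= e * c3 S.
Proof.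
move=> /andP[t0 tS]; have /andP[h1 h2] := clock_lap t0.
have en0 := step_ge0 e0 (N t).
have eS : th (e * (N t)%:R) = e * S_ (N t) by exact: (clock_grid T tau1_gt0 tauB e0).
rewrite (@mxint_split _ _ _ 0 (th (e * (N t)%:R)) t)//; last 2 first.
- exact: th0.
- exact: bphi.
rewrite addrAC; apply: le_trans (ler_normD _ _) _; rewrite mulrDr; apply: lerD.
  rewrite eS; apply: le_trans (lap_sum _) _.
  have -> : (N t)%:R * (e ^+ 2 * c2) = e * c2 * (e * (N t)%:R) by ring.
  rewrite [leRHS]mulrA ler_wpM2l ?mulr_ge0//; first exact: ltW.
  apply: le_trans (slow_lap_bound t0) _; rewrite ler_wpM2r// invr_ge0; exact: ltW.
apply: (@le_trans _ _ (Cf * (t - th (e * (N t)%:R)))).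
  apply: mxint_norm => //; first exact: bphi (th0 en0).
  by move=> s _; exact: fC.
by rewrite mulrCA ler_wpM2l// lerBlDl ltW.
Qed.

(** With [k = a e / e] this is the process [v^e] of the theorem after the change of
   variable [r = e * u], and [dfluctuation] is the integrand of its linearisation
   in the space variable. *)
Definition fluctuation s := k *: mxint 0 s (fun r => F (w r) (Q r)).
Definition dfluctuation r := k *: 'J (roof_integral tau f ^~ (Q r)) (w r).

Local Notation vs := fluctuation.
Local Notation Js := dfluctuation.
Let H r := X (th r) - w r.
Let Qd r := F (X (th r)) (Q r) - F (w r) (Q r) - H r *m 'J (roof_integral tau f ^~ (Q r)) (w r).
Local Notation LH := (CX * tau2 + taubar * C).
Let LH0 : 0 <= LH. Proof. by rewrite addr_ge0// mulr_ge0// ltW. Qed.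

Let HL s t : 0 <= s -> 0 <= t -> `|H s - H t| <= LH * `|s - t|.
Proof.
move=> s0 t0; rewrite /H opprD addrACA -opprD; apply: le_trans (ler_normB _ _) _.
rewrite mulrDl; apply: lerD; last exact: wL.
by apply: le_trans (XL (th0 s0) (th0 t0)) _; rewrite -mulrA ler_wpM2l// thL.
Qed.

Let H0 : H 0 = 0. Proof. by rewrite /H clock0 X0 mulr0 W0 subrr. Qed.

Let Hbd s : 0 <= s -> `|H s| <= LH * s.
Proof. by move=> s0; have := HL s0 (lexx 0); rewrite H0 !subr0 [`|s|]ger0_norm. Qed.

Let bH a b : 0 <= a -> bounded_meas a b H.
Proof.
move=> a0; apply: (@lipschitz_bounded_meas _ _ _ _ _ LH) => s t sab tab.
by apply: HL; [exact: in0 sab|exact: in0 tab].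
Qed.

Let bQd a b : 0 <= a -> bounded_meas a b Qd.
Proof.
move=> a0; apply: bounded_measB.
  by apply: bounded_measB; [exact: bounded_meas_FX|exact: bounded_meas_Fw].
by apply: bounded_measM; [exact: bH|exact: bounded_meas_Jw].
Qed.

Let QdB r : `|Qd r| <= d%:R * C * `|H r| ^+ 2.
Proof. exact: (C2_bounded_taylor (F_C2 (Q r))). Qed.

Lemma bounded_meas_dfluctuation a b : 0 <= a -> bounded_meas a b Js.
Proof. by move=> a0; apply: bounded_measZc; exact: bounded_meas_Jw. Qed.

Let fbarE r := fbar (X r) - fbar (W r).
Let bfbarE a b : 0 <= a -> bounded_meas a b fbarE.
Proof.
move=> a0; apply: bounded_measB; last first.
  apply: (@lipschitz_bounded_meas _ _ _ _ _ (d%:R * C * C)) => s t sab tab.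
  apply: le_trans (bL _ _) _; rewrite -[leRHS]mulrA ler_wpM2l//.
  by apply: WL; [exact: in0 sab|exact: in0 tab].
exact: (driven_bounded_meas_fbar bL dC0 XE).
Qed.

(** Taylor expansion of [F] at the averaged path [w], along the orbit: order zero is
   the fluctuation, order one is the integral of the displacement [H] against the
   linearised fluctuation, and [Qd] is the quadratic remainder. *)
Lemma error_decomposition S t : 0 <= t <= S ->
  exists2 err : 'rV[R]_d, `|err| <= k * e * c3 S &
  k *: (X t - W t) = vs (e * (N t)%:R) +
    mxint 0 (e * (N t)%:R) (fun r => H r *m Js r) +
    k *: mxint 0 (e * (N t)%:R) Qd + k *: mxint 0 t fbarE + err.
Proof.
move=> /[dup] tS /andP[t0 _]; have en0 := step_ge0 e0 (N t).
set n := e * (N t)%:R in en0 *.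
exists (k *: (mxint 0 t phi - mxint 0 n (fun r => F (X (th r)) (Q r)))).
  by rewrite normrZ gtr0_norm// -mulrA ler_wpM2l ?(lap_integral tS)// ltW.
have XtE : X t = x + (mxint 0 t phi + mxint 0 t (fun r => fbar (X r))).
  rewrite (proj2 XE t t0); congr (_ + _); apply: mxintD; first exact: bphi.
  exact: (driven_bounded_meas_fbar bL dC0 XE).
have WtE : W t = x + mxint 0 t (fun r => fbar (W r)).
  rewrite -{1}W0; apply: (ode_solution_mxint _ W_ode (lexx 0) t0).
  exact: (lipschitz_setT_continuous dC0 bL).
have bfW : bounded_meas 0 t (fun r => fbar (W r)).
  apply: (@lipschitz_bounded_meas _ _ _ _ _ (d%:R * C * C)) => s u sab uab.
  apply: le_trans (bL _ _) _; rewrite -[leRHS]mulrA ler_wpM2l//.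
  by apply: WL; [exact: in0 sab|exact: in0 uab].
have fbarEE : mxint 0 t fbarE = mxint 0 t (fun r => fbar (X r)) - mxint 0 t (fun r => fbar (W r)).
  by rewrite -mxintB//; exact: (driven_bounded_meas_fbar bL dC0 XE).
have HJE : mxint 0 n (fun r => H r *m Js r) =
    k *: mxint 0 n (fun r => H r *m 'J (roof_integral tau f ^~ (Q r)) (w r)).
  rewrite -mxintZ; last by apply: bounded_measM; [exact: bH|exact: bounded_meas_Jw].
  by apply: eq_mxint => r _; rewrite -scalemxAr.
have QdE : mxint 0 n Qd = mxint 0 n (fun r => F (X (th r)) (Q r)) - mxint 0 n (fun r => F (w r) (Q r))
    - mxint 0 n (fun r => H r *m 'J (roof_integral tau f ^~ (Q r)) (w r)).
  rewrite -mxintB; [|exact: bounded_meas_FX|exact: bounded_meas_Fw].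
  rewrite -mxintB//; last by apply: bounded_measM; [exact: bH|exact: bounded_meas_Jw].
  by apply: bounded_measB; [exact: bounded_meas_FX|exact: bounded_meas_Fw].
rewrite HJE QdE fbarEE XtE WtE /fluctuation.
move: (mxint 0 n _) (mxint 0 n _) (mxint 0 n _) (mxint 0 t _) (mxint 0 t _) (mxint 0 t _) => a b c a' b' c'.
by apply/matrixP => i j; rewrite !mxE; ring.
Qed.

Let HE r : 0 <= r -> `|H r| <= `|X (th r) - W (th r)| + `|W (th r) - w r|.
Proof. by move=> r0; rewrite /H -(subrKA (W (th r))); exact: ler_normD. Qed.

Let QdB2 r zeta : 0 <= r -> `|W (th r) - w r| <= zeta ->
  `|Qd r| <= d%:R * C * (2 * `|X (th r) - W (th r)| ^+ 2 + 2 * zeta ^+ 2).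
Proof.
move=> r0 rz; apply: le_trans (QdB r) _; rewrite ler_wpM2l//.
have h : `|H r| <= `|X (th r) - W (th r)| + zeta by apply: le_trans (HE r0) _; rewrite lerD2l.
apply: (@le_trans _ _ ((`|X (th r) - W (th r)| + zeta) ^+ 2)).
  by rewrite ler_sqr// nnegrE// (le_trans _ h).
by have := sqr_ge0 (`|X (th r) - W (th r)| - zeta); lra.
Qed.

Let XWL t : 0 <= t -> `|X t - W t| <= (CX + C) * t.
Proof.
move=> t0; have -> : X t - W t = (X t - X 0) - (W t - W 0).
  by rewrite X0 W0 opprB addrA subrK.
apply: le_trans (ler_normB _ _) _; rewrite mulrDl; apply: lerD.
  by apply: le_trans (XL t0 (lexx 0)) _; rewrite subr0 ger0_norm.
by apply: le_trans (WL t0 (lexx 0)) _; rewrite subr0 ger0_norm.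
Qed.

Let bE a b : 0 <= a -> bounded_meas a b (fun r => X r - W r).
Proof.
move=> a0; apply: bounded_measB; first exact: bX.
apply: (@lipschitz_bounded_meas _ _ _ _ _ C) => s t sab tab.
by apply: WL; [exact: in0 sab|exact: in0 tab].
Qed.

Definition apriori_rate S := 8 * (d%:R * C) * ((CX + C) * S) / tau1 + 4 * (d%:R * C) + 1.

Definition apriori_data S B delta :=
  B + d%:R * ((S / tau1 / delta + 1) * (LH * (S / tau1)) + LH * (S / tau1))
  + 2 * (d%:R * C) * (S / tau1) + c3 S.

Lemma apriori_data_ge0 S B delta : 0 <= S -> 0 <= B -> 0 < delta -> 0 <= apriori_data S B delta.
Proof.
move=> S0 B0 d0; have S'0 : 0 <= S / tau1 by rewrite divr_ge0// ltW.
have h1 : 0 <= S / tau1 / delta + 1 by rewrite addr_ge0// divr_ge0// ltW.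
have h2 : 0 <= LH * (S / tau1) by exact: mulr_ge0.
have h3 : 0 <= c2 * (S / tau1) by exact: mulr_ge0.
apply: addr_ge0; last by apply: addr_ge0 => //; exact: mulr_ge0.
apply: addr_ge0; last by apply: mulr_ge0 => //; exact: mulr_ge0.
by apply: addr_ge0 => //; apply: mulr_ge0 => //; apply: addr_ge0 => //; exact: mulr_ge0.
Qed.

Let slow_le S t : 0 <= t <= S -> 0 <= e * (N t)%:R <= S / tau1.
Proof.
move=> /andP[t0 tS]; rewrite (step_ge0 e0)/=.
apply: le_trans (slow_lap_bound t0) _; rewrite ler_wpM2r// invr_ge0; exact: ltW.
Qed.

(** The quadratic term and the averaged drift are contractions for the weight
    [expR (K * t)] because the clock runs at speed at least [tau1]; the term that
    is linear in the error is bounded crudely, the error being Lipschitz and the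
    oscillation of the linearised fluctuation being under control. *)
Lemma apriori_bound S B delta zeta :
  0 <= S -> 0 <= B -> 0 < delta -> 0 <= zeta -> k * zeta ^+ 2 <= 1 -> k * e <= 1 ->
  (forall s, 0 <= s <= S / tau1 -> `|vs s| <= B) ->
  (forall s, 0 <= s <= S / tau1 -> `|W (th s) - w s| <= zeta) ->
  (forall p q, 0 <= p -> p <= q -> q <= S / tau1 -> q - p <= delta -> `|mxint p q Js| <= 1) ->
  forall t, 0 <= t <= S ->
    k * `|X t - W t| <= 2 * apriori_data S B delta * expR (apriori_rate S * t).
Proof.
move=> S0 B0 d0 z0 kz ke vB zB osc.
set A := apriori_data S B delta; set K := apriori_rate S.
have A0 : 0 <= A by exact: apriori_data_ge0.
have S'0 : 0 <= S / tau1 by rewrite divr_ge0// ltW.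
have CS0 : 0 <= (CX + C) * S by rewrite mulr_ge0// addr_ge0.
have K1 : 1 <= K.
  rewrite lerDr addr_ge0//; last exact: mulr_ge0.
  by apply: divr_ge0; [apply: mulr_ge0 => //; exact: mulr_ge0|exact: ltW].
have K0 : 0 < K by exact: lt_le_trans K1.
apply: (@weighted_gronwall _ _ S A (k * ((CX + C) * S)) K A0) => [||t /andP[t0 tS]|m t m0 tS um].
- by rewrite mulr_ge0// ltW.
- exact: ltW.
- rewrite ler_wpM2l//; first exact: ltW.
  by apply: le_trans (XWL t0) _; rewrite ler_wpM2l// addr_ge0.
have /andP[t0 tS'] := tS; have /andP[n0 nS] := slow_le tS.
have [err errB E] := error_decomposition tS.
set n := e * (N t)%:R in n0 nS E.
have /andP[nt _] := clock_lap t0.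
have thr r : 0 <= r <= n -> th r <= t - tau1 * n + tau1 * r.
  move=> /andP[r0 rn]; have := clock_ge T tau1_gt0 tauB e0 y r0 rn.
  by move: nt; rewrite -/n; lra.
have cth r : 0 <= r <= n -> 0 <= th r <= t.
  move=> /[dup] rn /andP[r0 rn']; rewrite th0//=; apply: le_trans nt.
  exact: (clock_homo T tau1_gt0 tauB).
have inn r : r \in `[0, n] -> 0 <= r <= n by rewrite in_itv.
have t1 : `|mxint 0 n (fun r => H r *m Js r)| <=
    d%:R * ((S / tau1 / delta + 1) * (LH * (S / tau1)) + LH * (S / tau1)).
  have := @mxint_block_bound _ _ _ _ H Js (S / tau1) LH (LH * (S / tau1)) 1 delta LH0 ler01.
  rewrite !mulr1 => h; apply: h => //; [exact: mulr_ge0| | | |by rewrite n0].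
  - by move=> s u sS uS; apply: HL; [exact: in0 sS|exact: in0 uS].
  - move=> s; rewrite in_itv/= => /andP[s0 sS]; apply: le_trans (Hbd s0) _.
    by rewrite ler_wpM2l.
  - exact: bounded_meas_dfluctuation.
have t2 : `|k *: mxint 0 n Qd| <= m / 4 * expR (K * t) + 2 * (d%:R * C) * (S / tau1).
  rewrite -mxintZ; last exact: bQd.
  pose M' := 2 * (d%:R * C) * ((CX + C) * S) * (m * expR (K * (t - tau1 * n))).
  have M'0 : 0 <= M' by rewrite mulr_ge0// mulr_ge0// mulr_ge0.
  apply: (@le_trans _ _ (M' / (K * tau1) * expR (K * tau1 * n) + 2 * (d%:R * C) * (n - 0))).
    apply: mxint_norm_expD => //; first by rewrite mulr_gt0.
      by apply: bounded_measZc; exact: bQd.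
    move=> r /inn rn; have /andP[r0 _] := rn.
    rewrite normrZ gtr0_norm//.
    have rS' : 0 <= r <= S / tau1 by move/andP: rn => [-> /le_trans ->].
    have h1 := QdB2 r0 (zB _ rS').
    have /andP[th1 th2] := cth _ rn.
    have h2 : k * `|X (th r) - W (th r)| <= m * expR (K * (t - tau1 * n)) * expR (K * tau1 * r).
      apply: le_trans (um _ (cth _ rn)) _; rewrite -mulrA ler_wpM2l// -expRD ler_expR.
      by rewrite -mulrA -mulrDr ler_wpM2l ?thr// ltW.
    have h3 : `|X (th r) - W (th r)| <= (CX + C) * S.
      by apply: le_trans (XWL th1) _; rewrite ler_wpM2l ?addr_ge0// (le_trans th2).
    apply: (@le_trans _ _ (d%:R * C * (2 * (`|X (th r) - W (th r)| * (k * `|X (th r) - W (th r)|)) + 2 * (k * zeta ^+ 2)))).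
      rewrite (_ : d%:R * C * _ = k * (d%:R * C * (2 * `|X (th r) - W (th r)| ^+ 2 + 2 * zeta ^+ 2))); last by ring.
      by rewrite ler_wpM2l// ltW.
    rewrite (_ : M' * _ + _ = d%:R * C * (2 * (((CX + C) * S) * (m * expR (K * (t - tau1 * n)) * expR (K * tau1 * r))) + 2 * 1)); last by rewrite /M'; ring.
    rewrite ler_wpM2l// lerD// ler_wpM2l// ler_pM// mulr_ge0//; exact: ltW.
  rewrite subr0; apply: lerD; last by rewrite ler_wpM2l// mulr_ge0.
  have -> : M' / (K * tau1) * expR (K * tau1 * n) =
      (2 * (d%:R * C) * ((CX + C) * S) / tau1 / K) * (m * expR (K * t)).
    rewrite (_ : expR (K * t) = expR (K * (t - tau1 * n)) * expR (K * tau1 * n)); last first.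
      by rewrite -expRD; congr expR; ring.
    by rewrite /M'; field; rewrite !gt_eqF.
  rewrite (_ : m / 4 * _ = 4^-1 * (m * expR (K * t))); last by ring.
  rewrite ler_wpM2r ?mulr_ge0 ?expR_ge0// ler_pdivrMr//.
  have h : 0 <= 4 * (d%:R * C) + 1 by apply: addr_ge0 => //; exact: mulr_ge0.
  rewrite /K /apriori_rate; move: tau1^-1 => i1; lra.
have t3 : `|k *: mxint 0 t fbarE| <= m / 4 * expR (K * t).
  rewrite -mxintZ; last exact: bfbarE.
  have M'0 : 0 <= d%:R * C * m by rewrite mulr_ge0.
  apply: (@le_trans _ _ (d%:R * C * m / K * expR (K * t) + 0 * (t - 0))).
    apply: mxint_norm_expD => //; first by apply: bounded_measZc; exact: bfbarE.
    move=> r; rewrite in_itv/= => rt; rewrite normrZ gtr0_norm// addr0.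
    have := um _ rt; move=> h; rewrite -mulrA.
    apply: (@le_trans _ _ (d%:R * C * (k * `|X r - W r|))); last by rewrite ler_wpM2l.
    by rewrite [leRHS]mulrCA ler_wpM2l ?bL// ltW.
  rewrite mul0r addr0 ler_wpM2r ?expR_ge0// ler_pdivrMr//.
  have K4 : 4 * (d%:R * C) <= K.
    rewrite /K /apriori_rate addrAC lerDr addr_ge0//.
    by apply: divr_ge0; [apply: mulr_ge0 => //; exact: mulr_ge0|exact: ltW].
  by have := ler_wpM2l m0 K4; lra.
have t4 : `|err| <= c3 S.
  apply: le_trans errB _; rewrite -[leRHS]mul1r ler_wpM2r//.
  by rewrite addr_ge0// mulr_ge0.
have t0' : `|vs n| <= B by apply: vB; rewrite n0.
have -> : k * `|X t - W t| = `|k *: (X t - W t)| by rewrite normrZ gtr0_norm.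
rewrite E; apply: le_trans (ler_normD _ _) _.
have {}t3 := le_trans (ler_normD _ _) (lerD (le_trans (ler_normD _ _) (lerD (le_trans (ler_normD _ _) (lerD t0' t1)) t2)) t3).
apply: le_trans (lerD t3 t4) _.
by rewrite /A /apriori_data; lra.
Qed.

Local Notation LR := (linear_response (fun u => 'J fbar (W u)) (fun s => vs (s / taubar))).

Definition residual S delta eta zeta K :=
  eta + d%:R * ((S / tau1 / delta + 1) * ((K / k + zeta) * eta) + LH * eta * (S / tau1)) +
  d%:R * C * (S / tau1) * (2 * (K ^+ 2 / k) + 2 * (k * zeta ^+ 2)) +
  d%:R * C * S * (K ^+ 2 / k) + k * e * c3 S.

(** With the error already known to be of order [k^-1], every term but the
    fluctuation itself and the linearised drift is negligible, so that the
    normalised error solves the linear equation up to [residual]. *)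
Lemma error_linear_response S delta eta zeta K :
  0 <= S -> 0 < delta -> 0 <= eta -> 0 <= zeta -> 0 <= K ->
  (forall t, 0 <= t <= S -> k * `|X t - W t| <= K) ->
  (forall t, 0 <= t <= S -> `|vs (e * (N t)%:R) - vs (t / taubar)| <= eta) ->
  (forall s, 0 <= s <= S / tau1 -> `|W (th s) - w s| <= zeta) ->
  (forall p q, 0 <= p -> p <= q -> q <= S / tau1 -> q - p <= delta -> `|mxint p q Js| <= eta) ->
  forall t, 0 <= t <= S ->
    `|k *: (X t - W t) - LR t| <=
      2 * residual S delta eta zeta K * expR ((2 * (d%:R * C) + 1) * t).
Proof.
move=> S0 d0 eta0 z0 K0 EK vN zB osc.
have S'0 : 0 <= S / tau1 by rewrite divr_ge0// ltW.
have Kk0 : 0 <= K ^+ 2 / k by apply: divr_ge0; [exact: sqr_ge0|exact: ltW].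
have EK' t : 0 <= t <= S -> `|X t - W t| <= K / k by move=> tS; rewrite ler_pdivlMr// mulrC EK.
have EKk t : 0 <= t <= S -> k * `|X t - W t| ^+ 2 <= K ^+ 2 / k.
  move=> tS; rewrite !expr2 mulrA -[leRHS]mulrA ler_pM//; [by rewrite mulr_ge0// ltW|exact: EK|exact: EK'].
pose A u := 'J fbar (W u); pose V s := vs (s / taubar); pose yy t := k *: (X t - W t).
have bA : bounded_meas 0 S A.
  apply: (@lipschitz_bounded_meas _ _ _ _ _ (C * C)) => s t sS tS.
  apply: le_trans (C2_bounded_jacobian_lipschitz fbar_C2 _ _) _; rewrite -mulrA ler_wpM2l//.
  by apply: WL; [exact: in0 sS|exact: in0 tS].
have AC r : r \in `[0, S] -> `|A r| <= C by move=> _; have [_ _ _ h _] := fbar_C2; exact: h.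
have bV : bounded_meas 0 S V.
  apply: (@lipschitz_bounded_meas _ _ _ _ _ (k * C / taubar)) => s t sS tS.
  wlog st : s t sS tS / s <= t.
    move=> Hw; case: (leP s t) => [h|/ltW h]; first exact: Hw.
    by rewrite distrC [`|s - t|]distrC; exact: Hw.
  have s0 := in0 (lexx 0) sS; have t0 := in0 (lexx 0) tS.
  have s0' : 0 <= s / taubar by rewrite divr_ge0// ltW.
  have st' : s / taubar <= t / taubar by rewrite ler_wpM2r// invr_ge0 ltW.
  rewrite /V /fluctuation (@mxint_split _ _ _ 0 (s / taubar) (t / taubar))//; last exact: bounded_meas_Fw.
  rewrite scalerDr opprD addrA subrr add0r normrN normrZ gtr0_norm// -!mulrA ler_wpM2l//; first exact: ltW.
  rewrite distrC ger0_norm ?subr_ge0// [taubar^-1 * _]mulrC mulrBl.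
  by apply: mxint_norm => //; exact: bounded_meas_Fw.
have byy : bounded_meas 0 S yy by apply: bounded_measZc; exact: bE.
have [B1 B1B] := (bounded_meas_linear_response bA AC C0 bV).2.
have r0 : 0 <= residual S delta eta zeta K.
  have h1 : 0 <= S / tau1 / delta + 1 by rewrite addr_ge0// divr_ge0// ltW.
  have h2 : 0 <= K / k + zeta by rewrite addr_ge0// divr_ge0// ltW.
  have h3 : 0 <= k * zeta ^+ 2 by rewrite mulr_ge0// ?sqr_ge0// ltW.
  have h4 : 0 <= c3 S by apply: addr_ge0; exact: mulr_ge0.
  apply: addr_ge0; last by apply: mulr_ge0 => //; rewrite mulr_ge0// ltW.
  apply: addr_ge0; last by apply: mulr_ge0 => //; exact: mulr_ge0.
  apply: addr_ge0; last by apply: mulr_ge0; [exact: mulr_ge0|apply: addr_ge0; exact: mulr_ge0].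
  apply: addr_ge0 => //; apply: mulr_ge0 => //; apply: addr_ge0.
    by apply: mulr_ge0 => //; exact: mulr_ge0.
  by apply: mulr_ge0 => //; exact: mulr_ge0.
apply: (@linear_response_stable _ _ A S C bA AC C0 V yy (K + `|B1|)) => //.
- exact: addr_ge0.
- move=> t tS; apply: le_trans (ler_normB _ _) _; apply: lerD.
    by rewrite normrZ gtr0_norm// EK.
  by apply: le_trans (ler_norm _); apply: B1B; rewrite in_itv.
move=> t tS; have /andP[t0 tS'] := tS; have /andP[n0 nS] := slow_le tS.
have [err errB E] := error_decomposition tS.
have vN' := vN _ tS.
set n := e * (N t)%:R in n0 nS E vN'.
have /andP[nt _] := clock_lap t0.
have inn r : r \in `[0, n] -> 0 <= r <= n by rewrite in_itv.
have cth r : 0 <= r <= n -> 0 <= th r <= S.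
  move=> /[dup] rn /andP[q0 rn']; rewrite th0//=; apply: le_trans tS'; apply: le_trans nt.
  exact: (clock_homo T tau1_gt0 tauB).
have rnS r : 0 <= r <= n -> 0 <= r <= S / tau1 by move=> /andP[-> /le_trans ->].
have t1 : `|mxint 0 n (fun r => H r *m Js r)| <=
    d%:R * ((S / tau1 / delta + 1) * ((K / k + zeta) * eta) + LH * eta * (S / tau1)).
  have n01 : n / delta + 1 <= S / tau1 / delta + 1.
    by rewrite lerD2r ler_wpM2r// invr_ge0 ltW.
  apply: (@le_trans _ _ (d%:R * ((n / delta + 1) * ((K / k + zeta) * eta) + LH * eta * n))).
    apply: mxint_block_bound => //.
    - by apply: addr_ge0 => //; apply: divr_ge0 => //; exact: ltW.
    - by move=> s u sS uS; apply: HL; [exact: in0 sS|exact: in0 uS].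
    - move=> s /inn sn; have /andP[s0 _] := sn.
      apply: le_trans (HE s0) _; apply: lerD; last exact: zB (rnS _ sn).
      exact: EK' (cth _ sn).
    - exact: bounded_meas_dfluctuation.
    - by move=> p q p0 pq qn; apply: osc => //; exact: le_trans nS.
    - by rewrite n0 lexx.
  rewrite ler_wpM2l//; apply: lerD; last by rewrite ler_wpM2l// mulr_ge0.
  by rewrite ler_wpM2r// mulr_ge0// addr_ge0// divr_ge0// ltW.
have t2 : `|k *: mxint 0 n Qd| <=
    d%:R * C * (S / tau1) * (2 * (K ^+ 2 / k) + 2 * (k * zeta ^+ 2)).
  rewrite -mxintZ; last exact: bQd.
  apply: (@le_trans _ _ (d%:R * C * (2 * (K ^+ 2 / k) + 2 * (k * zeta ^+ 2)) * (n - 0))).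
    apply: mxint_norm => //; first by apply: bounded_measZc; exact: bQd.
    move=> r /inn rn; have /andP[q0 _] := rn.
    rewrite normrZ gtr0_norm//.
    apply: (@le_trans _ _ (k * (d%:R * C * (2 * `|X (th r) - W (th r)| ^+ 2 + 2 * zeta ^+ 2)))).
      by apply: ler_wpM2l; [exact: ltW|apply: QdB2 => //; exact: zB (rnS _ rn)].
    rewrite mulrCA ler_wpM2l// mulrDr mulrCA [k * (2 * _)]mulrCA lerD2r ler_wpM2l//.
    exact: EKk (cth _ rn).
  rewrite subr0 mulrAC ler_wpM2r//; last by rewrite ler_wpM2l.
  by apply: addr_ge0; apply: mulr_ge0 => //; rewrite mulr_ge0 ?sqr_ge0// ltW.
pose D r := yy r *m A r.
have bD : bounded_meas 0 t D.
  by apply: bounded_measS (lexx 0) tS' _; exact: bounded_measM.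
have t3 : `|k *: mxint 0 t fbarE - mxint 0 t D| <= d%:R * C * S * (K ^+ 2 / k).
  have bfb : bounded_meas 0 t (fun r => k *: fbarE r) by apply: bounded_measZc; exact: bfbarE.
  rewrite -mxintZ; last exact: bfbarE.
  rewrite -mxintB//; apply: (@le_trans _ _ (d%:R * C * (K ^+ 2 / k) * (t - 0))).
    apply: mxint_norm => //; first exact: bounded_measB.
    move=> r; rewrite in_itv/= => /andP[q0 rt].
    rewrite /D /yy -scalemxAl -scalerBr normrZ gtr0_norm//.
    apply: (@le_trans _ _ (k * (d%:R * C * `|X r - W r| ^+ 2))).
      by apply: ler_wpM2l; [exact: ltW|exact: (C2_bounded_taylor fbar_C2)].
    by rewrite mulrCA ler_wpM2l// EKk// q0 (le_trans rt).
  by rewrite subr0 mulrAC ler_wpM2r// ler_wpM2l.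
rewrite -/(V t) in vN'.
have -> : yy t - (V t + mxint 0 t D) =
    (vs n - V t) + mxint 0 n (fun r => H r *m Js r) + k *: mxint 0 n Qd +
    (k *: mxint 0 t fbarE - mxint 0 t D) + err.
  rewrite /yy E; move: (vs n) (V t) (mxint 0 n (fun r => H r *m Js r)) (k *: mxint 0 n Qd) (k *: mxint 0 t fbarE) (mxint 0 t D) => a1 a2 a3 a4 a5 a6.
  by apply/matrixP => i j; rewrite !mxE; ring.
apply: le_trans (ler_normD _ _) _; rewrite /residual; apply: lerD => //.
apply: le_trans (ler_normD _ _) _; apply: lerD => //.
apply: le_trans (ler_normD _ _) _; apply: lerD => //.
by apply: le_trans (ler_normD _ _) _; exact: lerD.
Qed.

End error.

(** * Random continuous paths *)

Section at_right.
Context {R : realType}.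

Lemma near_right0P (Q : R -> Prop) : (\forall e \near 0^'+, Q e) <->
  exists2 r, 0 < r & forall e, 0 < e -> e < r -> Q e.
Proof.
split=> [[r /= r0 h]|[r r0 h]].
  by exists r => // e e0 er; apply: h => //=; rewrite sub0r normrN gtr0_norm.
near=> e; apply: h => //; near: e; exact: nbhs_right_lt.
Unshelve. all: by end_near. Qed.

End at_right.

Section paths.
Context {R : realType} (V : normedModType R) (S : R).
Local Notation C := (@cpaths R V S).
Local Notation close e h h' := (forall t, t \in `[0, S] -> `|h t - h' t| <= e).

Lemma cpathsP (h : R -> V) : C h <-> forall s e, s \in `[0, S] -> 0 < e ->
  exists2 r, 0 < r & forall t, t \in `[0, S] -> `|s - t| < r -> `|h s - h t| < e.
Proof.
split=> [ch s e sS e0|H].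
  have /subspace_continuousP/(_ s sS)/cvgrPdist_lt/(_ e e0) := ch.
  by move=> [r /= r0 hr]; exists r => // t tS st; exact: hr.
apply/subspace_continuousP => s sS; apply/cvgrPdist_lt => e e0.
by have [r r0 hr] := H s e sS e0; exists r => //= t st tS; exact: hr.
Qed.

Lemma cpaths_uniform (h : R -> V) e : C h -> 0 < e ->
  exists2 r, 0 < r & forall s t, s \in `[0, S] -> t \in `[0, S] -> `|s - t| <= r ->
    `|h s - h t| <= e.
Proof.
move=> /cpathsP ch e0; have /compact_near_coveringP := @segment_compact R 0 S.
move=> /(_ R 0^'+ (fun r s => s \in `[0, S] -> forall t, t \in `[0, S] -> `|s - t| <= r ->
  `|h s - h t| <= e) _).
case=> [s sS|r /= r0 H]; last first.
  exists (r / 2); first by rewrite divr_gt0.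
  move=> s t sS tS st; apply: (H (r / 2)) => //=; last by rewrite divr_gt0.
  by rewrite sub0r normrN gtr0_norm ?divr_gt0// ltr_pdivrMr// mulr_natr mulr2n ltrDl.
have e2 : 0 < e / 2 by rewrite divr_gt0.
have [r r0 H] := ch s (e / 2) sS e2.
exists (ball s (r / 2), [set d | 0 < d < r / 2]) => /=.
  split; first by apply: nbhsx_ballx; rewrite divr_gt0.
  by apply/near_right0P; exists (r / 2) => [|d d0 dr /=]; rewrite ?divr_gt0// d0.
move=> [s' d] /= [ss' /andP[d0 dr]] s'S t tS s't.
rewrite /ball/= in ss'.
have h1 : `|h s - h s'| < e / 2.
  by apply: H => //; apply: lt_trans ss' _; rewrite ltr_pdivrMr// mulr_natr mulr2n ltrDl.
have h2 : `|h s - h t| < e / 2.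
  apply: H => //; rewrite -(subrKA s') (le_lt_trans (ler_normD _ _))//.
  by rewrite [ltRHS]splitr ltrD// (le_lt_trans s't).
rewrite -(subrKA (h s)) (le_trans (ler_normD _ _))// [leRHS]splitr lerD// ?ltW//.
by rewrite distrC.
Qed.

Lemma cpaths_bounded (h : R -> V) : C h -> exists B, forall t, t \in `[0, S] -> `|h t| <= B.
Proof.
move=> ch; have := compact_bounded (continuous_compact ch (segment_compact (a := 0) (b := S))).
move=> [B [_ HB]]; exists (B + 1) => t tS; apply: (HB (B + 1)); first by rewrite ltrDl.
by exists t.
Qed.

Lemma path_nbhsP (h : {uniform` `[0, S] -> V}) (Q : set (R -> V)) :
  nbhs h Q <-> exists2 e, 0 < e & forall h', close e h h' -> Q h'.
Proof.
split=> [/uniform_nbhs[E [entE EQ]]|[e e0 H]].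
  move: entE; rewrite -entourage_ballE => -[e /= e0 eE].
  exists (e / 2); first by rewrite divr_gt0.
  move=> h' hh'; apply: EQ => t tS; apply: eE; rewrite /= -ball_normE/=.
  by apply: le_lt_trans (hh' t tS) _; rewrite ltr_pdivrMr// mulr_natr mulr2n ltrDl.
apply/uniform_nbhs; exists [set xy | ball xy.1 e xy.2]; split.
  by rewrite -entourage_ballE; exists e.
move=> h' hh'; apply: H => t tS; apply: ltW.
by have := hh' t tS; rewrite /= -ball_normE.
Qed.

Lemma path_continuousP (W : normedModType R) (g : {uniform` `[0, S] -> V} -> W) :
  {within C, continuous g} <-> (forall h e, C h -> 0 < e ->
    exists2 r, 0 < r & forall h', C h' -> close r h h' -> `|g h - g h'| < e).
Proof.
split=> [cg h e Ch e0|H].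
  have /subspace_continuousP/(_ h Ch)/cvgrPdist_lt/(_ e e0) := cg.
  by move=> /path_nbhsP[r r0 hr]; exists r => // h' Ch' hh'; exact: hr.
apply/subspace_continuousP => h Ch; apply/cvgrPdist_lt => e e0.
have [r r0 hr] := H h e Ch e0; apply/path_nbhsP; exists r => // h' hh' Ch'.
exact: hr.
Qed.

Definition path_lipschitz (L : R) (g : (R -> V) -> R) := forall h h' e, C h -> C h' ->
  0 <= e -> close e h h' -> `|g h - g h'| <= L * e.

Lemma path_lipschitz_continuous L (g : {uniform` `[0, S] -> V} -> R) :
  path_lipschitz L g -> {within C, continuous g}.
Proof.
move=> gL; apply/path_continuousP => h e Ch e0.
have L1 : 0 < `|L| + 1 by rewrite ltr_wpDl.
exists (e / (`|L| + 1)); first by rewrite divr_gt0.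
move=> h' Ch' hh'; apply: le_lt_trans (gL _ _ _ Ch Ch' _ hh') _.
  by rewrite divr_ge0// ltW.
rewrite mulrA ltr_pdivrMr// mulrC ltr_pM2l//.
by rewrite (le_lt_trans (ler_norm _))// ltrDl.
Qed.

(** The Pasch-Hausdorff regularisation [inf_c (g c + k |h - c|)]. With [g = 0] and
    [k = 1] it is the distance to [K]; letting [k] tend to infinity it is an
    approximation of [g] from below by Lipschitz functions. *)
Definition inf_convolution (K : set (R -> V)) (g : (R -> V) -> R) (k : R) (h : R -> V) : R :=
  inf [set r | exists2 c, K c & exists2 e, 0 <= e /\ close e h c & r = g c + k * e].

Section inf_convolution_theory.
Variables (K : set (R -> V)) (g : (R -> V) -> R) (k B : R).
Hypotheses (KC : K `<=` C) (K0 : K !=set0) (k0 : 0 <= k) (gB : forall c, K c -> - B <= g c).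

Let lb h : lbound [set r | exists2 c, K c & exists2 e, 0 <= e /\ close e h c & r = g c + k * e] (- B).
Proof. by move=> r [c Kc [e [e0 _] ->]]; rewrite ler_wpDr ?mulr_ge0 ?gB. Qed.

Let ne h : C h ->
  [set r | exists2 c, K c & exists2 e, 0 <= e /\ close e h c & r = g c + k * e] !=set0.
Proof.
move=> Ch; have [c Kc] := K0.
have [B1 h1] := cpaths_bounded Ch; have [B2 h2] := cpaths_bounded (KC Kc).
exists (g c + k * (`|B1| + `|B2|)), c => //; exists (`|B1| + `|B2|) => //; split; first exact: addr_ge0.
move=> t tS; apply: le_trans (ler_normB _ _) _; apply: lerD.
  exact: le_trans (h1 t tS) (ler_norm _).
exact: le_trans (h2 t tS) (ler_norm _).
Qed.

Lemma inf_convolution_le h c e : K c -> 0 <= e -> close e h c ->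
  inf_convolution K g k h <= g c + k * e.
Proof.
move=> Kc e0 hc; apply: ge_inf; first by exists (- B); exact: lb.
by exists c => //; exists e.
Qed.

Lemma inf_convolution_ge h m : C h ->
  (forall c e, K c -> 0 <= e -> close e h c -> m <= g c + k * e) ->
  m <= inf_convolution K g k h.
Proof.
move=> Ch H; apply: lb_le_inf; first exact: ne.
by move=> _ [c Kc [e [e0 hc] ->]]; exact: H.
Qed.

Lemma inf_convolution_lipschitz : path_lipschitz k (inf_convolution K g k).
Proof.
have main h h' e : C h -> C h' -> 0 <= e -> close e h h' ->
    inf_convolution K g k h - inf_convolution K g k h' <= k * e.
  move=> Ch Ch' e0 hh'; rewrite lerBlDl -lerBlDr; apply: inf_convolution_ge => // c e' Kc e'0 h'c.
  rewrite lerBlDr -addrA -mulrDr; apply: inf_convolution_le => //; first exact: addr_ge0.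
  move=> t tS; rewrite -(subrKA (h' t)) (le_trans (ler_normD _ _))// addrC lerD//.
    exact: h'c.
  exact: hh'.
move=> h h' e Ch Ch' e0 hh'; rewrite ler_norml main// andbT lerNl opprB main// => t tS.
by rewrite distrC hh'.
Qed.

End inf_convolution_theory.

Lemma inf_convolution_cvg (g : {uniform` `[0, S] -> V} -> R) (B : R) h :
  {within C, continuous g} -> (forall c, C c -> `|g c| <= B) -> C h ->
  inf_convolution C g k%:R h @[k --> \oo] --> g h.
Proof.
move=> /path_continuousP cg gB Ch; apply/cvgrPdist_le => e e0.
have gB' c : C c -> - B <= g c by move=> /gB; rewrite ler_norml => /andP[].
have C0 : C !=set0 by exists h.
have [r r0 hr] := cg h e Ch e0; near=> k.
have le1 : inf_convolution C g k%:R h <= g h.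
  have := @inf_convolution_le C g k%:R B (ler0n _ _) gB' h h 0 Ch (lexx _).
  by rewrite mulr0 addr0; apply => t _; rewrite subrr normr0.
rewrite ger0_norm ?subr_ge0// lerBlDr -lerBlDl.
apply: (@inf_convolution_ge C g k%:R) => // c e' Cc e'0 hc.
have [ler|ltr] := leP e' r.
  have := hr c Cc (fun t tS => le_trans (hc t tS) ler); rewrite ltr_norml => /andP[_ h1].
  rewrite lerBlDr -lerBlDl; have := mulr_ge0 (ler0n R k) e'0; lra.
have k2 : 2 * B / r <= k%:R by near: k; exact: nbhs_infty_ger.
have h2 : 2 * B <= k%:R * e'.
  by move: k2; rewrite ler_pdivrMr// => /le_trans; apply; rewrite ler_wpM2l// ltW.
have := gB c Cc; have := gB h Ch; rewrite !ler_norml => /andP[_ h3] /andP[h4 _]; lra.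
Unshelve. all: by end_near. Qed.

(** The modulus of continuity at range [delta], in units of [eta]; it is capped at 1
    so as to be a bounded functional, to which weak convergence applies. *)
Definition capped_osc (delta eta : R) (h : R -> V) : R :=
  sup [set Num.min 1 (`|h p.1 - h p.2| / eta) |
    p in [set p : R * R | [/\ p.1 \in `[0, S], p.2 \in `[0, S] & `|p.1 - p.2| <= delta]]].

Section capped_osc_theory.
Variables (delta eta : R).
Hypotheses (S0 : 0 <= S) (d0 : 0 <= delta) (eta0 : 0 < eta).

Let ub (h : R -> V) : ubound [set Num.min 1 (`|h p.1 - h p.2| / eta) |
    p in [set p : R * R | [/\ p.1 \in `[0, S], p.2 \in `[0, S] & `|p.1 - p.2| <= delta]]] 1.
Proof. by move=> _ [p _ <-]; rewrite ge_min lexx. Qed.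

Lemma capped_osc_le h c : 0 <= c ->
  (forall s t, s \in `[0, S] -> t \in `[0, S] -> `|s - t| <= delta -> `|h s - h t| <= c * eta) ->
  capped_osc delta eta h <= c.
Proof.
move=> c0 H; apply: ge_sup.
  exists (Num.min 1 (`|h 0 - h 0| / eta)), (0, 0) => //=.
  by rewrite in_itv/= lexx S0 subrr normr0.
by move=> _ [[s t] /= [sS tS st] <-]; rewrite ge_min ler_pdivrMr// H// orbT.
Qed.

Lemma capped_osc_ge h s t : s \in `[0, S] -> t \in `[0, S] -> `|s - t| <= delta ->
  Num.min 1 (`|h s - h t| / eta) <= capped_osc delta eta h.
Proof.
by move=> sS tS st; apply: ub_le_sup; [exists 1; exact: ub|exists (s, t)].
Qed.

Lemma capped_osc_bound h : 0 <= capped_osc delta eta h <= 1.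
Proof.
have z : (0 : R) \in `[0, S] by rewrite in_itv/= lexx S0.
apply/andP; split.
  have := @capped_osc_ge h 0 0 z z; rewrite !subrr !normr0 mul0r => /(_ d0).
  by apply: le_trans; rewrite le_min lexx ler01.
apply: ge_sup; last exact: ub.
by exists (Num.min 1 (`|h 0 - h 0| / eta)), (0, 0) => //=; rewrite subrr normr0.
Qed.

Lemma capped_osc_lt1 h s t : capped_osc delta eta h < 1 ->
  s \in `[0, S] -> t \in `[0, S] -> `|s - t| <= delta -> `|h s - h t| <= eta.
Proof.
move=> h1 sS tS st; have := le_lt_trans (@capped_osc_ge h s t sS tS st) h1.
by rewrite gt_min ltxx/= ltr_pdivrMr// mul1r => /ltW.
Qed.

Lemma capped_osc_lipschitz : path_lipschitz (2 / eta) (capped_osc delta eta).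
Proof.
have main h h' e : 0 <= e -> close e h h' ->
    capped_osc delta eta h <= capped_osc delta eta h' + 2 / eta * e.
  move=> e0 hh'; apply: ge_sup.
    exists (Num.min 1 (`|h 0 - h 0| / eta)), (0, 0) => //=.
    by rewrite in_itv/= lexx S0 subrr normr0.
  move=> _ [[s t] /= [sS tS st] <-].
  apply: (@le_trans _ _ (Num.min 1 (`|h' s - h' t| / eta) + 2 / eta * e)); last first.
    by rewrite lerD2r capped_osc_ge.
  have e2 : 0 <= 2 / eta * e by rewrite mulr_ge0// divr_ge0// ltW.
  rewrite addr_minl le_min !ge_min; apply/andP; split.
    by rewrite lerDl e2.
  apply/orP; right; rewrite mulrAC -mulrDl ler_pM2r ?invr_gt0//.
  have -> : h s - h t = (h s - h' s) + (h' s - h' t) - (h t - h' t).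
    by rewrite subrKA opprB subrKA.
  have := hh' s sS; have := hh' t tS => a b.
  apply: le_trans (ler_normB _ _) _; apply: le_trans (lerD (ler_normD _ _) (lexx _)) _; lra.
move=> h h' e _ _ e0 hh'; rewrite ler_norml; apply/andP; split.
  by rewrite lerNl opprB lerBlDl main// => t tS; rewrite distrC hh'.
by rewrite lerBlDl main.
Qed.

End capped_osc_theory.

Lemma capped_osc_cvg0 eta h : 0 <= S -> 0 < eta -> C h ->
  capped_osc k.+1%:R^-1 eta h @[k --> \oo] --> 0.
Proof.
move=> S0 eta0 Ch; apply/cvgr0Pnorm_le => e e0.
have [r r0 hr] := cpaths_uniform Ch (mulr_gt0 e0 eta0); near=> k.
have k0 : 0 <= k.+1%:R^-1 :> R by rewrite invr_ge0.
rewrite ger0_norm; last by have /andP[] := capped_osc_bound eta S0 k0 h.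
apply: capped_osc_le => //; first exact: ltW.
move=> s t sS tS st; apply: hr => //; apply: le_trans st _.
rewrite invf_ple ?posrE// (@le_trans _ _ k%:R) ?ler_nat//.
near: k; exact: nbhs_infty_ger.
Unshelve. all: by end_near. Qed.

(** The easy half of the Arzela-Ascoli theorem, from the covering form of
    compactness applied to the ranges [r] that suit a neighbourhood of a path. *)
Lemma compact_paths_equicontinuous (K : set {uniform` `[0, S] -> V}) e : compact K -> K `<=` C ->
  0 < e -> exists2 r, 0 < r & forall h, K h -> forall s t, s \in `[0, S] -> t \in `[0, S] ->
    `|s - t| <= r -> `|h s - h t| <= e.
Proof.
move=> /compact_near_coveringP cK KC e0.
have := cK R 0^'+ (fun r h => forall s t, s \in `[0, S] -> t \in `[0, S] ->
  `|s - t| <= r -> `|h s - h t| <= e) _.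
case=> [h Kh|r /= r0 H]; last first.
  exists (r / 2); first by rewrite divr_gt0.
  move=> h Kh s t sS tS st; apply: (H (r / 2)) => //=; last by rewrite divr_gt0.
  by rewrite sub0r normrN gtr0_norm ?divr_gt0// ltr_pdivrMr// mulr_natr mulr2n ltrDl.
have e3 : 0 < e / 3 by rewrite divr_gt0.
have [r r0 H] := cpaths_uniform (KC _ Kh) e3.
exists ([set h' | close (e / 3) h h'], [set d | 0 < d < r]) => /=.
  split; first by apply/path_nbhsP; exists (e / 3).
  by apply/near_right0P; exists r => // d d0 dr /=; rewrite d0.
move=> [h' d] /= [hh' /andP[d0 dr]] s t sS tS st.
have -> : h' s - h' t = (h s - h t) - (h s - h' s) + (h t - h' t).
  by rewrite opprB [in RHS](addrC (h s - h t)) !subrKA.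
have a := hh' s sS; have b := hh' t tS.
have c := H s t sS tS (le_trans st (ltW dr)).
apply: le_trans (ler_normD _ _) _; apply: le_trans (lerD (ler_normB _ _) (lexx _)) _; lra.
Qed.

(** A closed set is the zero set of the distance to it, a Lipschitz functional; this
    is how the event of not belonging to [K] is seen to be measurable. *)
Lemma closed_inf_convolution (K : set {uniform` `[0, S] -> V}) (h : R -> V) :
  closed K -> K `<=` C -> K !=set0 -> C h ->
  inf_convolution K (fun=> 0) 1 h <= 0 -> K h.
Proof.
move=> clK KC K0 Ch h0; apply: clK => Q /path_nbhsP[e e0 eQ].
apply: contrapT => nKQ.
have : e <= inf_convolution K (fun=> 0) 1 h; last by lra.
apply: inf_convolution_ge => // c e' Kc e'0 hc; rewrite add0r mul1r leNgt; apply/negP => e'e.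
apply: nKQ; exists c; split => //; apply: eQ => t tS; apply: le_trans (hc t tS) _; exact: ltW.
Qed.

End paths.

(** * Functionals of random paths *)

Section interpolation.
Context {R : realType} (V : normedModType R) (delta : R) (N : nat).
Hypothesis delta_gt0 : 0 < delta.

Let hat (i : 'I_N) (t : R) := Num.max 0 (delta - `|t - i%:R * delta|).

(** Averages of the values at the nodes [i * delta] that are closer than [delta]
    to [t], with weights given by hat functions; a continuous path that depends on
    finitely many values. *)
Definition interpolate (z : 'I_N -> V) (t : R) : V :=
  (\sum_i hat i t)^-1 *: \sum_i hat i t *: z i.

Let hat_ge0 i t : 0 <= hat i t. Proof. by rewrite le_max lexx. Qed.

Let hat_sum_gt0 t : 0 <= t < N%:R * delta -> 0 < \sum_i hat i t.
Proof.
move=> /andP[t0 tN]; have td : 0 <= t / delta by rewrite divr_ge0// ltW.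
have /andP[h1 h2] := truncn_itv td.
have iN : (Num.truncn (t / delta) < N)%N by rewrite truncn_lt_nat// ltr_pdivrMr.
rewrite (bigD1 (Ordinal iN))//= ltr_pwDl ?sumr_ge0// lt_max/= subr_gt0.
rewrite ger0_norm; last by rewrite subr_ge0 -ler_pdivlMr.
apply/orP; right; rewrite ltrBlDr -[X in X + _]mul1r -mulrDl addrC natr1.
by rewrite -ltr_pdivrMr.
Qed.

Lemma interpolate_close (z : 'I_N -> V) t a e : 0 <= t < N%:R * delta -> 0 <= e ->
  (forall i : 'I_N, `|t - i%:R * delta| < delta -> `|z i - a| <= e) ->
  `|interpolate z t - a| <= e.
Proof.
move=> tN e0 H; have s0 := hat_sum_gt0 tN.
have -> : interpolate z t - a = (\sum_i hat i t)^-1 *: \sum_i hat i t *: (z i - a).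
  rewrite (eq_bigr (fun i => hat i t *: z i - hat i t *: a)); last first.
    by move=> i _; rewrite scalerBr.
  by rewrite sumrB scalerBr -scaler_suml scalerA mulVf ?gt_eqF// scale1r.
rewrite normrZ ger0_norm; last by rewrite invr_ge0 ltW.
rewrite mulrC ler_pdivrMr//.
apply: le_trans (ler_norm_sum _ _ _) _; rewrite mulr_sumr ler_sum// => i _.
rewrite normrZ ger0_norm// mulrC.
have [h|h] := ltP `|t - i%:R * delta| delta; first by rewrite ler_wpM2r// H.
have -> : hat i t = 0 by rewrite /hat max_l// subr_le0.
by rewrite !mulr0.
Qed.

Lemma interpolate_stable (z z' : 'I_N -> V) t e : 0 <= t < N%:R * delta -> 0 <= e ->
  (forall i, `|z i - z' i| <= e) -> `|interpolate z t - interpolate z' t| <= e.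
Proof.
move=> tN e0 H.
have -> : interpolate z t - interpolate z' t = interpolate (fun i => z i - z' i) t - 0.
  rewrite subr0 /interpolate -scalerBr -sumrB.
  by congr (_ *: _); apply: eq_bigr => i _; rewrite scalerBr.
by apply: interpolate_close => // i _; rewrite subr0.
Qed.

Let sum_cvg (W : normedModType R) (f : 'I_N -> R -> W) (r : seq 'I_N) (t : R) :
  (forall i, f i s @[s --> t] --> f i t) ->
  (\sum_(i <- r) f i s) @[s --> t] --> \sum_(i <- r) f i t.
Proof.
move=> cf; elim: r => [|i r IH].
  by rewrite big_nil; under eq_fun do rewrite big_nil; exact: cvg_cst.
by rewrite big_cons; under eq_fun do rewrite big_cons; exact: cvgD.
Qed.

Lemma interpolate_continuous (z : 'I_N -> V) t : 0 <= t < N%:R * delta ->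
  {for t, continuous (interpolate z)}.
Proof.
move=> tN; have s0 := hat_sum_gt0 tN.
have ch i : hat i s @[s --> t] --> hat i t.
  apply: (@continuous_max R R (cst 0) (fun s => delta - `|s - i%:R * delta|)).
    exact: cvg_cst.
  apply: cvgB; first exact: cvg_cst.
  by apply: cvg_norm; apply: cvgB; [exact: cvg_id|exact: cvg_cst].
apply: cvgZ.
  by apply: cvgV; [rewrite gt_eqF|exact: (@sum_cvg R)].
by apply: sum_cvg => i; apply: cvgZr_tmp; exact: ch.
Qed.

End interpolation.

Section functionals.
Context {R : realType} (m n : nat) (S : R) (S0 : 0 < S).
Local Notation V := 'M[R]_(m, n).
Local Notation C := (@cpaths R V S).
Context d (O : measurableType d) (D : set O) (mD : measurable D).

Lemma borel_continuous_real p q (h : O -> 'M[R]_(p, q)) (g : 'M[R]_(p, q) -> R) :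
  continuous g -> measurable_fun D (h : O -> borel 'M[R]_(p, q)) -> measurable_fun D (g \o h).
Proof.
move=> cg mh; apply: (@measurable_comp _ _ _ _ (borel 'M[R]_(p, q)) _ setT
  (g : borel 'M[R]_(p, q) -> R)) mh => //.
apply: (measurability _ (RGenOpens.measurableE R)).
move=> _ [_ [a [b ->] <-]]; rewrite setTI; apply: sub_sigma_algebra.
by apply: (@open_comp _ _ g) => [B _|]; [exact: cg|exact: interval_open].
Qed.

(** A continuous functional of the path is the limit of its values at the
    interpolated paths, which are continuous functions of finitely many values of
    the path. *)
Lemma measurable_path_functional (Z : O -> R -> V) (g : {uniform` `[0, S] -> V} -> R) :
  continuous_process D S Z -> {within C, continuous g} ->
  measurable_fun D (fun w => g (Z w)).
Proof.
move=> [ZC Zm] cg; have cg' := cg; move/path_continuousP in cg'.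
pose dl (N : nat) : R := S / N.+1%:R.
have dl0 N : 0 < dl N by rewrite divr_gt0.
have SN N t : t \in `[0, S] -> 0 <= t < N.+2%:R * dl N.
  rewrite in_itv/= => /andP[-> tS]; apply: le_lt_trans tS _.
  by rewrite mulrCA ltr_pMr// ltr_pdivlMr// mul1r ltr_nat.
pose I N (z : 'I_N.+2 -> V) := interpolate (dl N) z.
have IC N z : C (I N z).
  by apply: continuous_in_subspaceT => t /set_mem tS; apply: interpolate_continuous => //; exact: SN.
have node N (i : 'I_N.+2) : Num.min S (i%:R * dl N) \in `[0, S].
  by rewrite in_itv/= le_min ge_min lexx ltW//= mulr_ge0// ltW.
pose z N w (i : 'I_N.+2) := Z w (Num.min S (i%:R * dl N)).
have sub_dl r : 0 < r -> \forall N \near \oo, dl N <= r.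
  move=> r0; near=> N; rewrite /dl ler_pdivrMr// mulrC -ler_pdivrMr// (@le_trans _ _ N%:R) ?ler_nat//.
  near: N; exact: nbhs_infty_ger.
apply: (@measurable_fun_cvg _ _ _ _ (fun N w => g (I N (z N w)))) => [N|w Dw]; last first.
  apply/cvgrPdist_lt => e e0; have [r r0 hr] := cg' _ e (ZC w Dw) e0.
  have [r' r'0 hr'] := cpaths_uniform (ZC w Dw) r0; near=> N.
  apply: hr => // t tS; rewrite distrC; apply: interpolate_close; [by []|exact: SN|exact: ltW|].
  move=> i it; apply: hr' => //; have [h|h] := leP S (i%:R * dl N).
    have tS' : t <= S by move: tS; rewrite in_itv/= => /andP[].
    rewrite ger0_norm ?subr_ge0//; apply: le_trans (_ : dl N <= r'); last by near: N; exact: sub_dl.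
    by move: it; rewrite distrC ger0_norm ?subr_ge0 ?(le_trans tS')//; lra.
  by rewrite distrC (le_trans (ltW it))//; near: N; exact: sub_dl.
pose G N (B : 'M[R]_(N.+2, m * n)) := g (I N (fun i => vec_mx (row i B))).
pose h N w : 'M[R]_(N.+2, m * n) := \matrix_(i, j) (mxvec (z N w i)) 0 j.
have -> : (fun w => g (I N (z N w))) = G N \o h N.
  apply/funext => w /=; rewrite /G; congr (g (I N _)); apply/funext => i.
  rewrite -[LHS]mxvecK; congr vec_mx; apply/rowP => j; rewrite !mxE.
  by case/mxvec_indexP: j => a b; rewrite mxvecE.
apply: borel_continuous_real.
  move=> B U /nbhs_ballP[e /= e0 eU].
  have [r r0 hr] := cg' _ e (IC N (fun i => vec_mx (row i B))) e0.
  apply/nbhs_ballP; exists r => //= B'; rewrite -ball_normE/= => BB'; apply: eU.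
  apply: hr => // t tS; apply: interpolate_stable => //; [exact: SN|exact: ltW|].
  move=> i; apply: mxnorm_le => [|a b]; first exact: ltW.
  by rewrite !mxE; have := mxnorm_entry (B - B') i (mxvec_index a b); rewrite !mxE => /le_trans; apply; exact: ltW.
apply: borel_mx_measurable => // i j; case/mxvec_indexP: j => a b.
have -> : (fun w => h N w i (mxvec_index a b)) = fun w => Z w (Num.min S (i%:R * dl N)) a b.
  by apply/funext => w; rewrite mxE mxvecE.
exact: borel_mx_entry (Zm _ (node N i)).
Unshelve. all: by end_near. Qed.

End functionals.

Section bounded_integrals.
Context {R : realType} d (O : measurableType d) (P : probability O R).

Lemma bounded_integrable (D : set O) (g : O -> R) K : measurable D -> measurable_fun D g ->
  (forall w, D w -> `|g w| <= K) -> P.-integrable D (EFin \o g).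
Proof.
move=> mD mg gK; apply: measurable_bounded_integrable => //.
  by apply: le_lt_trans (probability_le1 P mD) _; exact: ltry.
exists K; split; first exact: num_real.
by move=> x Kx s Ds; apply: le_trans (gK s Ds) (ltW Kx).
Qed.

Lemma Rintegral_prob_cst (c : R) : \int[P]_w c = c.
Proof. by rewrite Rintegral_cst// [fine _](_ : _ = 1) ?mulr1//= probability_setT. Qed.

Lemma bounded_cvg_Rintegral (D : set O) (g_ : nat -> O -> R) (g : O -> R) K : measurable D ->
  (forall k, measurable_fun D (g_ k)) -> (forall k w, D w -> `|g_ k w| <= K) ->
  (forall w, D w -> g_ k w @[k --> \oo] --> g w) ->
  \int[P]_(w in D) g_ k w @[k --> \oo] --> \int[P]_(w in D) g w.
Proof.
move=> mD mg_ gK gc; have mg := measurable_fun_cvg mg_ gc.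
have := @dominated_convergence _ _ _ P D mD (fun k => EFin \o g_ k) (EFin \o g) (EFin \o cst K).
case=> //.
- by move=> k; exact/measurable_EFinP.
- exact/measurable_EFinP.
- by apply: aeW => w Dw; apply: cvg_EFin; [exact: nearW|exact: gc].
- exact: finite_measure_integrable_cst.
- by apply: aeW => w k Dw /=; rewrite lee_fin gK.
move=> ig _ h; apply: fine_cvg; rewrite fineK//; exact: integrable_fin_num.
Qed.

Lemma markov_bounded (g : O -> R) : measurable_fun setT g -> (forall w, 0 <= g w <= 1) ->
  (P [set w | (1 <= g w)%R] <= (\int[P]_w g w)%:E)%E.
Proof.
move=> mg g01; have mA : measurable [set w | 1 <= g w].
  by rewrite -[X in measurable X]setTI; exact: measurable_fun_le_set.
have ig : P.-integrable setT (EFin \o g).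
  by apply: (@bounded_integrable _ _ 1) => // w _; have /andP[h1 h2] := g01 w; rewrite ger0_norm.
rewrite /Rintegral fineK ?integrable_fin_num// -[X in P X]setIT -integral_indic//.
apply: ge0_le_integral => //.
- by apply/measurable_EFinP; exact: measurable_indic.
- exact/measurable_EFinP.
move=> w _; rewrite lee_fin indicE; have /andP[h1 _] := g01 w.
by case: (boolP (w \in _)) => [|//]; rewrite inE.
Qed.

Lemma Rintegral_close (D A : set O) (g g' : O -> R) (K r : R) : measurable D ->
  measurable_fun D g -> measurable_fun D g' -> 0 <= r ->
  0 <= K -> (forall w, D w -> `|g w| <= K) -> (forall w, D w -> `|g' w| <= K) ->
  measurable A -> (forall w, D w -> ~ A w -> `|g w - g' w| <= r) ->
  `|\int[P]_(w in D) g w - \int[P]_(w in D) g' w| <= r + 2 * K * fine (P A).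
Proof.
move=> mD mg mg' r0 K0 gK g'K mA H.
have ig := bounded_integrable mD mg gK; have ig' := bounded_integrable mD mg' g'K.
have igg : P.-integrable D (EFin \o (fun w => g w - g' w)).
  apply: (@bounded_integrable _ _ (2 * K)) => //; first exact: measurable_funB.
  by move=> w Dw; apply: le_trans (ler_normB _ _) _; have := gK w Dw; have := g'K w Dw; lra.
rewrite -RintegralB//; apply: le_trans (le_normr_Rintegral mD igg) _.
have mI : measurable_fun D (fun w => 2 * K * (\1_A w : R)).
  by apply: measurable_funM => //; exact: measurable_indic.
have iI : P.-integrable D (EFin \o (fun w => 2 * K * (\1_A w : R))).
  apply: (@bounded_integrable _ _ (2 * K)) => // w _.
  by rewrite indicE; case: (_ \in _); rewrite ?mulr1 ?mulr0 ?normr0 ?mulr_ge0// ger0_norm ?mulr_ge0.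
have iA : P.-integrable D (EFin \o (\1_A : O -> R)).
  by apply: (@bounded_integrable _ _ 1) => // w _; rewrite indicE; case: (_ \in _); rewrite ?normr1 ?normr0.
apply: (@le_trans _ _ (\int[P]_(w in D) (r + 2 * K * \1_A w))).
  apply: le_Rintegral => //.
  - by have := integrable_norm igg.
  - apply: (@integrableD _ _ _ _ _ mD (EFin \o cst r) (EFin \o (fun w => 2 * K * \1_A w))).
      exact: finite_measure_integrable_cst.
    exact: iI.
  - move=> w Dw; rewrite indicE; have [Aw|nAw] := boolP (w \in A).
      rewrite mulr1; apply: le_trans (ler_normB _ _) _; have := gK w Dw; have := g'K w Dw; lra.
    by rewrite mulr0 addr0 H// => /mem_set; exact/negP.
rewrite RintegralD//; last exact: finite_measure_integrable_cst.
rewrite Rintegral_cst// RintegralZl// lerD//.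
  rewrite -[leRHS]mulr1 ler_wpM2l// -[leRHS]/(fine 1%E) fine_le// ?fin_num_measure//.
  exact: probability_le1.
rewrite ler_wpM2l ?mulr_ge0// /Rintegral integral_indic// fine_le ?fin_num_measure//; [exact: measurableI|].
by apply: le_measure; rewrite ?inE//; exact: measurableI.
Qed.

End bounded_integrals.

Section weak_convergence.
Context {R : realType} (m n : nat) (S : R) (S0 : 0 < S).
Local Notation V := 'M[R]_(m, n).
Local Notation C := (@cpaths R V S).
Context d (O : measurableType d) (P : probability O R) (D : set O) (mD : measurable D).
Context (Z : R -> O -> R -> V).
Context d' (O' : measurableType d') (P' : probability O' R) (Y : O' -> R -> V).

Lemma continuous_process_integrable dq (Q : measurableType dq) (PQ : probability Q R)
    (E : set Q) (X : Q -> R -> V) (g : {uniform` `[0, S] -> V} -> R) K :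
  measurable E -> continuous_process E S X -> {within C, continuous g} ->
  (forall h, C h -> `|g h| <= K) -> PQ.-integrable E (EFin \o (fun w => g (X w))).
Proof.
move=> mE cX cg gK; apply: (@bounded_integrable _ _ _ _ _ _ K) => //.
  exact: measurable_path_functional.
by move=> w Ew; apply: gK; have [h _] := cX; exact: h.
Qed.

(** Bounded Lipschitz functionals decide convergence in distribution: [g] is the
    increasing limit of its regularisations [inf_convolution C g k], so that the
    integrals of [g] are asymptotically at least, and by symmetry at most, that of
    the limit. *)
Lemma weak_cvg_lipschitz :
  (forall e, 0 < e -> continuous_process D S (Z e)) -> continuous_process setT S Y ->
  (forall (g : {uniform` `[0, S] -> V} -> R) L K, 0 <= L -> path_lipschitz S L g ->
     (forall h, C h -> `|g h| <= K) ->
     \int[P]_(w in D) g (Z e w) @[e --> 0^'+] --> \int[P']_w g (Y w)) ->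
  @weak_cvg R {uniform` `[0, S] -> V} C _ _ P D Z _ _ P' Y.
Proof.
move=> cZ cY H.
have half (g : {uniform` `[0, S] -> V} -> R) K eps : {within C, continuous g} ->
    (forall h, C h -> `|g h| <= K) -> 0 < eps ->
    \forall e \near 0^'+, \int[P']_w g (Y w) - eps <= \int[P]_(w in D) g (Z e w).
  move=> cg gK e0.
  have C0 : C !=set0 by exists (fun=> 0); move=> t; exact: cvg_cst.
  have gK' h : C h -> - K <= g h by move=> /gK; rewrite ler_norml => /andP[].
  pose gk k := inf_convolution S C g k%:R.
  have gkL k : path_lipschitz S k%:R (gk k).
    exact: (@inf_convolution_lipschitz _ _ _ _ _ _ K (@subset_refl _ C) C0 (ler0n _ _) gK').
  have gkc k : {within C, continuous (gk k : {uniform` `[0, S] -> V} -> R)}.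
    exact: path_lipschitz_continuous (gkL k).
  have gkg k h : C h -> gk k h <= g h.
    move=> Ch; have := @inf_convolution_le _ _ S C g k%:R K (ler0n _ _) gK' h h 0 Ch (lexx _).
    by rewrite mulr0 addr0; apply => t _; rewrite subrr normr0.
  have gkK k h : C h -> `|gk k h| <= K.
    move=> Ch; rewrite ler_norml; apply/andP; split.
      apply: (@inf_convolution_ge _ _ S C g k%:R (@subset_refl _ C) C0) => // c e Cc e0' _.
      by rewrite ler_wpDr ?mulr_ge0// gK'.
    by apply: le_trans (gkg k h Ch) _; apply: le_trans (ler_norm _) (gK h Ch).
  have cY' w : C (Y w) by have [h _] := cY; exact: h.
  have lim : \int[P']_w gk k (Y w) @[k --> \oo] --> \int[P']_w g (Y w).
    apply: (@bounded_cvg_Rintegral _ _ _ _ _ _ _ K) => // [k|k w _|w _].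
    - exact: (measurable_path_functional S0 measurableT cY (gkc k)).
    - exact: gkK.
    - exact: inf_convolution_cvg cg gK (cY' w).
  have e2 : 0 < eps / 2 by rewrite divr_gt0.
  have /cvgrPdist_lt/(_ _ e2)[k _ /(_ k (leqnn k)) hk] := lim.
  have /cvgrPdist_lt/(_ _ e2) := H (gk k) k%:R K (ler0n _ _) (gkL k) (gkK k).
  apply: filterS2 (nbhs_right_gt 0) => e ep he.
  have : \int[P]_(w in D) gk k (Z e w) <= \int[P]_(w in D) g (Z e w).
    apply: le_Rintegral => //.
    - exact: continuous_process_integrable (cZ e ep) (gkc k) (gkK k).
    - exact: continuous_process_integrable (cZ e ep) cg gK.
    - by move=> w Dw; apply: gkg; have [h _] := cZ e ep; exact: h.
  by move: hk he; rewrite !ltr_norml => /andP[_ a] /andP[_ b]; lra.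
move=> g cg [K gK]; apply/cvgrPdist_le => eps e0.
have cNg : {within C, continuous (fun h => - g h : R)}.
  apply/path_continuousP => h e Ch e0'; have /path_continuousP := cg.
  move=> /(_ h e Ch e0')[r r0 hr]; exists r => // h' Ch' hh'.
  by rewrite -opprD normrN hr.
have NgK h : C h -> `|- g h| <= K by rewrite normrN; exact: gK.
have := half _ K eps cg gK e0; have := half _ K eps cNg NgK e0.
apply: filterS3 (nbhs_right_gt 0) => e ep.
have intN dq (Q : measurableType dq) (PQ : probability Q R) (E : set Q) (X : Q -> R -> V) :
    measurable E -> continuous_process E S X ->
    \int[PQ]_(w in E) (- g (X w)) = - \int[PQ]_(w in E) g (X w).
  move=> mE cX; rewrite -mulN1r -RintegralZl//; last exact: continuous_process_integrable cX cg gK.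
  by apply: eq_Rintegral => w _; rewrite mulN1r.
rewrite !intN//; last exact: cZ.
by move=> h1 h2; rewrite ler_norml; apply/andP; split; lra.
Qed.

(** Markov's inequality for the capped modulus of [Z e], whose expectation tends to
    that of the capped modulus of [Y]. *)
Lemma cvg_distr_osc delta eta kappa : 0 <= delta -> 0 < eta ->
  cvg_distr_C S P setT Z P' Y ->
  \int[P']_w capped_osc S delta eta (Y w) < kappa ->
  \forall e \near 0^'+, exists A, [/\ measurable A, (P A <= kappa%:E)%E &
    forall w, ~ A w -> forall s t, s \in `[0, S] -> t \in `[0, S] -> `|s - t| <= delta ->
      `|Z e w s - Z e w t| <= eta].
Proof.
move=> d0 eta0 [cZ cY wZ] Yk.
have cg : {within C, continuous (capped_osc S delta eta : {uniform` `[0, S] -> V} -> R)}.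
  exact: path_lipschitz_continuous (capped_osc_lipschitz (ltW S0) d0 eta0).
have gB h : 0 <= capped_osc S delta eta (h : R -> V) <= 1 := capped_osc_bound eta (ltW S0) d0 h.
have gK (h : {uniform` `[0, S] -> V}) : `|capped_osc S delta eta h| <= 1.
  by have /andP[h1 h2] := gB h; rewrite ger0_norm.
have wZ' := wZ _ cg (ltac:(by exists 1 => h _; exact: gK)).
have hlt : \forall e \near 0^'+, \int[P]_w capped_osc S delta eta (Z e w) < kappa.
  exact: (cvgr_lt _ wZ' _ Yk).
move: hlt; apply: filterS2 (nbhs_right_gt 0) => e e0 he.
have mg : measurable_fun setT (fun w => capped_osc S delta eta (Z e w)).
  exact: (measurable_path_functional S0 measurableT (cZ e e0) cg).
exists [set w | 1 <= capped_osc S delta eta (Z e w)]; split.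
- by rewrite -[X in measurable X]setTI; exact: measurable_fun_le_set.
- apply: le_trans (markov_bounded P mg (fun w => gB (Z e w))) _.
  by rewrite lee_fin ltW.
- move=> w /= /negP; rewrite -ltNge => h s t sS tS st.
  exact: (capped_osc_lt1 eta0 h sS tS st).
Qed.

(** The paths of [Y] are continuous, so that the expectation of their capped modulus
    tends to zero with the range, by dominated convergence. *)
Lemma cvg_distr_modulus eta kappa : 0 < eta -> 0 < kappa ->
  cvg_distr_C S P setT Z P' Y ->
  exists2 delta, 0 < delta & \forall e \near 0^'+, exists A, [/\ measurable A, (P A <= kappa%:E)%E &
    forall w, ~ A w -> forall s t, s \in `[0, S] -> t \in `[0, S] -> `|s - t| <= delta ->
      `|Z e w s - Z e w t| <= eta].
Proof.
move=> eta0 k0 H; have [cZ cY wZ] := H.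
have lim : \int[P']_w capped_osc S k.+1%:R^-1 eta (Y w) @[k --> \oo] --> \int[P']_w (0 : R).
  apply: (@bounded_cvg_Rintegral _ _ _ _ _ _ _ 1) => // [k|k w _|w _].
  - apply: (measurable_path_functional S0 measurableT cY).
    have k1 : 0 <= k.+1%:R^-1 :> R by rewrite invr_ge0.
    exact: path_lipschitz_continuous (capped_osc_lipschitz (ltW S0) k1 eta0).
  - have k1 : 0 <= k.+1%:R^-1 :> R by rewrite invr_ge0.
    have /andP[h1 h2] := capped_osc_bound eta (ltW S0) k1 (Y w).
    by rewrite ger0_norm.
  - by apply: capped_osc_cvg0 => //; [exact: ltW|have [h _] := cY; exact: h].
rewrite Rintegral_prob_cst in lim.
have [k _ /(_ k (leqnn k)) hk] := cvgr_lt _ lim _ k0.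
exists k.+1%:R^-1; first by rewrite invr_gt0.
by apply: cvg_distr_osc => //; rewrite invr_ge0.
Qed.

(** The compact set given by tightness is equicontinuous. If it is not empty, the
    exceptional event is where the distance to it is positive. *)
Lemma tight_modulus eta kappa : 0 < eta -> 0 < kappa -> tight_C S P Z ->
  exists2 delta, 0 < delta & \forall e \near 0^'+, exists A, [/\ measurable A, (P A <= kappa%:E)%E &
    forall w, ~ A w -> forall s t, s \in `[0, S] -> t \in `[0, S] -> `|s - t| <= delta ->
      `|Z e w s - Z e w t| <= eta].
Proof.
move=> eta0 k0 [cZ /(_ kappa k0)[K [Kc Kcl KC PK]]].
have [delta d0 hd] := compact_paths_equicontinuous Kc KC eta0.
exists delta => //; move: PK; apply: filterS2 (nbhs_right_gt 0) => e e0 he.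
exists [set w | ~ K (Z e w)]; split => //; last first.
  by move=> w /= /contrapT Kw; exact: hd.
have [K0|K0] := pselect (K !=set0); last first.
  rewrite (_ : [set w | _] = setT)//; apply/seteqP; split => // w _ /= Kw.
  by apply: K0; exists (Z e w).
pose g := inf_convolution S K (fun=> 0) 1.
have cg : {within C, continuous (g : {uniform` `[0, S] -> V} -> R)}.
  apply: path_lipschitz_continuous.
  apply: (@inf_convolution_lipschitz _ _ _ _ _ _ 0 KC K0 ler01) => c _; rewrite oppr0//.
have mg := measurable_path_functional S0 measurableT (cZ e e0) cg.
rewrite (_ : [set w | _] = setT `&` [set w | 0 < g (Z e w)]).
  exact: measurable_fun_lt_set.
rewrite setTI; apply/seteqP; split=> w /=.
  move=> nK; rewrite ltNge; apply/negP => h; apply: nK.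
  by apply: closed_inf_convolution => //; have [h' _] := cZ e e0; exact: h'.
move=> h Kw; move: h; rewrite ltNge => /negP; apply.
have := @inf_convolution_le _ _ S K (fun=> 0) 1 0 ler01 _ (Z e w) (Z e w) 0 Kw (lexx _).
rewrite mulr0 addr0; apply; first by move=> c _; rewrite oppr0.
by move=> t _; rewrite subrr normr0.
Qed.

End weak_convergence.

(** * Asymptotically invariant functions do not see the initial law *)

Section sweeping.
Context dM (M : measurableType dM) (R : realType).
Context (mu : {measure set M -> \bar R}) (T : M -> M).
Hypotheses (T_preserving : measure_preserving mu T)
  (T_conservative : conservative mu T) (T_ergodic : ergodic mu T).

Let mT : measurable_fun setT T. Proof. by case: T_preserving. Qed.

Let miter n : measurable_fun setT (iter n T).
Proof.
elim: n => [|n IH]; first exact: measurable_id.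
by apply: (measurableT_comp mT).
Qed.

Let mpre n A : measurable A -> measurable (iter n T @^-1` A).
Proof. by move=> mA; rewrite -[X in measurable X]setTI; exact: miter. Qed.

Let mu_iter n A : measurable A -> mu (iter n T @^-1` A) = mu A.
Proof.
move=> mA; elim: n => [//|n IH]; case: T_preserving => _ hT.
rewrite (_ : iter n.+1 T @^-1` A = T @^-1` (iter n T @^-1` A)).
  by rewrite hT ?IH//; exact: mpre.
by apply/seteqP; split => y /=; rewrite -iterS iterSr.
Qed.

(** A set of positive measure is visited by almost every orbit: the points of [B]
    that never return form a wandering set, so that almost every point of [B]
    returns infinitely often, and the points that do so form an invariant set. *)
Lemma sweeping B : measurable B -> mu B != 0%E ->
  mu.-negligible [set y | forall j, (0 < j)%N -> ~ B (iter j T y)].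
Proof.
move=> mB B0.
pose E := \bigcap_n \bigcup_m (iter (n + m) T @^-1` B).
have mE : measurable E.
  by apply: bigcapT_measurable => n; apply: bigcupT_measurable => m; exact: mpre.
have TE : T @^-1` E = E.
  apply/seteqP; split => y Ey n _.
    have [m _ h] := Ey n I; exists m.+1 => //=.
    by move: h; rewrite /= addnS /= -iterS iterSr.
  have [m _ h] := Ey n.+1 I; exists m => //=.
  by rewrite /= -iterSr; exact: h.
pose W := B `&` \bigcap_m ~` (iter m.+1 T @^-1` B).
have mW : measurable W.
  by apply: measurableI => //; apply: bigcapT_measurable => m; apply: measurableC; exact: mpre.
have W0 : mu W = 0%E.
  apply: T_conservative => //; apply/trivIsetP => i j _ _ ij; apply/seteqP; split => // y.
  wlog ltij : i j ij / (i < j)%N.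
    move=> Hw [h1 h2]; have [h|h] : (i < j)%N \/ (j < i)%N.
    - by case: (ltngtP i j) ij => // _; [left|right].
    - exact: (Hw i j).
    - by apply: (Hw j i) => //; rewrite eq_sym.
  move=> [[_ h1] [h2 _]]; apply: (h1 (j - i).-1 I) => /=.
  by rewrite -iterS -iterD prednK ?subn_gt0// subnK// ltnW.
have [Enull|Ec] := T_ergodic mE TE.
  exfalso; move/eqP: B0; apply; apply: measure_negligible => //.
  apply: (@negligibleS _ _ _ mu (E `|` \bigcup_n (iter n T @^-1` W))).
    move=> y By; have [Ey|nEy] := pselect (E y); first by left.
    right; have [n hn] : exists n, forall m, (n <= m)%N -> ~ B (iter m T y).
      apply: contrapT => /forallNP H; apply: nEy => n _; apply: contrapT => H'.
      apply: (H n) => m nm Bm; apply: H'; exists (m - n)%N => //=.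
      by rewrite subnKC.
    have {hn} [k [Bk hk]] : exists k, B (iter k T y) /\ forall m, (k < m)%N -> ~ B (iter m T y).
      elim: n hn => [|n IH] hn; first by case: (hn 0%N).
      have [Bn|nBn] := pselect (B (iter n T y)); first by exists n; split.
      apply: IH => m; rewrite leq_eqVlt => /predU1P[<-//|]; exact: hn.
    exists k => //; split => // m _ /=; rewrite -iterS -iterD; apply: hk.
    by rewrite addSn ltnS leq_addl.
  apply: negligibleU; first by apply/negligibleP.
  by apply: negligible_bigcup => n; apply/negligibleP; [exact: mpre|have := mu_iter n mW; rewrite W0].
apply: (@negligibleS _ _ _ mu (~` E)); last by apply/negligibleP => //; exact: measurableC.
move=> y hy Ey; have [m _] := Ey 1%N I; exact: hy.
Qed.

End sweeping.

Section filling.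
Context dM (M : measurableType dM) (R : realType) (T : M -> M).
Hypothesis mT : measurable_fun setT T.
Local Notation fmeasure := {finite_measure set M -> \bar R}.
Local Open Scope ereal_scope.

Let mpre A : measurable A -> measurable (T @^-1` A).
Proof. by move=> mA; rewrite -[X in measurable X]setTI; exact: mT. Qed.

(** One step of the filling scheme: the image of [a] is used to fill [b], with [N]
    the set where it does not suffice. What overflows is [a'], and [b'] is what
    remains to be filled. *)
Lemma filling_step (a b : fmeasure) : exists x : fmeasure * fmeasure * set M,
  [/\ measurable x.2, x.1.1 x.2 = 0, x.1.2 (~` x.2) = 0 &
   forall A, measurable A -> [/\ x.1.1 A <= a (T @^-1` A), x.1.2 A <= b A &
     x.1.1 A + b A = a (T @^-1` A) + x.1.2 A]].
Proof.
have [nu nuE] : exists nu : {charge set M -> \bar R}, forall A, nu A = a (T @^-1` A) - b A.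
  unshelve eexists (cadd (pushforward (charge_of_finite_measure a) T : {charge set M -> \bar R})
    (copp (charge_of_finite_measure b))); first exact: mT.
  by [].
have [P [N nuPN]] := Hahn_decomposition nu.
have [posP negN PN PN0] := nuPN; have [mP _] := posP; have [mN _] := negN.
have pE A : measurable A -> jordan_pos nuPN A = nu (A `&` P).
  by move=> mA; rewrite jordan_posE cjordan_posE /crestr0 mem_set.
have nE A : measurable A -> jordan_neg nuPN A = - nu (A `&` N).
  by move=> mA; rewrite jordan_negE cjordan_negE /crestr0 mem_set.
have fa A : measurable A -> a (T @^-1` A) \is a fin_num by move=> mA; apply: fin_num_measure; exact: mpre.
have fb A : measurable A -> b A \is a fin_num by move=> mA; exact: fin_num_measure.
exists ((jordan_pos nuPN : fmeasure), (jordan_neg nuPN : fmeasure), N); split => //=.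
- by rewrite pE// setIC PN0 charge0.
- rewrite nE; last exact: measurableC.
  by rewrite setICl charge0 oppe0.
move=> A mA; have mAP := measurableI _ _ mA mP; have mAN := measurableI _ _ mA mN.
split.
- rewrite pE// nuE; apply: (@le_trans _ _ (a (T @^-1` (A `&` P)))).
    by rewrite leeBlDr ?fb// leeDl.
  by apply: le_measure; rewrite ?inE; [exact: mpre|exact: mpre|move=> y []].
- rewrite nE// nuE; apply: (@le_trans _ _ (b (A `&` N))); last first.
    by apply: le_measure; rewrite ?inE.
  have : 0 <= a (T @^-1` (A `&` N)) by exact: measure_ge0.
  move: (fa _ mAN) (fb _ mAN); move: (a _) (b _) => [x| |] [y| |]//= _ _.
  by rewrite !lee_fin; lra.
have e : a (T @^-1` A) - b A = jordan_pos nuPN A - jordan_neg nuPN A.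
  by have := jordan_decomp nuPN mA; rewrite nuE /cadd/= cscaleN1.
have fp : jordan_pos nuPN A \is a fin_num by exact: fin_num_measure.
have fn : jordan_neg nuPN A \is a fin_num by exact: fin_num_measure.
move: e fp fn (fa A mA) (fb A mA).
move: (jordan_pos nuPN A) (jordan_neg nuPN A) (a _) (b A).
by move=> [p| |] [q| |] [r| |] [s| |]//= [h] _ _ _ _; rewrite -!EFinD; congr EFin; lra.
Qed.

Variables (a0 b0 : fmeasure).

Let step (x : fmeasure * fmeasure * set M) := projT1 (cid (filling_step x.1.1 x.1.2)).

Definition filling n := iter n step (a0, b0, setT).

Local Notation al n := (filling n).1.1.
Local Notation be n := (filling n).1.2.
Local Notation N n := (filling n.+1).2.

Lemma fillingP n : [/\ measurable (N n), al n.+1 (N n) = 0, be n.+1 (~` N n) = 0 &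
   forall A, measurable A -> [/\ al n.+1 A <= al n (T @^-1` A), be n.+1 A <= be n A &
     al n.+1 A + be n A = al n (T @^-1` A) + be n.+1 A]].
Proof. by rewrite /filling /= /step; case: cid. Qed.

Lemma filling_mass n : a0 setT = b0 setT -> al n setT = be n setT.
Proof.
move=> ab; elim: n => [//|n IH].
have [_ _ _ /(_ _ measurableT)[_ _]] := fillingP n.
rewrite preimage_setT IH.
have f1 : al n.+1 setT \is a fin_num by exact: fin_num_measure.
have f2 : be n.+1 setT \is a fin_num by exact: fin_num_measure.
have f3 : be n setT \is a fin_num by exact: fin_num_measure.
move: f1 f2 f3; move: (al n.+1 _) (be n.+1 _) (be n _) => [x| |] [y| |] [z| |]//= _ _ _ [h].
by congr EFin; lra.
Qed.

Lemma filling_mass_le n : al n setT <= a0 setT.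
Proof.
elim: n => [//|n]; apply: le_trans.
by have [_ _ _ /(_ _ measurableT)[]] := fillingP n; rewrite preimage_setT.
Qed.

Variable (mu : {measure set M -> \bar R}).
Hypotheses (T_preserving : measure_preserving mu T)
  (T_conservative : conservative mu T) (T_ergodic : ergodic mu T).
Hypotheses (a_ac : content_dominates mu a0) (b_ac : content_dominates mu b0).
Hypothesis ab : a0 setT = b0 setT.

Let mN n : measurable (N n). Proof. by have [] := fillingP n. Qed.

Let be_le m n A : measurable A -> (m <= n)%N -> be n A <= be m A.
Proof.
move=> mA /subnK <-; elim: (n - m)%N => [//|k IH]; rewrite addSn.
by apply: le_trans IH; have [_ _ _ /(_ _ mA)[]] := fillingP (k + m).
Qed.

(** If the set [B] of the points that are never filled is null then [be n] tends to
    zero. Otherwise almost every orbit visits [B]; but all the mass of [al] that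
    enters [B] is absorbed there, so that [al n] tends to zero. Both have the same
    total mass. *)
Lemma filling_cvg0 (kappa : R) : (0 < kappa)%R -> exists n, al n setT <= kappa%:E.
Proof.
move=> k0; pose B := \bigcap_n N n.
have mB : measurable B by exact: bigcapT_measurable.
have small (F : (set M)^nat) (m : fmeasure) : (forall n, measurable (F n)) ->
    (forall n, F n.+1 `<=` F n) -> m (\bigcap_n F n) = 0 -> exists n, m (F n) <= kappa%:E.
  move=> mF Fle m0.
  have h : m (F 0%N) < +oo by rewrite ltey_eq fin_num_measure.
  have lim : (m \o F) x @[x --> \oo] --> 0.
    rewrite -m0; apply: nonincreasing_cvg_mu => //; first exact: bigcapT_measurable.
    apply/nonincreasing_seqP => n; exact/subsetPset.
  have lim' : (fine \o (m \o F)) x @[x --> \oo] --> 0%R by exact: fine_cvg.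
  have [n _ /(_ n (leqnn n))/=] := cvgr_lt _ lim' _ k0.
  by rewrite -lte_fin fineK ?fin_num_measure// => h'; exists n; exact: ltW.
have [muB|muB] := eqVneq (mu B) 0.
  pose F n := \bigcap_(j in [set j | (j < n)%N]) N j.
  have mF n : measurable (F n).
    rewrite -[F n]setCK setC_bigcap; apply: measurableC; apply: bigcup_measurable => j _.
    exact: measurableC.
  have [||n hn] := small F b0 mF.
  - by move=> n y Fy j jn; apply: Fy => /=; exact: ltnW.
  - rewrite (_ : \bigcap_n F n = B) ?b_ac//.
    by apply/seteqP; split => y h j _; [apply: (h j.+1) => //=|move=> i _; exact: h].
  exists n; rewrite filling_mass//; apply: le_trans hn.
  have F0 : be n (~` F n) = 0.
    rewrite setC_bigcap; apply: measure_negligible.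
      by apply: bigcup_measurable => j _; exact: measurableC.
    apply: (@negligibleS _ _ _ (be n) (\bigcup_j (~` N j `&` [set _ | (j < n)%N]))).
      by move=> y [j jn h]; exists j.
    apply: negligible_bigcup => j; have [jn|nj] := boolP (j < n)%N; last first.
      rewrite (_ : _ `&` _ = set0); first exact: negligible_set0.
      by apply/seteqP; split => // y [_].
    apply: (@negligibleS _ _ _ (be n) (~` N j)) => [y []//|].
    apply/negligibleP; first exact: measurableC.
    apply/eqP; rewrite eq_le measure_ge0 andbT.
    by have [_ _ <- _] := fillingP j; apply: be_le => //; exact: measurableC.
  apply: (@le_trans _ _ (be n (F n) + be n (~` F n))).
    by rewrite -(setUv (F n)); apply: measureU2 => //; exact: measurableC.
  by rewrite F0 adde0; exact: (@be_le 0 n).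
pose U (A : set M) := T @^-1` (A `\` B).
have mU A : measurable A -> measurable (U A) by move=> mA; apply: mpre; exact: measurableD.
have mUn n : measurable (iter n U setT) by elim: n => [|n IH]; [exact: measurableT|exact: mU IH].
have alB n : al n.+1 B = 0.
  apply/eqP; rewrite eq_le measure_ge0 andbT; have [_ <- _ _] := fillingP n.
  by apply: le_measure; rewrite ?inE// => y h; exact: h.
have alU n A : measurable A -> al n A <= a0 (iter n U A).
  elim: n A => [//|n IH] A mA; rewrite iterSr; apply: le_trans (IH _ (mU A mA)).
  apply: (@le_trans _ _ (al n.+1 (A `\` B))).
    have /le_trans : al n.+1 A <= al n.+1 (A `\` B) + al n.+1 B.
      apply: (@le_trans _ _ (al n.+1 ((A `\` B) `|` B))).
        apply: le_measure; rewrite ?inE//; first by apply: measurableU => //; exact: measurableD.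
        by move=> y Ay; have [By|nBy] := pselect (B y); [right|left].
      by apply: measureU2 => //; exact: measurableD.
    by apply; rewrite alB adde0.
  by have [_ _ _ /(_ (A `\` B) (measurableD mA mB))[]] := fillingP n.
have [||n hn] := small (fun n => iter n U setT) a0 mUn.
- elim=> [//|n IH] y /=; rewrite /U /= => -[h1 h2]; split => //; exact: IH.
- apply: a_ac; first exact: bigcapT_measurable.
  apply: measure_negligible; first exact: bigcapT_measurable.
  apply: negligibleS (sweeping T_preserving T_conservative T_ergodic mB muB).
  move=> y h j j0; have := h j I; elim: j y {h} j0 => [//|j IH] y _ /= [h1 h2].
  by case: j IH h1 => [//|j] IH h1; rewrite -iterS iterSr; exact: IH.
by exists n; apply: le_trans (alU n _ measurableT) hn.
Qed.

End filling.

Section transfer.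
Context dM (M : measurableType dM) (R : realType) (T : M -> M).
Context (mu : {measure set M -> \bar R}).
Hypotheses (T_preserving : measure_preserving mu T)
  (T_conservative : conservative mu T) (T_ergodic : ergodic mu T).
Context (P Q : probability M R).
Hypotheses (P_ac : content_dominates mu P) (Q_ac : content_dominates mu Q).
Local Notation fmeasure := {finite_measure set M -> \bar R}.

Let mT : measurable_fun setT T. Proof. by case: T_preserving. Qed.

Let fint (m : {measure set M -> \bar R}) (H : M -> R) (K : R) : (m setT < +oo)%E ->
  measurable_fun setT H -> (forall y, `|H y| <= K) -> m.-integrable setT (EFin \o H).
Proof.
move=> moo mH HK; apply: measurable_bounded_integrable => //.
exists K; split; first exact: num_real.
by move=> x Kx s _; exact: le_trans (HK s) (ltW Kx).
Qed.

Let foo (m : fmeasure) : (m setT < +oo)%E.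
Proof. by rewrite ltey_eq fin_num_measure. Qed.

Let fint_bound (m : fmeasure) (H : M -> R) (K : R) : measurable_fun setT H -> (forall y, `|H y| <= K) ->
  `|\int[m]_y H y| <= K * fine (m setT).
Proof.
move=> mH HK; have iH := fint (foo m) mH HK.
apply: le_trans (le_normr_Rintegral measurableT iH) _; rewrite -Rintegral_cst//.
apply: le_Rintegral => //; [exact: integrable_norm|exact: finite_measure_integrable_cst].
Qed.

(** A step of the filling scheme changes the difference of the two integrals by at
    most [c], the cost of moving the mass of [al] by [T]. After [n] steps what is
    left of either measure has the mass of [al n]. *)
Lemma filling_integral n (H : M -> R) (c K : R) : measurable_fun setT H ->
  (forall y, `|H y| <= K) -> (forall y, `|H (T y) - H y| <= c) ->
  `|\int[P]_y H y - \int[Q]_y H y| <= n%:R * c + 2 * K * fine ((filling mT P Q n).1.1 setT).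
Proof.
move=> mH HK Hc.
pose al k : fmeasure := (filling mT P Q k).1.1; pose be k : fmeasure := (filling mT P Q k).1.2.
have c0 : 0 <= c by exact: le_trans (Hc point).
have mHT : measurable_fun setT (H \o T) by exact: measurableT_comp.
have PQ : P setT = Q setT by rewrite !probability_setT.
have stepE k : \int[al k.+1]_y H y + \int[be k]_y H y = \int[al k]_y H (T y) + \int[be k.+1]_y H y.
  have fin_int (m : {measure set M -> \bar R}) : (m setT < +oo)%E -> (\int[m]_y (H y)%:E)%E \is a fin_num.
    by move=> moo; apply: integrable_fin_num => //; exact: fint moo mH HK.
  have mHe : measurable_fun setT (EFin \o H) by exact/measurable_EFinP.
  have [pm pmE] : exists pm : {measure set M -> \bar R}, forall A, pm A = al k (T @^-1` A).
    by unshelve eexists (pushforward (al k) T : {measure set M -> \bar R}).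
  have pmoo : (pm setT < +oo)%E by rewrite pmE foo.
  have e1 : (\int[measure_add (al k.+1) (be k)]_y (H y)%:E =
      \int[al k.+1]_y (H y)%:E + \int[be k]_y (H y)%:E)%E.
    by apply: integral_measure_add => //; [exact: fint (foo _) mH HK..].
  have e2 : (\int[measure_add pm (be k.+1)]_y (H y)%:E =
      \int[pm]_y (H y)%:E + \int[be k.+1]_y (H y)%:E)%E.
    by apply: integral_measure_add => //; [exact: fint pmoo mH HK|exact: fint (foo _) mH HK].
  have e3 : (\int[measure_add (al k.+1) (be k)]_y (H y)%:E = \int[measure_add pm (be k.+1)]_y (H y)%:E)%E.
    apply: eq_measure_integral => A mA _.
    rewrite [LHS]measure_addE [RHS]measure_addE pmE.
    by have [_ _ _ /(_ A mA)[_ _]] := fillingP mT P Q k.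
  have e4 : (\int[pm]_y (H y)%:E = \int[al k]_y (H (T y))%:E)%E.
    have iHT : (al k).-integrable (T @^-1` setT) ((EFin \o H) \o T).
      by rewrite preimage_setT; apply: (fint (foo _) mHT (K := K)) => y; exact: HK.
    have := integral_pushforward mT mHe iHT measurableT; rewrite preimage_setT => <-.
    by apply: eq_measure_integral => A mA _; rewrite pmE.
  rewrite /Rintegral -fineD ?fin_int//; [|exact: foo..].
  rewrite -e1 e3 e2 e4 fineD ?fin_int//; last exact: foo.
  by rewrite -e4 fin_int.
have main : `|(\int[al n]_y H y - \int[be n]_y H y) - (\int[P]_y H y - \int[Q]_y H y)| <= n%:R * c.
  elim: n => [|n IH]; first by rewrite subrr normr0 mul0r.
  have -> : (\int[al n.+1]_y H y - \int[be n.+1]_y H y) - (\int[P]_y H y - \int[Q]_y H y) =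
      \int[al n]_y (H (T y) - H y) +
      ((\int[al n]_y H y - \int[be n]_y H y) - (\int[P]_y H y - \int[Q]_y H y)).
    rewrite RintegralB//; [|exact: fint (foo _) mHT (fun y => HK (T y))|exact: fint (foo _) mH HK].
    have := stepE n; lra.
  rewrite -natr1 mulrDl mul1r [leRHS]addrC; apply: le_trans (ler_normD _ _) _; apply: lerD => //.
  apply: le_trans (fint_bound _ (measurable_funB mHT mH) Hc) _.
  rewrite -[leRHS]mulr1 ler_wpM2l// -[leRHS]/(fine 1%E) fine_le ?fin_num_measure//.
  by rewrite -(probability_setT P); exact: filling_mass_le.
have a1 := fint_bound (al n) mH HK; have b1 := fint_bound (be n) mH HK.
have abn : be n setT = al n setT by rewrite /al /be filling_mass.
rewrite abn in b1; rewrite -/(al n).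
move: main a1 b1; rewrite !ler_norml => /andP[h1 h2] /andP[h3 h4] /andP[h5 h6].
by apply/andP; split; lra.
Qed.

(** The number [n] of steps of the filling scheme is fixed by the precision alone;
    the cost [n * c e] of these steps then tends to zero. *)
Lemma asymptotic_invariance (H : R -> M -> R) (c : R -> R) (K l : R) :
  (forall e, 0 < e -> measurable_fun setT (H e)) ->
  (forall e y, 0 < e -> `|H e y| <= K) ->
  (forall e y, 0 < e -> `|H e (T y) - H e y| <= c e) -> c e @[e --> 0^'+] --> 0 ->
  \int[P]_y H e y @[e --> 0^'+] --> l -> \int[Q]_y H e y @[e --> 0^'+] --> l.
Proof.
move=> mH HK Hc c0 Pl; apply/cvgrPdist_le => eps eps0.
have K0 : 0 <= K by apply: le_trans (HK 1 point ltr01).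
have k0 : 0 < eps / 3 / (2 * K + 1) by rewrite !divr_gt0// ltr_wpDl// mulr_ge0.
have PQ : P setT = Q setT by rewrite !probability_setT.
have [n hn] := filling_cvg0 mT T_preserving T_conservative T_ergodic P_ac Q_ac PQ k0.
have e3 : 0 < eps / 3 by rewrite divr_gt0.
have e3n : 0 < eps / 3 / n.+1%:R by rewrite divr_gt0.
have /cvgrPdist_lt/(_ _ e3) := Pl; have /cvgrPdist_lt/(_ _ e3n) := c0.
apply: filterS3 (nbhs_right_gt 0) => e e0 hc hP.
have := filling_integral n (mH e e0) (fun y => HK e y e0) (fun y => Hc e y e0).
set m := fine _ => hm.
have m1 : 2 * K * m <= eps / 3.
  apply: (@le_trans _ _ (2 * K * (eps / 3 / (2 * K + 1)))).
    rewrite ler_wpM2l ?mulr_ge0// -[leRHS]/(fine (_)%:E) fine_le// ?fin_num_measure//.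
  by rewrite mulrCA ler_piMr ?(ltW e3)// ler_pdivrMr ?mul1r ?lerDl// ltr_wpDl// mulr_ge0.
have c1 : n%:R * c e <= eps / 3.
  move: hc; rewrite sub0r normrN ltr_pdivlMr// => hc.
  have ce0 : 0 <= c e by exact: le_trans (Hc e point e0).
  rewrite ger0_norm// in hc; apply: le_trans (ltW hc); rewrite mulrC ler_wpM2l// ler_nat//.
rewrite -(subrKA (\int[P]_y H e y)); apply: le_trans (ler_normD _ _) _; lra.
Qed.

End transfer.

(** * The driven paths depend measurably on the starting point *)

Section euler.
Context dM (M : measurableType dM) (R : realType) (d : nat).
Context (T : M -> M) (tau : M -> R) (tau1 tau2 : R).
Hypotheses (tau1_gt0 : 0 < tau1) (tauB : forall y, tau1 <= tau y <= tau2).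
Hypotheses (mT : measurable_fun setT T) (mtau : measurable_fun setT tau).
Local Notation RM := (measurableTypeR R).
Context (f : 'rV[R]_d -> M * RM -> 'rV[R]_d) (Cf Lf : R).
Hypothesis mf : measurable_fun setT
  (fun p : borel 'rV[R]_d * (M * RM) => f p.1 p.2 : borel 'rV[R]_d).
Hypotheses (fC : forall x p, `|f x p| <= Cf)
  (fL : forall x y p, `|f x p - f y p| <= Lf * `|x - y|).
Context (fbar : 'rV[R]_d -> 'rV[R]_d) (Cb Lb : R).
Hypotheses (bC : forall x, `|fbar x| <= Cb)
  (bL : forall x y, `|fbar x - fbar y| <= Lb * `|x - y|).
Hypotheses (Lf0 : 0 <= Lf) (Lb0 : 0 <= Lb).
Context (e : R) (x : 'rV[R]_d) (X : M * RM -> R -> 'rV[R]_d).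
Hypotheses (e0 : 0 < e) (XE : forall p, susp tau p -> driven T tau f fbar e 0 x p (X p)).

Local Notation flow := (susp_flow T tau).
Local Notation L := (Lf + Lb).
Local Notation CX := (Cf + Cb).

Let mD : measurable (susp tau : set (M * RM)) := measurable_susp mtau.

(** Euler's scheme in the space variable only: the driving term is integrated exactly
    over each step, being merely measurable in time. *)
Fixpoint euler (h : R) (k : nat) (p : M * RM) : 'rV[R]_d :=
  if k is k'.+1 then euler h k' p + mxint (k'%:R * h) (k'.+1%:R * h)
    (fun s => f (euler h k' p) (flow (s / e + 0) p) + fbar (euler h k' p))
  else x.

Lemma measurable_euler h k i j : 0 <= h ->
  measurable_fun (susp tau) (fun p => euler h k p i j).
Proof.
move=> h0; elim: k i j => [|k IH] i j /=; first exact: measurable_cst.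
have ab : k%:R * h <= k.+1%:R * h by rewrite ler_wpM2r// ler_nat.
have k0 : 0 <= k%:R * h by exact: mulr_ge0.
under eq_fun do rewrite mxE [X in _ + X]mxE.
apply: measurable_funD; first exact: IH.
apply: (@measurable_fun_Rintegral _ _ _ _ _ _ CX) => //.
  move=> p s _ _; apply: le_trans (mxnorm_entry _ _ _) _.
  by apply: le_trans (ler_normD _ _) _; exact: lerD.
have mE : measurable ((susp tau : set (M * RM)) `*` (`[k%:R * h, k.+1%:R * h]%classic : set RM)).
  by apply: measurableX => //; exact: measurable_itv.
have sub z : (susp tau `*` `[k%:R * h, k.+1%:R * h]%classic) z -> susp tau z.1 by case.
have mEu a b : measurable_fun (susp tau `*` `[k%:R * h, k.+1%:R * h]%classic)
    (fun z : M * RM * RM => euler h k z.1 a b).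
  have mfst := @measurable_funTS _ _ _ _ (susp tau `*` `[k%:R * h, k.+1%:R * h]%classic) _
    (@measurable_fst _ _ (M * RM)%type RM).
  apply: (measurable_comp mD _ (IH a b) mfst) => _ [z [hz _] <-]; exact: hz.
apply: (eq_measurable_fun (fun z : M * RM * RM =>
    f (euler h k z.1) (flow (z.2 / e + 0) z.1) i j + fbar (euler h k z.1) i j)).
  by move=> z _; rewrite [RHS]mxE.
apply: measurable_funD.
  apply: (measurable_field mf) => //.
  apply: (measurable_susp_flow tau1_gt0 tauB mT mtau) => //.
  - move=> z [_ /=]; rewrite in_itv/= => /andP[zs _].
    by rewrite addr0 divr_ge0//; [exact: le_trans zs|exact: ltW].
  - apply: measurable_funD => //; apply: measurable_funM => //.
    exact: (@measurable_funTS _ _ _ _ _ _ (@measurable_snd _ _ (M * RM)%type RM)).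
  - exact: (@measurable_funTS _ _ _ _ _ _ (@measurable_fst _ _ (M * RM)%type RM)).
apply: borel_mx_entry; apply: (borel_continuous (continuous_fbar bL Lb0)).
exact: borel_mx_measurable.
Qed.

Lemma euler_error h k p : 0 <= h -> susp tau p ->
  `|X p (k%:R * h) - euler h k p| <= CX * h * (expR (L * (k%:R * h)) - 1).
Proof.
move=> h0 ps; have CX0 : 0 <= CX by rewrite addr_ge0 ?(Cf_ge0 fC p) ?(Cb_ge0 bC).
have L0 : 0 <= L by exact: addr_ge0.
elim: k => [|k IH].
  by rewrite mul0r mulr0 expR0 subrr mulr0 (driven0 (XE ps)) subrr normr0.
have ab : k%:R * h <= k.+1%:R * h by rewrite ler_wpM2r// ler_nat.
have k0 : 0 <= k%:R * h by exact: mulr_ge0.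
have kh : k.+1%:R * h - k%:R * h = h by rewrite -natr1; ring.
rewrite (drivenE tau1_gt0 tauB mT mtau mf fC bL Lb0 e0 (lexx 0) ps (XE ps) k0 ab) /=.
set E := euler h k p in IH *.
have b1 : bounded_meas (k%:R * h) (k.+1%:R * h) (fun s => f (X p s) (flow (s / e + 0) p) + fbar (X p s)).
  apply: bounded_measD; first exact: (driven_bounded_meas_f tau1_gt0 tauB mT mtau mf fC e0 (lexx 0) ps (XE ps)).
  exact: (driven_bounded_meas_fbar bL Lb0 (XE ps)).
have b2 : bounded_meas (k%:R * h) (k.+1%:R * h) (fun s => f E (flow (s / e + 0) p) + fbar E).
  apply: bounded_measD; last exact: bounded_meas_cst.
  apply: (bounded_meas_field mf fC); first exact: bounded_meas_cst.
  exact: (measurable_flow_time tau1_gt0 tauB mT mtau).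
rewrite opprD addrACA; apply: le_trans (ler_normD _ _) _.
apply: (@le_trans _ _ (`|X p (k%:R * h) - E| + L * (`|X p (k%:R * h) - E| + CX * h) * h)).
  rewrite lerD2l -mxintB// -[X in _ <= _ * X]kh; apply: mxint_norm => //.
    exact: bounded_measB.
  move=> s; rewrite in_itv/= => /andP[s1 s2].
  have Xs : `|X p s - E| <= `|X p (k%:R * h) - E| + CX * h.
    rewrite -(subrKA (X p (k%:R * h))) addrC; apply: le_trans (ler_normD _ _) _; rewrite addrC.
    rewrite addrC lerD2l; apply: le_trans (driven_lipschitz tau1_gt0 tauB mT mtau mf fC bC bL Lb0 e0 (lexx 0) ps (XE ps) (le_trans k0 s1) k0) _.
    by rewrite ler_wpM2l// ger0_norm ?subr_ge0// -[leRHS]kh lerB.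
  rewrite opprD addrACA; apply: le_trans (ler_normD _ _) _; rewrite mulrDl; apply: lerD.
    by apply: le_trans (fL _ _ _) _; rewrite ler_wpM2l.
  by apply: le_trans (bL _ _) _; rewrite ler_wpM2l.
have h1 : 1 + L * h <= expR (L * h) by exact: expR_ge1Dx.
have -> : L * (k.+1%:R * h) = L * (k%:R * h) + L * h by rewrite -natr1; ring.
rewrite expRD; set x1 := expR _ in IH *; set x2 := expR _ in h1 *.
have x10 : 0 <= x1 by exact: expR_ge0.
have Lh0 : 0 <= L * h by exact: mulr_ge0.
have := ler_wpM2l x10 h1; move=> h2.
have := ler_wpM2l (mulr_ge0 CX0 h0) h2; move=> h3.
have := ler_wpM2l Lh0 IH; move=> h4.
lra.
Qed.

(** The paths [X p] are given separately for each [p]; they depend measurably on [p]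
    because uniqueness makes them limits of Euler's scheme. *)
Lemma measurable_driven t i j : 0 <= t -> measurable_fun (susp tau) (fun p => X p t i j).
Proof.
move=> t0; apply: (@measurable_fun_cvg _ _ _ _ (fun N p => euler (t / N.+1%:R) N.+1 p i j)).
  by move=> N; apply: measurable_euler; rewrite divr_ge0.
move=> p ps; apply/cvgrPdist_le => eps eps0.
pose K := CX * t * (expR (L * t) - 1); near=> N.
have tN : N.+1%:R * (t / N.+1%:R) = t by rewrite mulrC divfK.
have := @euler_error (t / N.+1%:R) N.+1 p _ ps; rewrite tN divr_ge0// => /(_ isT) h.
have := mxnorm_entry (X p t - euler (t / N.+1%:R) N.+1 p) i j.
rewrite !mxE => /le_trans; apply; apply: le_trans h _.
rewrite (_ : _ * _ = K / N.+1%:R); last by rewrite /K; ring.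
rewrite ler_pdivrMr// mulrC -ler_pdivrMr// (@le_trans _ _ N%:R) ?ler_nat//.
near: N; exact: nbhs_infty_ger.
Unshelve. all: by end_near. Qed.

End euler.

(** * Linear response with large probability *)

Section mostly.
Context {R : realType} dM (M : measurableType dM) (P : probability M R).

(** The exceptional event is covered by a measurable set because it involves all
    solutions of an equation and is not itself known to be measurable. *)
Definition mostly (kappa : R) (Q : R -> M -> Prop) := \forall e \near 0^'+,
  exists A, [/\ measurable A, (P A <= kappa%:E)%E & forall y, ~ A y -> Q e y].

Lemma mostlyI k k' Q Q' : mostly k Q -> mostly k' Q' ->
  mostly (k + k') (fun e y => Q e y /\ Q' e y).
Proof.
move=> h h'; near=> e.
have [A [mA PA QA]] : exists A, [/\ measurable A, (P A <= k%:E)%E & forall y, ~ A y -> Q e y].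
  by near: e; exact: h.
have [B [mB PB QB]] : exists A, [/\ measurable A, (P A <= k'%:E)%E & forall y, ~ A y -> Q' e y].
  by near: e; exact: h'.
exists (A `|` B); split; first exact: measurableU.
  by rewrite EFinD; apply: le_trans (leeD PA PB); exact: measureU2.
by move=> y nAB; split; [apply: QA => Ay|apply: QB => By]; apply: nAB; [left|right].
Unshelve. all: by end_near. Qed.

Lemma mostlyW k (D : R -> Prop) (Q Q' : R -> M -> Prop) : (\forall e \near 0^'+, D e) ->
  (forall e y, 0 < e -> D e -> Q e y -> Q' e y) -> mostly k Q -> mostly k Q'.
Proof.
move=> hD H; apply: filterS3 (nbhs_right_gt 0) hD => e e0 De [A [mA PA QA]].
by exists A; split => // y /QA; exact: H.
Qed.

End mostly.

Lemma steps_bound {R : realType} (V : normedModType R) (S delta : R) (h : R -> V) : 0 < delta ->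
  h 0 = 0 -> (forall s t, s \in `[0, S] -> t \in `[0, S] -> `|s - t| <= delta -> `|h s - h t| <= 1) ->
  forall s, 0 <= s <= S -> `|h s| <= S / delta + 1.
Proof.
move=> d0 h0 H s sS.
have main (n : nat) : forall t, 0 <= t <= S -> t <= n%:R * delta -> `|h t| <= n%:R.
  elim: n => [|n IH] t /[dup] tS /andP[t0 tS'] tn.
    have -> : t = 0 by apply: le_anti; rewrite t0 andbT; rewrite mul0r in tn.
    by rewrite h0 normr0.
  have [td|dt] := leP t delta.
    rewrite -[h t]subr0 -h0; apply: le_trans (H t 0 _ _ _) _; rewrite ?in_itv/= ?t0 ?lexx ?subr0 ?ger0_norm//.
    - exact: le_trans tS'.
    - by rewrite ler1n.
  have tdS : 0 <= t - delta <= S by rewrite subr_ge0 ltW//= lerBlDr (le_trans tS')// lerDl ltW.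
  rewrite -(subrK (h (t - delta)) (h t)) -natr1 addrC; apply: le_trans (ler_normD _ _) _.
  apply: lerD.
    by apply: IH => //; rewrite lerBlDr -[X in _ + X]mul1r -mulrDl natr1.
  by apply: H; rewrite ?in_itv//= opprD addrA subrr add0r opprK gtr0_norm.
have /andP[s0 sS'] := sS.
have := main (Num.truncn (s / delta)).+1 s sS; rewrite -ler_pdivrMr// => /(_ (ltW (truncnS_gt _))).
move=> /le_trans; apply; rewrite -natr1 lerD2r.
apply: (@le_trans _ _ (s / delta)); first by rewrite truncn_le divr_ge0// ltW.
by rewrite ler_wpM2r// invr_ge0 ltW.
Qed.

Section lap_deviation.
Context dM (M : measurableType dM) (R : realType).
Context (T : M -> M) (tau : M -> R) (tau1 tau2 : R).
Hypotheses (tau1_gt0 : 0 < tau1) (tauB : forall y, tau1 <= tau y <= tau2).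
Hypotheses (mT : measurable_fun setT T) (mtau : measurable_fun setT tau).
Context (taubar : R) (taubar0 : 0 < taubar) (P : probability M R).
Local Notation lap := (lap T tau).
Local Notation dev e y t := (`|e * (lap (t / e) y)%:R - t / taubar|).

Let dev_bound e y S t : 0 < e -> t \in `[0, S] -> dev e y t <= S / tau1 + S / taubar.
Proof.
move=> e0; rewrite in_itv/= => /andP[t0 tS].
apply: le_trans (ler_normB _ _) _.
rewrite [X in X + _]ger0_norm; last by rewrite mulr_ge0// ltW.
rewrite [X in _ + X]ger0_norm; last by rewrite divr_ge0// ltW.
apply: lerD; last by rewrite ler_wpM2r// invr_ge0 ltW.
apply: le_trans (slow_lap_bound T tau1_gt0 tauB e0 y t0) _.
by rewrite ler_wpM2r// invr_ge0 ltW.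
Qed.

Let dev_sup e y S eta : 0 < e -> 0 < S ->
  eta < sup [set dev e y t | t in `[0, S]] <-> exists2 t, t \in `[0, S] & eta < dev e y t.
Proof.
move=> e0 S0.
have hu : has_ubound [set dev e y t | t in `[0, S]].
  by exists (S / tau1 + S / taubar) => _ [t tS <-]; exact: dev_bound.
split=> [h|[t tS h]].
  have hs : has_sup [set dev e y t | t in `[0, S]].
    by split => //; exists (dev e y 0), 0 => //=; rewrite in_itv/= lexx ltW.
  have [_ [t tS <-] h'] := sup_adherent (eps := sup [set dev e y t | t in `[0, S]] - eta) (ltac:(by rewrite subr_gt0)) hs.
  by exists t => //; move: h'; lra.
by apply: lt_le_trans h _; apply: ub_le_sup => //; exists t.
Qed.

(** The lap count is right-continuous in time, so that rational times and the
    final one suffice. *)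
Let dev_rational e y S eta t : 0 < e -> t \in `[0, S] -> eta < dev e y t ->
  eta < dev e y S \/ exists q : rat, ratr q \in `[0, S] /\ eta < dev e y (ratr q).
Proof.
move=> e0; rewrite in_itv/= => /andP[t0 tS] ht; have te : 0 <= t / e by rewrite divr_ge0// ltW.
move: tS; rewrite le_eqVlt => /predU1P[<-|tS]; first by left.
right; have /andP[h1 h2] := lapP T tau1_gt0 tauB y te.
set n := lap (t / e) y in ht h1 h2.
pose b := Num.min S (Num.min (e * birkhoff_sum T tau n.+1 y) (t + taubar * (dev e y t - eta))).
have tb : t < b.
  rewrite !lt_min tS/= ltrDl mulr_gt0 ?subr_gt0// andbT.
  by rewrite mulrC -ltr_pdivrMr.
have [q] := rat_in_itvoo tb; rewrite in_itv/= !lt_min => /and3P[tq qS /andP[qn qd]].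
exists q; split; first by rewrite in_itv/= (le_trans t0 (ltW tq)) ltW.
rewrite (@lap_eq _ _ _ T tau tau1 tau2 tau1_gt0 tauB n); last first.
- by rewrite ltr_pdivrMr// mulrC.
- by apply: le_trans h1 _; rewrite ler_pM2r ?invr_gt0// ltW.
have h3 : (ratr q - t) / taubar < dev e y t - eta by rewrite ltr_pdivrMr// mulrC ltrBlDl.
have := ler_normD (e * n%:R - ratr q / taubar) ((ratr q - t) / taubar).
rewrite -/n in h3; have -> : e * n%:R - ratr q / taubar + (ratr q - t) / taubar = e * n%:R - t / taubar by ring.
have -> : `|(ratr q - t) / taubar| = (ratr q - t) / taubar.
  by rewrite ger0_norm// divr_ge0 ?subr_ge0// ltW.
lra.
Qed.

Lemma measurable_dev e t : 0 < e -> 0 <= t -> measurable_fun setT (fun y => dev e y t).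
Proof.
move=> e0 t0; have te : 0 <= t / e by rewrite divr_ge0// ltW.
apply: measurableT_comp => //; apply: measurable_funB => //; apply: measurable_funM => //.
apply: (@measurable_fun_cases _ _ M R setT (fun y => lap (t / e) y) (fun k _ => k%:R)) => // k.
exact: (measurable_lap_eq tau1_gt0 tauB mT mtau (g := fun=> t / e) (h := id)).
Qed.

Lemma measurable_lap_deviation e S eta : 0 < e -> 0 < S ->
  measurable [set y | eta < sup [set dev e y t | t in `[0, S]]].
Proof.
move=> e0 S0; pose c (q : rat) : R := if ratr q \in `[0, S] then ratr q else S.
have cS q : c q \in `[0, S] by rewrite /c; case: ifP => // _; rewrite in_itv/= lexx ltW.
have mm t : 0 <= t -> measurable [set y | eta < dev e y t].
  move=> t0; rewrite -[X in measurable X]setTI.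
  by apply: measurable_fun_lt_set => //; exact: measurable_dev.
rewrite (_ : [set y | _] = [set y | eta < dev e y S] `|` \bigcup_q [set y | eta < dev e y (c q)]).
  apply: measurableU; first exact: mm (ltW S0).
  apply: countable_bigcupT_measurable => [|q]; first exact: countableP.
  by apply: mm; have := cS q; rewrite in_itv/= => /andP[].
apply/seteqP; split => y /=.
  move=> /(dev_sup _ _ e0 S0)[t tS h].
  have [h'|[q [qS h']]] := dev_rational e0 tS h; first by left.
  by right; exists q => //=; rewrite /c qS.
move=> [h|[q _ h]]; apply/(dev_sup _ _ e0 S0); last by exists (c q).
by exists S => //; rewrite in_itv/= lexx ltW.
Qed.

Lemma mostly_lap S eta kappa : 0 < S -> 0 < eta -> 0 < kappa ->
  cvg_prob_unif S P (fun e y t => e * (lap (t / e) y)%:R) (fun t => t / taubar) ->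
  mostly P kappa (fun e y => forall t, 0 <= t <= S -> dev e y t <= eta).
Proof.
move=> S0 eta0 k0 /(_ eta eta0) h.
have {}h : \forall e \near 0^'+, (P [set y | (eta < sup [set dev e y t | t in `[0, S]])%R] <= kappa%:E)%E.
  have lim : (fine \o (fun e => P [set y | (eta < sup [set dev e y t | t in `[0, S]])%R])) e @[e --> 0^'+] --> (0 : R).
    exact: fine_cvg.
  have /cvgrPdist_lt/(_ _ k0) := lim; apply: filterS2 (nbhs_right_gt 0) => e e0.
  rewrite sub0r normrN => /ltW; rewrite ger0_norm; last by rewrite fine_ge0.
  by rewrite /= -lee_fin fineK// fin_num_measure//; exact: measurable_lap_deviation.
move: h; apply: filterS2 (nbhs_right_gt 0) => e e0 h.
exists [set y | eta < sup [set dev e y t | t in `[0, S]]]; split => //.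
  exact: measurable_lap_deviation.
move=> y /= nh t tS; rewrite leNgt; apply/negP => h'; apply: nh.
by apply/(dev_sup _ _ e0 S0); exists t => //; rewrite in_itv.
Qed.

End lap_deviation.

Lemma eq_linear_response {R : realType} n (A : R -> 'M[R]_n) (V V' : R -> 'rV[R]_n) t :
  (forall s, 0 <= s <= t -> V s = V' s) -> 0 <= t ->
  linear_response A V t = linear_response A V' t.
Proof.
move=> VV' t0; rewrite /linear_response VV'; last by rewrite t0 lexx.
by congr (_ + _); apply: eq_mxint => s; rewrite in_itv/= => st; rewrite VV'.
Qed.

Section closeness.
Context dM (M : measurableType dM) (R : realType) (d : nat).
Context (T : M -> M) (tau : M -> R) (tau1 tau2 : R).
Hypotheses (tau1_gt0 : 0 < tau1) (tauB : forall y, tau1 <= tau y <= tau2).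
Hypotheses (mT : measurable_fun setT T) (mtau : measurable_fun setT tau).
Local Notation RM := (measurableTypeR R).
Context (f : 'rV[R]_d -> M * RM -> 'rV[R]_d) (Cf Lf : R).
Hypothesis mf : measurable_fun setT
  (fun p : borel 'rV[R]_d * (M * RM) => f p.1 p.2 : borel 'rV[R]_d).
Hypotheses (fC : forall x p, `|f x p| <= Cf)
  (fL : forall x y p, `|f x p - f y p| <= Lf * `|x - y|) (Lf0 : 0 <= Lf).
Context (fbar : 'rV[R]_d -> 'rV[R]_d) (C : R).
Hypotheses (F_C2 : forall y, C2_bounded C ((roof_integral tau f) ^~ y))
  (fbar_C2 : C2_bounded C fbar).
Context (taubar : R) (taubar0 : 0 < taubar).
Context (x : 'rV[R]_d) (W : R -> 'rV[R]_d).
Hypothesis W_ode : ode_solution fbar x W.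
Context (a : R -> R) (a_gt0 : forall e, 0 < e -> 0 < a e).
Hypotheses (a_cvg0 : a e @[e --> 0^'+] --> 0) (ea_cvg0 : e / a e @[e --> 0^'+] --> 0).

Local Notation F z y := (roof_integral tau f z y).
Local Notation JF z y := ('J (roof_integral tau f ^~ y) z).
Local Notation w r := (W (taubar * r)).
Local Notation lap := (lap T tau).

Definition fluctuation_process e y t := a e *: mxint 0 (t / e)
  (fun s => F (w (e * s)) (iter (Num.truncn s) T y)).
Definition dfluctuation_process e y t := a e *: mxint 0 (t / e)
  (fun s => JF (w (e * s)) (iter (Num.truncn s) T y)).
Definition roof_process e y t := Num.sqrt (e * a e) *: mxint 0 (t / e)
  (fun s => (tau (iter (Num.truncn s) T y) - taubar) *: fbar (w (e * s))).

Local Notation vv := fluctuation_process.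
Local Notation jv := dfluctuation_process.
Local Notation zz := roof_process.

Lemma slow_time_change m n e y t (G : M -> R -> 'M[R]_(m, n)) : 0 < e -> 0 <= t ->
  bounded_meas 0 t (fun r => G (slow_orbit T e y r) r) ->
  mxint 0 t (fun r => G (slow_orbit T e y r) r) =
  e *: mxint 0 (t / e) (fun s => G (iter (Num.truncn s) T y) (e * s)).
Proof.
move=> e0 t0 bG.
have e1 : 0 = 0 + e * 0 :> R by rewrite mulr0 addr0.
have e2 : t = 0 + e * (t / e) by rewrite add0r mulrC divfK// gt_eqF.
rewrite {1}e1 {1}e2 mxint_affine//; last by rewrite -e1 -e2.
congr (_ *: _); apply: eq_mxint => s _; rewrite add0r /slow_orbit.
by rewrite [e * s / e]mulrAC divff ?mul1r// gt_eqF.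
Qed.

Let k e := a e / e.
Let k_gt0 e : 0 < e -> 0 < k e. Proof. by move=> e0; rewrite divr_gt0// a_gt0. Qed.
Let ke e : 0 < e -> k e * e = a e. Proof. by move=> e0; rewrite divfK// gt_eqF. Qed.

Let C0 : 0 <= C. Proof. exact: C2_bounded_ge0 fbar_C2. Qed.
Let dC0 : 0 <= d%:R * C. Proof. exact: mulr_ge0. Qed.
Let bC u : `|fbar u| <= C. Proof. by have [_ _ h _ _] := fbar_C2. Qed.
Let bL u v : `|fbar u - fbar v| <= d%:R * C * `|u - v|.
Proof. exact: C2_bounded_lipschitz. Qed.
Let Cf0 : 0 <= Cf. Proof. exact: Cf_ge0 fC (point, 0). Qed.
Let tau2_ge0 : 0 <= tau2.
Proof. by have /andP[h1 h2] := tauB point; rewrite (le_trans _ h2)// (le_trans _ h1)// ltW. Qed.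

Lemma fluctuation_processE e y t : 0 < e -> 0 <= t ->
  vv e y t = fluctuation T tau f taubar W e (k e) y t.
Proof.
move=> e0 t0; rewrite /fluctuation (@slow_time_change _ _ e y t (fun z r => F (w r) z))//.
  by rewrite scalerA ke.
exact: (bounded_meas_Fw T F_C2 fbar_C2 taubar0 W_ode e0).
Qed.

Lemma dfluctuation_processE e y p q : 0 < e -> 0 <= p -> p <= q ->
  jv e y q - jv e y p = mxint p q (dfluctuation T tau f taubar W e (k e) y).
Proof.
move=> e0 p0 pq.
have bJ u v : 0 <= u -> bounded_meas u v (fun r => JF (w r) (slow_orbit T e y r)).
  by move=> u0; exact: (bounded_meas_Jw T F_C2 fbar_C2 taubar0 W_ode e0).
have jvE t : 0 <= t -> jv e y t = mxint 0 t (dfluctuation T tau f taubar W e (k e) y).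
  move=> t0; rewrite /dfluctuation mxintZ; last exact: bJ.
  by rewrite (@slow_time_change _ _ e y t (fun z r => JF (w r) z)) ?scalerA ?ke//; exact: bJ.
rewrite !jvE ?(le_trans p0)// (@mxint_split _ _ _ 0 p q)//; first by rewrite addrC addKr.
by apply: bounded_measZc; exact: bJ.
Qed.

Lemma roof_processE e y t : 0 < e -> 0 <= t ->
  mxint 0 t (fun r => (tau (slow_orbit T e y r) - taubar) *: fbar (w r)) =
  (Num.sqrt (e / a e)) *: zz e y t.
Proof.
move=> e0 t0.
rewrite (@slow_time_change _ _ e y t (fun z r => (tau z - taubar) *: fbar (w r)))//.
  rewrite /roof_process scalerA; congr (_ *: _).
  rewrite -sqrtrM; last by rewrite divr_ge0// ltW// a_gt0.
  have -> : e / a e * (e * a e) = e ^+ 2 by field; rewrite gt_eqF// a_gt0.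
  by rewrite sqrtr_sqr gtr0_norm.
have bf : bounded_meas 0 t (fun r => fbar (w r)).
  exact: (bounded_meas_fbarw bC bL dC0 taubar0 W_ode).
have := bounded_measB (bounded_meas_tauZ T tau1_gt0 tauB e0 y (lexx 0) bf) (bounded_measZc taubar bf).
by apply: eq_bounded_meas => r _; rewrite scalerBl.
Qed.

Context (P : probability M R) (dO : measure_display) (O : measurableType dO).
Context (P' : probability O R) (v : O -> R -> 'rV[R]_d).
Hypothesis vv_cvg : forall S, 0 < S -> cvg_distr_C S P setT vv P' v.
Hypothesis jv_tight : forall S, 0 < S -> tight_C S P jv.
Hypothesis zz_cvg : forall S, 0 < S -> cvg_distr_C S P setT zz P (fun _ _ => 0).
Hypothesis lap_cvg : forall S, 0 < S ->
  cvg_prob_unif S P (fun e y t => e * (lap (t / e) y)%:R) (fun t => t / taubar).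

Local Notation A := (fun u => 'J fbar (W u)).
Local Notation osc S delta eta h := (forall s t, s \in `[0, S] -> t \in `[0, S] ->
  `|s - t| <= delta -> `|h s - h t| <= eta).

(** The limit is the zero process, so that the modulus of continuity is small even at
    range [S]. *)
Let zz_small S xi kappa : 0 < S -> 0 < xi -> 0 < kappa ->
  mostly P kappa (fun e y => osc S S xi (zz e y)).
Proof.
move=> S0 xi0 k0; apply: (cvg_distr_osc S0 (ltW S0) xi0 (zz_cvg S0)).
rewrite (_ : (fun w : M => _) = fun=> 0) ?Rintegral_prob_cst//.
apply/funext => u; apply/eqP; rewrite eq_le; have /andP[-> _] := capped_osc_bound xi (ltW S0) (ltW S0) (fun _ : R => 0 : 'rV[R]_d).
rewrite andbT; apply: capped_osc_le => //; [exact: ltW|exact: ltW|].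
by move=> s t _ _ _; rewrite subrr normr0 mul0r.
Qed.

Local Notation LHc := ((Cf + C) * tau2 + taubar * C).
Local Notation c3 S := ((Lf * ((Cf + C) * tau2) * tau2 + d%:R * C * ((Cf + C) * tau2)) * (S / tau1) + Cf * tau2).

(** The part of [residual] that tends to zero with [e], for fixed values of the other
    parameters. *)
Let vanishing S delta eta m K e := d%:R * (S / tau1 / delta + 1) *
  ((K * (e / a e) + Num.sqrt (m * (e / a e))) * eta) +
  (d%:R * C * (S / tau1) * 2 + d%:R * C * S) * (K ^+ 2 * (e / a e)) + a e * c3 S.

Let vanishing_cvg0 S delta eta m K : vanishing S delta eta m K e @[e --> 0^'+] --> 0.
Proof.
pose l : R := d%:R * (S / tau1 / delta + 1) * ((K * 0 + Num.sqrt (m * 0)) * eta) +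
    (d%:R * C * (S / tau1) * 2 + d%:R * C * S) * (K ^+ 2 * 0) + 0 * c3 S.
have l0 : l = 0 by rewrite /l !mulr0 sqrtr0 !addr0 !mul0r mulr0 addr0.
suff : vanishing S delta eta m K e @[e --> 0^'+] --> l by rewrite l0.
have cM c (h : R -> R) l' : h e @[e --> 0^'+] --> l' -> c * h e @[e --> 0^'+] --> c * l'.
  by move=> hl; apply: cvgM => //; exact: cvg_cst.
apply: cvgD; last by apply: cvgM => //; exact: cvg_cst.
apply: cvgD; last by apply: (cM); exact: (cM).
apply: (cM); apply: cvgM; last exact: cvg_cst.
apply: cvgD; first exact: (cM).
by apply: continuous_cvg; [exact: sqrt_continuous|exact: (cM)].
Qed.

Let residualE S delta eta m K e : 0 < e -> 0 <= m ->
  residual d tau1 tau2 Cf Lf C taubar e (k e) S delta eta (Num.sqrt (m * (e / a e))) K =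
  eta * (1 + d%:R * LHc * (S / tau1)) + d%:R * C * (S / tau1) * 2 * m + vanishing S delta eta m K e.
Proof.
move=> e0 m0; have a0 := a_gt0 e0; have a0' : a e != 0 by rewrite gt_eqF.
have e0' : e != 0 by rewrite gt_eqF.
have u0 : 0 <= e / a e by rewrite divr_ge0// ltW.
have kz : k e * Num.sqrt (m * (e / a e)) ^+ 2 = m.
  rewrite sqr_sqrtr; last exact: mulr_ge0.
  by rewrite /k/=; field; rewrite a0' e0'.
have kV z : z / k e = z * (e / a e) by rewrite /k invf_div.
by rewrite /residual kz !kV ke// /vanishing; ring.
Qed.

(** The parameters are chosen in this order. The moduli of continuity [d1] and [d2],
    at precision 1, fix the a priori bound [K]. Then [eta] and [m] are chosen small
    in terms of [rho]: [eta] bounds oscillations, and [m] is the value of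
    [k * zeta ^+ 2], where [zeta] bounds the displacement of the averaged path by
    the clock. They fix the moduli [d3] and [d4], and what remains of the residual
    tends to zero with [e]. *)
Lemma mostly_linear_response S rho kappa : 0 < S -> 0 < rho -> 0 < kappa ->
  mostly P kappa (fun e y => forall X, driven T tau f fbar e 0 x (y, 0) X ->
    forall t, 0 <= t <= S ->
      `|(a e / e) *: (X t - W t) - linear_response A (fun s => vv e y (s / taubar)) t| <= rho).
Proof.
move=> S0 rho0 kappa0.
have S'0 : 0 < S / tau1 by rewrite divr_gt0.
pose S1 := Num.max (S / tau1) (S / taubar).
have S10 : 0 < S1 by rewrite lt_max S'0.
have SS1 : S / tau1 <= S1 by rewrite le_max lexx.
have SS2 : S / taubar <= S1 by rewrite le_max lexx orbT.
pose k6 := kappa / 6; have k60 : 0 < k6 by rewrite divr_gt0.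
have [d1 d10 vv1] := cvg_distr_modulus S10 ltr01 k60 (vv_cvg S10).
have [d2 d20 jv1] := tight_modulus S10 ltr01 k60 (jv_tight S10).
pose B := S1 / d1 + 1; have B0 : 0 <= B by rewrite addr_ge0// divr_ge0// ltW.
pose dt := apriori_data d tau1 tau2 Cf Lf C taubar S B d2.
pose K := 2 * dt * expR (apriori_rate d tau1 Cf C S * S).
have dt0 : 0 <= dt.
  exact: (apriori_data_ge0 tau1_gt0 tauB fC Lf0 fbar_C2 taubar0 point (ltW S0) B0 d20).
have rate0 : 0 <= apriori_rate d tau1 Cf C S.
  have CS0 : 0 <= (Cf + C + C) * S by rewrite mulr_ge0 ?addr_ge0// ltW.
  rewrite addr_ge0// addr_ge0//; last exact: mulr_ge0.
  by apply: divr_ge0; [apply: mulr_ge0 => //; exact: mulr_ge0|exact: ltW].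
have K0 : 0 <= K by rewrite !mulr_ge0// expR_ge0.
pose E3 := expR ((2 * (d%:R * C) + 1) * S); pose r0 := rho / (2 * E3).
have E30 : 0 < E3 by exact: expR_gt0.
have r00 : 0 < r0 by rewrite divr_gt0// mulr_gt0.
have q0 : 0 <= d%:R * LHc * (S / tau1).
  rewrite mulr_ge0 ?(ltW S'0)// mulr_ge0// addr_ge0// mulr_ge0// ?addr_ge0//; exact: ltW.
pose eta := r0 / 4 / (1 + d%:R * LHc * (S / tau1)).
have r40 : 0 < r0 / 4 by apply: divr_gt0.
have eta0 : 0 < eta by apply: divr_gt0 => //; exact: ltr_pwDl.
have q1 : 0 <= d%:R * C * (S / tau1) * 2.
  by apply: mulr_ge0 => //; apply: mulr_ge0 => //; exact: ltW.
pose m := Num.min 1 (r0 / 4 / (d%:R * C * (S / tau1) * 2 + 1)).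
have m0 : 0 < m by rewrite lt_min ltr01/=; apply: divr_gt0 => //; exact: ltr_wpDl.
pose E2 := expR ((2 * (tau2 * (d%:R * C)) + 1) * (S / tau1)).
have E20 : 0 < E2 by exact: expR_gt0.
pose xi := Num.sqrt m / (2 * E2).
have xi0 : 0 < xi by rewrite divr_gt0 ?sqrtr_gt0// mulr_gt0.
have [d3 d30 vv3] := cvg_distr_modulus S10 eta0 k60 (vv_cvg S10).
have [d4 d40 jv4] := tight_modulus S10 eta0 k60 (jv_tight S10).
have z5 := zz_small S10 xi0 k60.
have l6 := mostly_lap tau1_gt0 tauB mT mtau taubar0 S0 d30 k60 (lap_cvg S0).
have near1 : \forall e \near 0^'+, vanishing S d4 eta m K e <= r0 / 4 /\ a e <= 1.
  have h1 : \forall e \near 0^'+, vanishing S d4 eta m K e < r0 / 4.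
    exact: (cvgr_lt _ (vanishing_cvg0 S d4 eta m K) _ r40).
  have h2 : \forall e \near 0^'+, a e < 1 by exact: (cvgr_lt _ a_cvg0 _ ltr01).
  by move: h1 h2; apply: filterS2 => e h1 h2; split; exact: ltW.
have -> : kappa = k6 + k6 + k6 + k6 + k6 + k6 by rewrite /k6; field.
apply: mostlyW near1 _ (mostlyI (mostlyI (mostlyI (mostlyI (mostlyI vv1 jv1) vv3) jv4) z5) l6).
move=> e y e0 [van ae1] [[[[[hv1 hj2] hv3] hj4] hz] hl] X XE t tS.
have ke0 := k_gt0 e0; have a0 := a_gt0 e0.
have vvE s : 0 <= s -> vv e y s = fluctuation T tau f taubar W e (k e) y s.
  by move=> s0; exact: fluctuation_processE.
have vv00 : vv e y 0 = 0 by rewrite /fluctuation_process mul0r mxint_xx scaler0.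
have zz00 : zz e y 0 = 0 by rewrite /roof_process mul0r mxint_xx scaler0.
have in1 s : 0 <= s <= S / tau1 -> s \in `[0, S1].
  by move=> /andP[s0 sS]; rewrite in_itv/= s0 (le_trans sS).
have z_in1 : 0 \in `[0, S1] by rewrite in_itv/= lexx ltW.
have u0 : 0 <= e / a e by rewrite divr_ge0// ltW.
(* This order of magnitude is what the normalisation [Num.sqrt (e * a e)] of the
   roof process gives; it makes [k * zeta ^+ 2] equal to [m]. *)
pose zeta := Num.sqrt (m * (e / a e)).
have zeta0 : 0 <= zeta by exact: sqrtr_ge0.
have zB s : 0 <= s <= S / tau1 -> `|W (clock T tau e y s) - w s| <= zeta.
  move=> sS; have xu : 0 <= Num.sqrt (e / a e) * xi by rewrite mulr_ge0 ?sqrtr_ge0// ltW.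
  apply: le_trans (averaged_clock_deviation tau1_gt0 tauB bC bL dC0 taubar0 W_ode e0 (ltW S'0) xu _ sS) _.
    move=> u /[dup] uS /andP[u0' _]; rewrite roof_processE// normrZ ger0_norm ?sqrtr_ge0//.
    rewrite ler_wpM2l ?sqrtr_ge0// -[zz e y u]subr0 -zz00; apply: hz => //; first exact: in1.
    rewrite subr0 ger0_norm//; by move: (in1 _ uS); rewrite in_itv/= => /andP[].
  apply: (@le_trans _ _ (2 * (Num.sqrt (e / a e) * xi) * E2)).
    apply: ler_wpM2l; first exact: mulr_ge0.
    rewrite ler_expR; have /andP[_ sS'] := sS; rewrite ler_wpM2l// addr_ge0//.
    by do 2 apply: mulr_ge0 => //.
  rewrite /zeta (@sqrtrM _ m (e / a e)) ?(ltW m0)// /xi le_eqVlt; apply/orP; left; apply/eqP.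
  by field; rewrite gt_eqF.
have kz : k e * zeta ^+ 2 <= 1.
  rewrite /zeta sqr_sqrtr; last by rewrite mulr_ge0// ltW.
  have -> : k e * (m * (e / a e)) = m by rewrite /k/=; field; rewrite !gt_eqF.
  by rewrite ge_min lexx.
have jvo dl et : osc S1 dl et (jv e y) -> forall p q, 0 <= p -> p <= q -> q <= S / tau1 ->
    q - p <= dl -> `|mxint p q (dfluctuation T tau f taubar W e (k e) y)| <= et.
  move=> H p q p0 pq qS qp; rewrite -(dfluctuation_processE y e0 p0 pq); apply: H.
  - by apply: in1; rewrite (le_trans p0).
  - by apply: in1; rewrite p0 (le_trans pq).
  - by rewrite ger0_norm// subr_ge0.
have EK s : 0 <= s <= S -> k e * `|X s - W s| <= K.
  move=> /[dup] sS /andP[s0 sS'].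
  apply: le_trans (apriori_bound tau1_gt0 tauB mT mtau mf fC fL Lf0 F_C2 fbar_C2 taubar0 W_ode
    e0 ke0 XE (ltW S0) B0 d20 zeta0 kz _ _ zB (jvo _ _ hj2) sS) _.
  - by rewrite ke.
  - move=> u /[dup] uS /andP[u0' _]; rewrite -vvE//.
    by apply: (steps_bound d10 vv00 hv1); have := in1 _ uS; rewrite in_itv.
  - by rewrite ler_wpM2l ?mulr_ge0// ler_expR ler_wpM2l.
have vN s : 0 <= s <= S -> `|fluctuation T tau f taubar W e (k e) y (e * (lap (s / e) y)%:R) -
    fluctuation T tau f taubar W e (k e) y (s / taubar)| <= eta.
  move=> /[dup] sS /andP[s0 sS'].
  have n0 : 0 <= e * (lap (s / e) y)%:R by rewrite mulr_ge0// ltW.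
  have st0 : 0 <= s / taubar by rewrite divr_ge0// ltW.
  rewrite -!vvE//; apply: hv3; last exact: hl.
    apply: in1; rewrite n0/=; apply: le_trans (slow_lap_bound T tau1_gt0 tauB e0 y s0) _.
    by rewrite ler_wpM2r// invr_ge0 ltW.
  rewrite in_itv/= st0/=; apply: le_trans SS2.
  by rewrite ler_wpM2r// invr_ge0 ltW.
have /andP[t0 tS'] := tS.
have := error_linear_response tau1_gt0 tauB mT mtau mf fC fL Lf0 F_C2 fbar_C2 taubar0 W_ode
    e0 ke0 XE (ltW S0) d40 (ltW eta0) zeta0 K0 EK vN zB (jvo _ _ hj4) tS.
have := vvE.
generalize (fluctuation T tau f taubar W e (k e) y) (fluctuation_process e y) => FL V VFL.
rewrite (eq_linear_response A (V' := fun s => V (s / taubar)) _ t0); last first.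
  by move=> s /andP[s0 _]; rewrite VFL// divr_ge0// ltW.
move: (linear_response A _ t) => LV.
move=> /le_trans; apply; rewrite residualE//; last exact: ltW.
apply: (@le_trans _ _ (2 * r0 * E3)); last first.
  by rewrite /r0 le_eqVlt; apply/orP; left; apply/eqP; field; rewrite gt_eqF.
have e1 : eta * (1 + d%:R * LHc * (S / tau1)) = r0 / 4.
  by rewrite /eta divfK// gt_eqF// ltr_pwDl.
have e2 : d%:R * C * (S / tau1) * 2 * m <= r0 / 4.
  apply: (@le_trans _ _ ((d%:R * C * (S / tau1) * 2 + 1) * m)); first by rewrite ler_wpM2r ?lerDl// ltW.
  by rewrite mulrC -ler_pdivlMr ?ltr_wpDl// ge_min lexx orbT.
apply: (@le_trans _ _ (2 * r0 * expR ((2 * (d%:R * C) + 1) * t))).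
  by rewrite ler_wpM2r ?expR_ge0// ler_wpM2l// e1; lra.
rewrite ler_wpM2l//; first by rewrite mulr_ge0// ltW.
by rewrite ler_expR ler_wpM2l// addr_ge0// mulr_ge0.
Qed.

End closeness.

(** * Strong convergence in distribution *)

Section base_law.
Context dM (M : measurableType dM) (R : realType).
Context (mu : {sigma_finite_measure set M -> \bar R}) (tau : M -> R) (mtau : measurable_fun setT tau).
Local Notation RM := (measurableTypeR R).
Context (P1 : probability (M * RM)%type R).
Hypothesis P1_ac : P1 `<< susp_measure mu mtau.

Definition base_law : probability M R :=
  distribution P1 (mfun_Sub (mem_set (@measurable_fst _ _ M RM))).

Let ac (A : set (M * RM)) : measurable A ->
  (mu \x (@lebesgue_measure R))%E (A `&` susp tau) = 0%E -> P1 A = 0%E.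
Proof.
move=> mA A0; have /null_content_dominatesP H : P1 `<< mrestr (mu \x (@lebesgue_measure R))%E (measurable_susp mtau) by exact: P1_ac.
exact: H.
Qed.

Lemma base_law_ac : content_dominates mu base_law.
Proof.
move=> A mA A0; have mAT : measurable (A `*` [set: RM]) by exact: measurableX.
have -> : base_law A = P1 (A `*` [set: RM]).
  by congr (P1 _); apply/seteqP; split => [p Ap|p []].
apply: ac => //; apply/eqP; rewrite eq_le measure_ge0 andbT.
apply: (@le_trans _ _ ((mu \x (@lebesgue_measure R))%E (A `*` [set: RM]))).
  by apply: le_measure; rewrite ?inE//; apply: measurableI => //; exact: measurable_susp.
by rewrite product_measure1E// A0 mul0e.
Qed.

Lemma law_susp : P1 (~` susp tau) = 0%E.
Proof.
apply: ac; first by apply: measurableC; exact: measurable_susp.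
by rewrite setICl measure0.
Qed.

Lemma base_law_integral (H : M -> R) K : measurable_fun setT H -> (forall y, `|H y| <= K) ->
  \int[base_law]_y H y = \int[P1]_(p in susp tau) H p.1.
Proof.
move=> mH HK; have mHe : measurable_fun setT (EFin \o H) by exact/measurable_EFinP.
have mfst := @measurable_fst _ _ M RM.
have mH1 : measurable_fun setT (H \o fst : M * RM -> R) by exact: measurableT_comp.
have i1 : P1.-integrable setT (EFin \o (H \o fst)).
  by apply: (@bounded_integrable _ _ _ _ _ _ K) => // p _; exact: HK.
have iHT : P1.-integrable (fst @^-1` [set: M]) ((EFin \o H) \o fst) by rewrite preimage_setT.
have E1 := integral_pushforward mfst mHe iHT measurableT; rewrite preimage_setT in E1.
have mS := measurable_susp mtau.
have E2 := @negligible_integral _ _ _ P1 setT (~` susp tau) (EFin \o (H \o fst)) (measurableC mS) measurableT i1 law_susp.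
rewrite setDE setTI setCK in E2.
by rewrite /Rintegral -E2 -E1.
Qed.

End base_law.

Section response_functional.
Context {R : realType} (n : nat) (A : R -> 'M[R]_n) (S C taubar : R).
Hypotheses (S0 : 0 < S) (taubar0 : 0 < taubar) (C0 : 0 <= C).
Hypotheses (bA : bounded_meas 0 S A) (AC : forall r, r \in `[0, S] -> `|A r| <= C).
Local Notation V := 'rV[R]_n.
Local Notation S' := (S / taubar).

(** The limit error as a function of the limit fluctuation. *)
Definition response (h : R -> V) (t : R) : V := linear_response A (fun s => h (s / taubar)) t.

Let in_S' s : s \in `[0, S] -> s / taubar \in `[0, S'].
Proof.
rewrite !in_itv/= => /andP[s0 sS]; rewrite divr_ge0 ?(ltW taubar0)//=.
by rewrite ler_wpM2r// invr_ge0 ltW.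
Qed.

Let scaled_cpaths (h : R -> V) : @cpaths R V S' h -> @cpaths R V S (fun s => h (s / taubar)).
Proof.
move=> /cpathsP ch; apply/cpathsP => s e sS e0.
have [r r0 hr] := ch _ e (in_S' sS) e0; exists (r * taubar); first exact: mulr_gt0.
move=> t tS st; apply: hr; first exact: in_S'.
by rewrite -mulrBl normrM [`|taubar^-1|]gtr0_norm ?invr_gt0// ltr_pdivrMr.
Qed.

Let bh (h : R -> V) : @cpaths R V S' h -> bounded_meas 0 S (fun s => h (s / taubar)).
Proof. by move=> ch; apply: continuous_bounded_meas; exact: scaled_cpaths. Qed.

Lemma response_cpaths (h : R -> V) : @cpaths R V S' h -> @cpaths R V S (response h).
Proof.
move=> ch; have cV := scaled_cpaths ch; have [L HL] := linear_response_lipschitz bA AC C0 (bh ch).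
have cd := lipschitz_within_continuous HL.
have : {within `[0, S], continuous ((fun s => linear_response A (fun s0 => h (s0 / taubar)) s - h (s / taubar)) + (fun s => h (s / taubar)))}.
  by move=> s; apply: continuousD; [exact: cd|exact: cV].
rewrite (_ : _ + _ = response h)//.
by apply/funext => s; rewrite /response -[LHS]/(_ - _ + _) subrK.
Qed.

Lemma response_lipschitz : exists2 L, 0 <= L & forall h h' e, @cpaths R V S' h -> @cpaths R V S' h' ->
  0 <= e -> (forall t, t \in `[0, S'] -> `|h t - h' t| <= e) ->
  forall t, t \in `[0, S] -> `|response h t - response h' t| <= L * e.
Proof.
exists (1 + n%:R * (n%:R * C) * (2 * expR ((2 * (n%:R * C) + 1) * S)) * S).
  by rewrite addr_ge0// !mulr_ge0 ?expR_ge0// ltW.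
move=> h h' e ch ch' e0 hh' t; rewrite in_itv/= => tS.
rewrite /response (linear_responseB bA AC C0 (bh ch) (bh ch') tS).
apply: (linear_response_bounded bA AC C0) => //; first exact: bounded_measB (bh ch) (bh ch').
by move=> s sS; apply: hh'; exact: in_S'.
Qed.

Lemma response_process dO (O : measurableType dO) (v : O -> R -> V) :
  continuous_process setT S' v -> continuous_process setT S (fun u => response (v u)).
Proof.
move=> cv; have cv1 u : @cpaths R V S' (v u) by case: cv => + _; exact.
have S'0 : 0 < S' by rewrite divr_gt0.
split=> [u _|t tS]; first exact: response_cpaths.
apply: borel_mx_measurable => // i j.
have [L L0 HL] := response_lipschitz.
apply: (measurable_path_functional S'0 measurableT cv (g := fun h => response h t i j)).
apply: (@path_lipschitz_continuous _ _ _ L) => h h' e ch ch' e0 hh'.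
apply: le_trans (HL h h' e ch ch' e0 hh' t tS).
by have := mxnorm_entry (response h t - response h' t) i j; rewrite !mxE.
Qed.

Lemma response_lipschitz_comp (g : {uniform` `[0, S] -> V} -> R) L : 0 <= L ->
  path_lipschitz S L g -> {within @cpaths R V S', continuous (fun h => g (response h) : R)}.
Proof.
move=> L0 gL; have [L' L'0 HL] := response_lipschitz.
apply: (@path_lipschitz_continuous _ _ _ (L * L')) => h h' e ch ch' e0 hh'.
rewrite -mulrA; apply: gL; [exact: response_cpaths|exact: response_cpaths|exact: mulr_ge0|].
exact: HL.
Qed.

End response_functional.

Section strong.
Context dM (M : measurableType dM) (R : realType) (d : nat).
Context (mu : {sigma_finite_measure set M -> \bar R}) (T : M -> M).
Hypotheses (T_preserving : measure_preserving mu T)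
  (T_conservative : conservative mu T) (T_ergodic : ergodic mu T).
Context (tau : M -> R) (tau1 tau2 : R).
Hypotheses (tau1_gt0 : 0 < tau1) (tauB : forall y, tau1 <= tau y <= tau2).
Hypothesis (mtau : measurable_fun setT tau).
Local Notation RM := (measurableTypeR R).
Context (f : 'rV[R]_d -> M * RM -> 'rV[R]_d) (Cf Lf : R).
Hypothesis mf : measurable_fun setT
  (fun p : borel 'rV[R]_d * (M * RM) => f p.1 p.2 : borel 'rV[R]_d).
Hypotheses (fC : forall x p, `|f x p| <= Cf)
  (fL : forall x y p, `|f x p - f y p| <= Lf * `|x - y|) (Lf0 : 0 <= Lf).
Context (fbar : 'rV[R]_d -> 'rV[R]_d) (C : R).
Hypotheses (F_C2 : forall y, C2_bounded C ((roof_integral tau f) ^~ y))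
  (fbar_C2 : C2_bounded C fbar).
Context (taubar : R) (taubar0 : 0 < taubar).
Context (x : 'rV[R]_d) (W : R -> 'rV[R]_d).
Hypothesis W_ode : ode_solution fbar x W.
Context (a : R -> R) (a_gt0 : forall e, 0 < e -> 0 < a e).
Hypotheses (a_cvg0 : a e @[e --> 0^'+] --> 0) (ea_cvg0 : e / a e @[e --> 0^'+] --> 0).
Context (mubar : probability M R) (mubar_ac : mubar `<< mu).
Context (dO : measure_display) (O : measurableType dO).
Context (P' : probability O R) (v : O -> R -> 'rV[R]_d).

Local Notation vv := (fluctuation_process T tau f taubar W a).
Local Notation jv := (dfluctuation_process T tau f taubar W a).
Local Notation zz := (roof_process T tau fbar taubar W a).

Hypothesis vv_cvg : forall S, 0 < S -> cvg_distr_C S mubar setT vv P' v.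
Hypothesis jv_tight : forall S, 0 < S -> tight_C S mubar jv.
Hypothesis zz_cvg : forall S, 0 < S -> cvg_distr_C S mubar setT zz mubar (fun _ _ => 0).
Hypothesis lap_cvg : forall S, 0 < S ->
  cvg_prob_unif S mubar (fun e y t => e * (lap T tau (t / e) y)%:R) (fun t => t / taubar).

Context (X : R -> M * RM -> R -> 'rV[R]_d).
Hypothesis XE : forall e p, 0 < e -> susp tau p -> driven T tau f fbar e 0 x p (X e p).

Context (P1 : probability (M * RM)%type R).
Hypothesis P1_ac : P1 `<< susp_measure mu mtau.

Local Notation Z := (fun e p t => (a e / e) *: (X e p t - W t)).
Local Notation A := (fun u => 'J fbar (W u)).
Local Notation Y := (fun u t => response A taubar (v u) t).

Let mT : measurable_fun setT T. Proof. by case: T_preserving. Qed.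
Let C0 : 0 <= C. Proof. exact: C2_bounded_ge0 fbar_C2. Qed.
Let dC0 : 0 <= d%:R * C. Proof. exact: mulr_ge0. Qed.
Let bC u : `|fbar u| <= C. Proof. by have [_ _ h _ _] := fbar_C2. Qed.
Let bL u u' : `|fbar u - fbar u'| <= d%:R * C * `|u - u'|.
Proof. exact: C2_bounded_lipschitz. Qed.
Let Cf0 : 0 <= Cf. Proof. exact: Cf_ge0 fC (point, 0). Qed.
Let tau2_ge0 : 0 <= tau2.
Proof. by have /andP[h1 h2] := tauB point; rewrite (le_trans _ h2)// (le_trans _ h1)// ltW. Qed.
Let ps y : susp tau (y, 0). Proof. exact: susp_zero tau1_gt0 tauB y. Qed.
Let mS : measurable (susp tau : set (M * RM)). Proof. exact: measurable_susp. Qed.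

Let WL s t : 0 <= s -> 0 <= t -> `|W s - W t| <= C * `|s - t|.
Proof. exact: (averaged_lipschitz bC bL dC0 W_ode). Qed.

Let bA S : bounded_meas 0 S A.
Proof.
apply: (@lipschitz_bounded_meas _ _ _ _ _ (C * C)) => s t.
rewrite !in_itv/= => /andP[s0 _] /andP[t0 _].
apply: le_trans (C2_bounded_jacobian_lipschitz fbar_C2 _ _) _.
by rewrite -mulrA ler_wpM2l//; exact: WL.
Qed.

Let AC S r : r \in `[0, S] -> `|A r| <= C.
Proof. by move=> _; have [_ _ _ h _] := fbar_C2; exact: h. Qed.

Let k_gt0 e : 0 < e -> 0 < a e / e. Proof. by move=> e0; rewrite divr_gt0// a_gt0. Qed.

Lemma error_process S e : 0 < e -> continuous_process (susp tau) S (Z e).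
Proof.
move=> e0; have k0 := k_gt0 e0; split=> [p psp|t].
  apply: (@lipschitz_within_continuous _ _ _ _ (a e / e * ((Cf + C) + C))) => s t.
  rewrite !in_itv/= => /andP[s0 _] /andP[t0 _].
  rewrite -scalerBr normrZ gtr0_norm// -mulrA ler_wpM2l//; first exact: ltW.
  rewrite opprD addrACA -opprD; apply: le_trans (ler_normB _ _) _; rewrite mulrDl; apply: lerD.
    exact: (driven_lipschitz tau1_gt0 tauB mT mtau mf fC bC bL dC0 e0 (lexx 0) psp (XE e0 psp)).
  by apply: WL.
rewrite in_itv/= => /andP[t0 _]; apply: borel_mx_measurable => // i j.
apply: (eq_measurable_fun (fun p => a e / e * (X e p t i j - W t i j))).
  by move=> p _; rewrite !mxE.
apply: measurable_funM => //; apply: measurable_funB => //.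
exact: (measurable_driven tau1_gt0 tauB mT mtau mf fC fL bC bL Lf0 dC0 e0 (fun p => @XE e p e0)).
Qed.

Lemma response_process_limit S : 0 < S -> continuous_process setT S Y.
Proof.
move=> S0; have S'0 : 0 < S / taubar by rewrite divr_gt0.
have [_ cv _] := vv_cvg S'0.
exact: (response_process S0 taubar0 C0 (bA S) (@AC S) cv).
Qed.

Local Notation shift_const S := (tau2 * (Cf + C) * (1 + 2 * expR ((2 * (Lf + d%:R * C) + 1) * S))).

(** Two starting points on the same orbit of the flow, at most [tau2] apart, have
    normalised errors that differ by [O(a_e)]. *)
Lemma error_shift S e r y p : 0 < S -> 0 < e -> 0 <= r <= tau2 -> susp tau p ->
  (forall t, 0 <= t -> susp_flow T tau t p = susp_flow T tau (t + r) (y, 0)) ->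
  forall t, t \in `[0, S] -> `|Z e p t - Z e (y, 0) t| <= a e * shift_const S.
Proof.
move=> S0 e0 /andP[r0 r2] pp flowE t tS; have k0 := k_gt0 e0.
have X'E : driven T tau f fbar e r x (y, 0) (X e p).
  have [c1 c2] := XE e0 pp; split => // u u0; rewrite c2//; congr (_ + _).
  apply: eq_mxint => s; rewrite in_itv/= => /andP[s0 _].
  by rewrite addr0 flowE// divr_ge0// ltW.
have tS' : 0 <= t <= S by move: tS; rewrite in_itv.
have := driven_shift tau1_gt0 tauB mT mtau mf fC fL bC bL Lf0 dC0 e0 r0 (ps y) (ltW S0) (XE e0 (ps y)) X'E tS'.
move=> h; rewrite -scalerBr opprB addrA subrK normrZ gtr0_norm//.
apply: (@le_trans _ _ (a e / e * (e * r * (Cf + C) * (1 + 2 * expR ((2 * (Lf + d%:R * C) + 1) * S))))).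
  by rewrite ler_wpM2l// ltW.
rewrite (_ : a e / e * _ = a e * (r * (Cf + C) * (1 + 2 * expR ((2 * (Lf + d%:R * C) + 1) * S)))); last first.
  by field; rewrite gt_eqF.
rewrite ler_wpM2l//; first by rewrite ltW// a_gt0.
rewrite ler_wpM2r//.
by rewrite ler_wpM2r// addr_ge0.
Qed.

Section functional.
Context (S : R) (S0 : 0 < S) (g : {uniform` `[0, S] -> 'rV[R]_d} -> R) (L K : R).
Hypotheses (L0 : 0 <= L) (gL : path_lipschitz S L g) (gK : forall h, @cpaths R 'rV[R]_d S h -> `|g h| <= K).

Let H e y := g (Z e (y, 0)).

Let cg : {within @cpaths R 'rV[R]_d S, continuous g}.
Proof. exact: path_lipschitz_continuous gL. Qed.

Let S'0 : 0 < S / taubar. Proof. by rewrite divr_gt0. Qed.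

Let K0 : 0 <= K.
Proof. by apply: le_trans (gK (h := fun=> 0) _) => // t; exact: cvg_cst. Qed.

Let base_process e : 0 < e -> continuous_process setT S (fun y => Z e (y, 0)).
Proof.
move=> e0; have [cZ mZ] := error_process S e0; split => [y _|t tS]; first exact: cZ.
have mpair := @measurable_funTS _ _ _ _ setT _ (@pair2_measurable _ _ M RM 0).
apply: (measurable_comp mS _ (mZ t tS) mpair) => _ [y _ <-]; exact: ps.
Qed.

Let mH e : 0 < e -> measurable_fun setT (H e).
Proof. by move=> e0; exact: (measurable_path_functional S0 measurableT (base_process e0) cg). Qed.

Let HK e y : 0 < e -> `|H e y| <= K.
Proof. by move=> e0; apply: gK; have [h _] := base_process e0; exact: h. Qed.

(** Up to an event of small probability the error is close to the response to [vv],
    and the response is a continuous functional of the path. *)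
Let H_cvg : \int[mubar]_y H e y @[e --> 0^'+] --> \int[P']_u g (Y u).
Proof.
have cgr := response_lipschitz_comp S0 taubar0 C0 (bA S) (@AC S) L0 gL.
have [cvv cv wv] := vv_cvg S'0.
have rc := response_cpaths taubar0 C0 (bA S) (@AC S).
have grK h : @cpaths R 'rV[R]_d (S / taubar) h -> `|g (response A taubar h)| <= K.
  by move=> ch; apply: gK; exact: rc.
have lim := wv _ cgr (ex_intro _ K grK).
apply/cvgrPdist_le => eps eps0.
have e2 : 0 < eps / 2 by rewrite divr_gt0.
pose rho := eps / 4 / (L + 1); pose kap := eps / 4 / (2 * K + 1).
have rho0 : 0 < rho by rewrite /rho !divr_gt0// ltr_wpDl.
have kap0 : 0 < kap by rewrite /kap !divr_gt0// ltr_wpDl// mulr_ge0.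
have close := mostly_linear_response tau1_gt0 tauB mT mtau mf fC fL Lf0 F_C2 fbar_C2 taubar0 W_ode
  a_gt0 a_cvg0 ea_cvg0 vv_cvg jv_tight zz_cvg lap_cvg S0 rho0 kap0.
have /cvgrPdist_le/(_ _ e2) := lim; move: close.
apply: filterS3 (nbhs_right_gt 0) => e e0 [B [mB PB HB]] hlim.
have mgr : measurable_fun setT (fun y => g (response A taubar (vv e y))).
  exact: (measurable_path_functional S'0 measurableT (cvv e e0) cgr).
have := @Rintegral_close _ _ _ mubar setT B (H e) (fun y => g (response A taubar (vv e y))) K (L * rho)
  measurableT (mH e0) mgr (mulr_ge0 L0 (ltW rho0)) K0 (fun y _ => HK y e0) _ mB _.
have cvvy y : @cpaths R 'rV[R]_d (S / taubar) (vv e y) by have [h _] := cvv e e0; exact: h.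
move=> /(_ (fun y _ => grK _ (cvvy y)) _) h.
have {h} := h _; rewrite -/(H e) => h.
have PB' : fine (mubar B) <= kap by rewrite -lee_fin fineK// fin_num_measure.
have r1 : L * rho <= eps / 4.
  by rewrite /rho mulrCA ler_piMr ?(ltW (divr_gt0 _ _))// ler_pdivrMr ?mul1r ?lerDl// ltr_wpDl.
have r2 : 2 * K * fine (mubar B) <= eps / 4.
  apply: (@le_trans _ _ (2 * K * kap)); first by rewrite ler_wpM2l ?mulr_ge0.
  by rewrite /kap mulrCA ler_piMr ?(ltW (divr_gt0 _ _))// ler_pdivrMr ?mul1r ?lerDl// ltr_wpDl// mulr_ge0.
rewrite -(subrKA (\int[mubar]_y g (response A taubar (vv e y)))).
apply: le_trans (ler_normD _ _) _; rewrite [eps]splitr lerD//.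
rewrite distrC; apply: le_trans (h _) _; last by lra.
move=> y _ nBy; apply: gL => //; [by have [h' _] := base_process e0; exact: h'|exact: rc|exact: ltW|].
by move=> t; rewrite in_itv/= => tS; exact: HB (XE e0 (ps y)) _ tS.
Qed.

(** Moving the base point from [y] to [T y], or the starting point from [(y, 0)] to
    [(y, s)], changes the error by [O(a_e)]. Hence [H] is asymptotically invariant
    and converges under the law of the base point as it does under [mubar], and
    the height [s] does not matter in the limit. *)
Lemma functional_cvg : \int[P1]_(p in susp tau) g (Z e p) @[e --> 0^'+] --> \int[P']_u g (Y u).
Proof.
pose c e := L * (a e * shift_const S).
have c0 : c e @[e --> 0^'+] --> 0.
  suff : c e @[e --> 0^'+] --> L * (0 * shift_const S) by rewrite mul0r mulr0.
  by apply: cvgM; [exact: cvg_cst|apply: cvgM => //; exact: cvg_cst].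
have sc0 : 0 <= shift_const S.
  by rewrite mulr_ge0 ?mulr_ge0 ?addr_ge0// mulr_ge0// expR_ge0.
have ac0 e : 0 < e -> 0 <= a e * shift_const S by move=> e0; rewrite mulr_ge0// ltW// a_gt0.
have cZ e p : 0 < e -> susp tau p -> @cpaths R 'rV[R]_d S (Z e p).
  by move=> e0 pp; have [h _] := error_process S e0; exact: h.
have Hc e y : 0 < e -> `|H e (T y) - H e y| <= c e.
  move=> e0; apply: gL; [exact: cZ|exact: cZ|exact: ac0|].
  have /andP[t1 t2] := tauB y.
  apply: (@error_shift S e (tau y)) => //; first by rewrite t2 andbT (le_trans _ t1)// ltW.
  by move=> t t0; exact: (susp_flow_base T tau1_gt0 tauB y t0).
have mubar_ac' := (null_content_dominatesP _ _).1 mubar_ac.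
have lim := asymptotic_invariance T_preserving T_conservative T_ergodic mubar_ac'
  (base_law_ac P1_ac) mH HK Hc c0 H_cvg.
apply/cvgrPdist_le => eps eps0; have e2 : 0 < eps / 2 by rewrite divr_gt0.
have /cvgrPdist_le/(_ _ e2) := lim; have /cvgrPdist_le/(_ _ e2) := c0.
apply: filterS3 (nbhs_right_gt 0) => e e0 hc hlim.
rewrite (base_law_integral P1_ac (mH e0) (fun y => HK y e0)) in hlim.
have mgZ : measurable_fun (susp tau) (fun p => g (Z e p)).
  exact: (measurable_path_functional S0 mS (error_process S e0) cg).
have mgH : measurable_fun (susp tau) (fun p : M * RM => H e p.1).
  by apply: measurable_funTS; exact: measurableT_comp (mH e0) _.
have := @Rintegral_close _ _ _ P1 (susp tau) set0 (fun p : M * RM => H e p.1) (fun p => g (Z e p)) K (c e)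
  mS mgH mgZ _ K0 _ _ measurable0 _.
rewrite measure0 /= mulr0 addr0 => h.
rewrite -(subrKA (\int[P1]_(p in susp tau) H e p.1)) (le_trans (ler_normD _ _))// [eps]splitr lerD//.
apply: le_trans (h _ _ _ _) _ => //.
- by rewrite mulr_ge0// ac0.
- by move=> p pp; apply: HK.
- by move=> p pp; apply: gK; exact: cZ.
- move=> [y s] pp _ /=; rewrite distrC; apply: gL; [exact: cZ|exact: cZ|exact: ac0|].
  have := pp; rewrite /susp/= => /andP[s0 sy]; have /andP[_ t2] := tauB y.
  apply: (@error_shift S e s) => //; first by rewrite s0 (le_trans (ltW sy)).
  by move=> t _; exact: susp_flow_fibre.
- by move: hc; rewrite sub0r normrN; apply: le_trans; exact: ler_norm.
Qed.

End functional.

Lemma strong_linear_response S : 0 < S -> cvg_distr_C S P1 (susp tau) Z P' Y.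
Proof.
move=> S0; split; [by move=> e e0; exact: error_process|exact: response_process_limit|].
apply: weak_cvg_lipschitz => //; [by move=> e e0; exact: error_process|exact: response_process_limit|].
by move=> g L K L0 gL gK; exact: functional_cvg L0 gL gK.
Qed.

End strong.

Section extension.
Context dM (M : measurableType dM) (R : realType) (n : nat) (tau : M -> R).
Local Notation RM := (measurableTypeR R).
Hypothesis (mtau : measurable_fun setT tau).
Context (f : 'rV[R]_n -> M * RM -> 'rV[R]_n).
Hypothesis mf : measurable_fun ([set: borel 'rV[R]_n] `*` susp tau)
  (fun p : borel 'rV[R]_n * (M * RM) => f p.1 p.2 : borel 'rV[R]_n).

(** Only the values of [f] on the suspension matter; extended by zero, [f] is
    measurable, bounded and Lipschitz everywhere. *)
Definition extend0 (x : 'rV[R]_n) (p : M * RM) : 'rV[R]_n := if p \in susp tau then f x p else 0.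

Lemma extend0E x p : susp tau p -> extend0 x p = f x p.
Proof. by move=> /mem_set h; rewrite /extend0 h. Qed.

Lemma measurable_extend0 : measurable_fun setT
  (fun p : borel 'rV[R]_n * (M * RM) => extend0 p.1 p.2 : borel 'rV[R]_n).
Proof.
have mD : measurable ([set: borel 'rV[R]_n] `*` susp tau).
  by apply: measurableX => //; exact: measurable_susp.
have := measurable_fun_patch (0 : borel 'rV[R]_n) mD mf.
apply: eq_measurable_fun => -[z p] _; rewrite /extend0.
by rewrite in_setX/= in_setT.
Qed.

Lemma extend0_bounded C : (forall x p, susp tau p -> `|f x p| <= C) ->
  forall x p, `|extend0 x p| <= `|C|.
Proof.
move=> fC x p; rewrite /extend0; case: ifPn => [|_]; last by rewrite normr0.
by rewrite inE => pp; apply: le_trans (fC x p pp) (ler_norm _).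
Qed.

Lemma extend0_lipschitz L : (forall p, susp tau p -> L.-lipschitz (f ^~ p)) ->
  forall x y p, `|extend0 x p - extend0 y p| <= `|L| * `|x - y|.
Proof.
move=> fL x y p; rewrite /extend0; case: ifPn => [|_]; last by rewrite subrr normr0 mulr_ge0.
rewrite inE => pp; have := fL p pp (x, y) (conj I I) => /= h.
by apply: le_trans h _; rewrite ler_wpM2r// ler_norm.
Qed.

Lemma roof_integral_extend0 : (forall y, 0 < tau y) ->
  roof_integral tau f = roof_integral tau extend0.
Proof.
move=> tau0; apply/funext => x; apply/funext => y; apply/matrixP => i j; rewrite !mxE.
have co (h : R -> R) : measurable_fun `[0, tau y[%classic h ->
    \int[lebesgue_measure]_(s in `[0, tau y]) h s = \int[lebesgue_measure]_(s in `[0, tau y[) h s.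
  by move=> mh; rewrite /Rintegral -integral_itv_bndo_bndc//; exact/measurable_EFinP.
have mext : measurable_fun `[0, tau y[%classic (fun s : R => extend0 x (y, s) i j).
  apply: borel_mx_entry.
  have mpair : measurable_fun setT (fun s : RM => (x : borel 'rV[R]_n, (y, s))).
    apply: measurable_fun_pairD => //; exact: measurable_fun_pairD.
  by apply: measurable_funTS; exact: measurableT_comp measurable_extend0 mpair.
have eqf s : s \in `[0, tau y[ -> extend0 x (y, s) i j = f x (y, s) i j.
  by rewrite in_itv/= => sy; rewrite extend0E.
have mfx : measurable_fun `[0, tau y[%classic (fun s : R => f x (y, s) i j).
  by apply: eq_measurable_fun mext => s; rewrite inE/= => /eqf.
by rewrite !co//; apply: eq_Rintegral => s; rewrite inE/= => /eqf.
Qed.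

End extension.

Lemma roof_bounds dM (M : measurableType dM) (R : realType) (tau : M -> R) :
  (forall y, 0 < tau y) -> has_ubound (range tau) ->
  forall y, inf (range tau) <= tau y <= sup (range tau).
Proof.
move=> tau0 tauub y; apply/andP; split.
  by apply: ge_inf; [exists 0 => _ [z _ <-]; exact: ltW|exists y].
by apply: ub_le_sup => //; exists y.
Qed.

Theorem theorem5p4 (R : realType) (d : nat)
    (dM : measure_display) (M : measurableType dM)
    (mu : {sigma_finite_measure set M -> \bar R}) (T : M -> M)
    (mu_infinite : mu [set: M] = +oo%E)
    (T_preserving : measure_preserving mu T)
    (T_conservative : conservative mu T) (T_ergodic : ergodic mu T)
    (tau : M -> R) (tau_measurable : measurable_fun setT tau)
    (tau_gt0 : forall y, 0 < tau y)
    (tau_inf : 0 < inf (range tau)) (tau_sup : has_ubound (range tau))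
    (f : 'rV[R]_d -> M * measurableTypeR R -> 'rV[R]_d)
    (f_measurable : measurable_fun
       ([set: borel 'rV[R]_d] `*` susp tau)
       (fun p : borel 'rV[R]_d * (M * measurableTypeR R) =>
          f p.1 p.2 : borel 'rV[R]_d))
    (f_bounded : exists C : R, forall x p, susp tau p -> `|f x p| <= C)
    (f_lipschitz : exists C : R, forall p, susp tau p -> C.-lipschitz (f ^~ p))
    (fbar : 'rV[R]_d -> 'rV[R]_d)
    (fbar_measurable :
       measurable_fun setT (fbar : borel 'rV[R]_d -> borel 'rV[R]_d))
    (fbar_bounded : exists C : R, forall x, `|fbar x| <= C)
    (fbar_lipschitz : exists C : R, C.-lipschitz fbar)
    (taubar : R) (taubar_gt0 : 0 < taubar)
    (W : R -> 'rV[R]_d -> 'rV[R]_d)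
    (W_ode : forall x, ode_solution fbar x (W ^~ x))
    (X : R -> 'rV[R]_d -> M * measurableTypeR R -> R -> 'rV[R]_d)
    (X_ode : forall e x p, 0 < e -> susp tau p ->
       caratheodory_solution
         (fun t z => f z (susp_flow T tau (t / e) p) + fbar z) x (X e x p))
    (mubar : probability M R) (mubar_ac : mubar `<< mu)
    (a : R -> R) (a_gt0 : forall e, 0 < e -> 0 < a e)
    (a_cvg0 : a e @[e --> 0^'+] --> 0)
    (ea_cvg0 : e / a e @[e --> 0^'+] --> 0)
    (dO : measure_display) (O : measurableType dO) (P : probability O R)
    (v : 'rV[R]_d -> O -> R -> 'rV[R]_d) :
  let F := roof_integral tau f in
  let w t x := W (taubar * t) x in
  (exists C : R,
     (forall y, C2_bounded C (F ^~ y)) /\ C2_bounded C fbar) ->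
  (forall x S, 0 < S ->
     cvg_distr_C S mubar setT
       (fun e y t => a e *: mxint 0 (t / e)
          (fun s => F (w (e * s) x) (iter (Num.truncn s) T y)))
       P (v x) /\
     tight_C S mubar
       (fun e y t => a e *: mxint 0 (t / e)
          (fun s => 'J (F ^~ (iter (Num.truncn s) T y)) (w (e * s) x)))) ->
  (forall S, 0 < S ->
     cvg_prob_unif S mubar (fun e y t => e * (lap T tau (t / e) y)%:R)
       (fun t => t / taubar)) ->
  (forall x,
     (forall S, 0 < S ->
        cvg_distr_C S mubar setT
          (fun e y t => Num.sqrt (e * a e) *: mxint 0 (t / e)
             (fun s => (tau (iter (Num.truncn s) T y) - taubar) *:
                fbar (w (e * s) x)))
          mubar (fun _ _ => 0)) /\
     cvg_distr_fd mubar
       (fun e y t => e *: mxint 0 (t / e)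
          (fun s => (tau (iter (Num.truncn s) T y) - taubar) *:
             'J fbar (w (e * s) x)))
       mubar (fun _ _ => 0)) ->
  forall x,
    strong_cvg_distr (susp_measure mu tau_measurable) (susp tau)
      (fun e p t => (a e / e) *: (X e x p t - W t x))
      P
      (fun w t => v x w (t / taubar) +
         mxint 0 t (fun s => v x w (s / taubar) *m 'J fbar (W s x) *m
                      mxexp_int (fun u => 'J fbar (W u x)) s t)).
Proof.
move=> F w [C [F_C2 fbar_C2]] vjH lapH zH x P1 P1_ac S S0.
have [Cf fC] := f_bounded; have [Lf fL] := f_lipschitz.
have tauB := roof_bounds tau_gt0 tau_sup.
have FE := roof_integral_extend0 tau_measurable f_measurable tau_gt0.
pose f' := extend0 tau f.
have XE e p : 0 < e -> susp tau p -> driven T tau f' fbar e 0 x p (X e x p).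
  move=> e0 pp; have [c1 c2] := @X_ode e x p e0 pp; split => // t t0.
  rewrite c2//; congr (_ + _); apply: eq_mxint => s; rewrite in_itv/= => /andP[s0 _].
  rewrite addr0 /f' extend0E//; apply: (susp_flow_susp T tau_inf tauB) => //.
  by rewrite divr_ge0// ltW.
rewrite /F FE in F_C2 vjH.
have H := (strong_linear_response T_preserving T_conservative T_ergodic tau_inf tauB
  (measurable_extend0 tau_measurable f_measurable) (extend0_bounded fC) (extend0_lipschitz fL)
  (normr_ge0 _) F_C2 fbar_C2 taubar_gt0 (W_ode x) a_gt0 a_cvg0 ea_cvg0 mubar_ac
  (fun S S0 => proj1 (vjH x S S0)) (fun S S0 => proj2 (vjH x S S0))
  (proj1 (zH x)) lapH (X := fun e p => X e x p) XE P1_ac S0).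
exact H.
Qed.
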